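(* Let $k$ be a field and let $G$ be a pseudo-reductive $k$-group, with associated $k'/k$, $G'$, $\pi'$ and $i_G$ as defined in the context. Let $H'$ be a subgroup of $G'$. If there exists at least one levitation (resp. smooth levitation) of $H'$ in $G$, then there exists a largest such levitation (resp. smooth levitation) of $H'$ in $G$, namely $i_G^{-1}(R_{k'/k}(H'))$ (resp. $(i_G^{-1}(R_{k'/k}(H')))^{\mathrm{sm}}$).
   Context: $\overline{k}$ is an algebraic closure of $k$ and $k^{\mathrm{s}}$ is the separable closure of $k$ in $\overline{k}$. Algebraic groups are group schemes of finite type, not assumed smooth; all groups here are affine. A subgroup is a (closed) subgroup scheme over the base field; images and preimages are scheme-theoretic. For a smooth connected affine $k$-group $G$, $\mathscr{R}_u(G)$ is the largest smooth connected unipotent normal $k$-subgroup. $G$ is pseudo-reductive if it is smooth, connected, affine and $\mathscr{R}_u(G)=1$. For a pseudo-reductive $k$-group $G$: $k'/k$ denotes the minimal field of definition (inside $\overline{k}$) for $\mathscr{R}_u(G_{\overline{k}})$, i.e. the smallest intermediate field over which this subgroup is defined (a finite purely inseparable extension of $k$); $G':=G_{k'}/\mathscr{R}_u(G_{k'})$, a reductive $k'$-group; $\pi':G_{k'}\to G'$ is the quotient map; $R_{k'/k}$ is Weil restriction, right adjoint to base change $(-)_{k'}$; and $i_G:G\to R_{k'/k}(G')$ is the $k$-homomorphism corresponding to $\pi'$ under this adjunction. For a subgroup $H'$ of $G'$, $R_{k'/k}(H')$ is regarded as a subgroup of $R_{k'/k}(G')$. A levitation of $H'$ in $G$ is a (not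 necessarily smooth) subgroup $H$ of $G$ with $\pi'(H_{k'})=H'$; it is a smooth levitation if $H$ is smooth. ''Largest'' means containing all others. For an algebraic $k$-group $M$, $M^{\mathrm{sm}}$ denotes the largest smooth subgroup of $M$ (the $k$-descent of the subgroup of $M_{k^{\mathrm{s}}}$ generated by $M(k^{\mathrm{s}})$). *)

(* Defs.v *)
From HB Require Import structures.
From mathcomp Require Import all_boot all_order all_algebra all_field.
From mathcomp Require Import mpoly.

Set Implicit Arguments.
Unset Strict Implicit.
Unset Printing Implicit Defensive.

Import GRing.Theory VectorInternalTheory.
Local Open Scope ring_scope.

(* Affine group schemes of finite type over a field k, given by equations: a
   closed subscheme of affine n-space over k is an ideal of {mpoly k[n]}, and a
   commutative k-algebra is a (nonzero) commutative ring R together with its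
   structure morphism s : k -> R.  Base change along a field morphism acts on
   the coefficients of the equations. *)

Record ideal (k : fieldType) (n : nat) := Ideal {
  ideal_mem :> {mpoly k[n]} -> Prop;
  ideal0 : ideal_mem 0;
  idealD : forall f g, ideal_mem f -> ideal_mem g -> ideal_mem (f + g);
  idealM : forall f g, ideal_mem g -> ideal_mem (f * g) }.

Definition ideal_sub (k : fieldType) n (I J : ideal k n) :=
  forall f, I f -> J f.

Definition ideal_eq (k : fieldType) n (I J : ideal k n) :=
  forall f, I f <-> J f.

Definition prime_ideal (k : fieldType) n (P : ideal k n) :=
  ~ P 1 /\ forall f g, P (f * g) -> P f \/ P g.

Definition zeros (k : fieldType) n (I : ideal k n)
    (R : comNzRingType) (s : {rmorphism k -> R}) (v : 'I_n -> R) :=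
  forall f, I f -> mmap s v f = 0.

(* The ideal of {mpoly F[n]} generated by the image of I under j : k -> F. *)
Section IdealBaseChange.
Variables (k F : fieldType) (j : {rmorphism k -> F}) (n : nat) (I : ideal k n).

Definition bc_mem (h : {mpoly F[n]}) :=
  exists2 l : seq ({mpoly F[n]} * {mpoly k[n]}),
    (forall p, p \in l -> I p.2) & h = \sum_(p <- l) p.1 * map_mpoly j p.2.

Fact bc_mem0 : bc_mem 0.
Proof. by exists [::]; rewrite ?big_nil. Qed.

Fact bc_memD f g : bc_mem f -> bc_mem g -> bc_mem (f + g).
Proof.
move=> [l lI ->] [m mI ->]; exists (l ++ m); last by rewrite big_cat.
by move=> p; rewrite mem_cat => /orP[/lI|/mI].
Qed.

Fact bc_memM f g : bc_mem g -> bc_mem (f * g).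
Proof.
move=> [l lI ->]; exists [seq (f * p.1, p.2) | p <- l].
  by move=> p /mapP[q /lI Iq ->].
by rewrite big_map mulr_sumr; apply: eq_bigr => p _; rewrite mulrA.
Qed.

Definition bc_ideal := Ideal bc_mem0 bc_memD bc_memM.

Lemma mmap_map_mpoly (R : comNzRingType) (t : {rmorphism F -> R})
    (v : 'I_n -> R) (f : {mpoly k[n]}) :
  mmap t v (map_mpoly j f) = mmap (t \o j) v f.
Proof.
have -> : map_mpoly j f = \sum_(m <- msupp f) j f@_m *: 'X_[m].
  rewrite /map_mpoly /mmap; apply: eq_bigr => m _ /=.
  by rewrite mul_mpolyC mmap1_id.
rewrite raddf_sum /= [RHS]/mmap; apply: eq_bigr => m _.
by rewrite mmapZ mmapX.
Qed.

Lemma bc_zeros (R : comNzRingType) (t : {rmorphism F -> R}) (v : 'I_n -> R) :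
  zeros bc_ideal t v <-> zeros I (t \o j) v.
Proof.
split=> Iv f.
  move=> If; rewrite -mmap_map_mpoly; apply: Iv.
  exists [:: (1, f)]; last by rewrite big_seq1 mul1r.
  by move=> p; rewrite inE => /eqP ->.
move=> [l lI ->]; rewrite raddf_sum /= big_seq big1 // => p /lI Ip.
by rewrite rmorphM /= mmap_map_mpoly Iv // mulr0.
Qed.

End IdealBaseChange.

Definition join_pts (R : Type) n (u v : 'I_n -> R) (i : 'I_(n + n)) : R :=
  match split i with inl a => u a | inr b => v b end.

(* By Yoneda, the group law, the unit and the inverse are given by polynomials,
   which are required to induce a group structure on R-points, for all R. *)
Record affgrp (k : fieldType) := AffGrp {
  gdim : nat;
  gideal : ideal k gdim;
  gmulp : 'I_gdim -> {mpoly k[gdim + gdim]};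
  gonep : 'I_gdim -> k;
  ginvp : 'I_gdim -> {mpoly k[gdim]};
  gmul := fun (R : comNzRingType) (s : {rmorphism k -> R})
              (u v : 'I_gdim -> R) i => mmap s (join_pts u v) (gmulp i);
  gone := fun (R : comNzRingType) (s : {rmorphism k -> R}) i => s (gonep i);
  ginv := fun (R : comNzRingType) (s : {rmorphism k -> R})
              (u : 'I_gdim -> R) i => mmap s u (ginvp i);
  gpts := fun (R : comNzRingType) (s : {rmorphism k -> R})
              (u : 'I_gdim -> R) => zeros gideal s u;
  gmul_pts : forall R s u v, gpts s u -> gpts s v -> @gpts R s (gmul s u v);
  gone_pts : forall R s, @gpts R s (gone s);
  ginv_pts : forall R s u, gpts s u -> @gpts R s (ginv s u);
  gmulA : forall (R : comNzRingType) (s : {rmorphism k -> R}) u v w,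
    gpts s u -> gpts s v -> gpts s w ->
    gmul s u (gmul s v w) =1 gmul s (gmul s u v) w;
  gmul1g : forall (R : comNzRingType) (s : {rmorphism k -> R}) u,
    gpts s u -> gmul s (gone s) u =1 u;
  gmulVg : forall (R : comNzRingType) (s : {rmorphism k -> R}) u,
    gpts s u -> gmul s (ginv s u) u =1 gone s }.

Arguments gmul [k] a [R] s u v i.
Arguments gone [k] a [R] s i.
Arguments ginv [k] a [R] s u i.
Arguments gpts [k] a [R] s u.

(* Closed subgroup schemes. *)
Record subgrp (k : fieldType) (G : affgrp k) := SubGrp {
  sideal : ideal k (gdim G);
  sideal_sub : ideal_sub (gideal G) sideal;
  smul_pts : forall (R : comNzRingType) (s : {rmorphism k -> R}) u v,
    zeros sideal s u -> zeros sideal s v -> zeros sideal s (gmul G s u v);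
  sone_pts : forall (R : comNzRingType) (s : {rmorphism k -> R}),
    zeros sideal s (gone G s);
  sinv_pts : forall (R : comNzRingType) (s : {rmorphism k -> R}) u,
    zeros sideal s u -> zeros sideal s (ginv G s u) }.

Definition spts (k : fieldType) (G : affgrp k) (H : subgrp G)
    (R : comNzRingType) (s : {rmorphism k -> R}) (u : 'I_(gdim G) -> R) :=
  zeros (sideal H) s u.

Definition sub_le (k : fieldType) (G : affgrp k) (H K : subgrp G) :=
  ideal_sub (sideal K) (sideal H).

Definition is_largest (k : fieldType) (G : affgrp k) (P : subgrp G -> Prop)
    (H : subgrp G) := P H /\ forall K, P K -> sub_le K H.

Section SubAffGrp.
Variables (k : fieldType) (G : affgrp k) (H : subgrp G).

Fact spts_gpts (R : comNzRingType) (s : {rmorphism k -> R}) u :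
  spts H s u -> gpts G s u.
Proof. by move=> Hu f Gf; apply: Hu; apply: sideal_sub. Qed.

Definition sub_affgrp : affgrp k.
Proof.
refine (@AffGrp k (gdim G) (sideal H) (@gmulp k G) (@gonep k G) (@ginvp k G)
          _ _ _ _ _ _).
- exact: (@smul_pts k G H).
- exact: (@sone_pts k G H).
- exact: (@sinv_pts k G H).
- by move=> R s u v w Hu Hv Hw; apply: (@gmulA k G); apply: spts_gpts.
- by move=> R s u Hu; apply: (@gmul1g k G); apply: spts_gpts.
- by move=> R s u Hu; apply: (@gmulVg k G); apply: spts_gpts.
Defined.

End SubAffGrp.

Section GroupBaseChange.
Variables (k F : fieldType) (j : {rmorphism k -> F}) (G : affgrp k).

Let gmul_bc (R : comNzRingType) (t : {rmorphism F -> R})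
    (u v : 'I_(gdim G) -> R) i :
  mmap t (join_pts u v) (map_mpoly j (gmulp i)) = gmul G (t \o j) u v i.
Proof. exact: mmap_map_mpoly. Qed.

Let ginv_bc (R : comNzRingType) (t : {rmorphism F -> R})
    (u : 'I_(gdim G) -> R) i :
  mmap t u (map_mpoly j (ginvp i)) = ginv G (t \o j) u i.
Proof. exact: mmap_map_mpoly. Qed.

Let eq_zeros n (I : ideal k n) (R : comNzRingType) (s : {rmorphism k -> R})
  u v : u =1 v -> zeros I s u -> zeros I s v.
Proof.
move=> euv Iu f If; rewrite -[RHS](Iu f If) /mmap.
by apply: eq_bigr => m _; congr (_ * _); apply: mmap1_eq.
Qed.

Let eq_gmul (R : comNzRingType) (s : {rmorphism k -> R}) u u' v v' :
  u =1 u' -> v =1 v' -> gmul G s u v =1 gmul G s u' v'.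
Proof.
move=> eu ev i; rewrite /gmul /mmap; apply: eq_bigr => m _; congr (_ * _).
by apply: mmap1_eq => a; rewrite /join_pts; case: split.
Qed.

Definition bc_grp : affgrp F.
Proof.
refine (@AffGrp F (gdim G) (bc_ideal j (gideal G))
  (fun i => map_mpoly j (gmulp i)) (fun i => j (gonep i))
  (fun i => map_mpoly j (ginvp i)) _ _ _ _ _ _).
- move=> R t u v /bc_zeros Gu /bc_zeros Gv; apply/bc_zeros.
  apply: (@eq_zeros _ _ _ _ (gmul G (t \o j) u v)); last exact: gmul_pts.
  by move=> i; rewrite gmul_bc.
- move=> R t; apply/bc_zeros; exact: (@gone_pts k G R (t \o j)).
- move=> R t u /bc_zeros Gu; apply/bc_zeros.
  apply: (@eq_zeros _ _ _ _ (ginv G (t \o j) u)); last exact: ginv_pts.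
  by move=> i; rewrite ginv_bc.
- move=> R t u v w /bc_zeros Gu /bc_zeros Gv /bc_zeros Gw i; rewrite !gmul_bc.
  have evw : (fun a => mmap t (join_pts v w) (map_mpoly j (gmulp a)))
      =1 gmul G (t \o j) v w by move=> a; exact: gmul_bc.
  have euv : gmul G (t \o j) u v
      =1 (fun a => mmap t (join_pts u v) (map_mpoly j (gmulp a))).
    by move=> a; rewrite gmul_bc.
  rewrite (eq_gmul _ (frefl u) evw) (gmulA Gu Gv Gw).
  exact: (eq_gmul _ euv (frefl w)).
- move=> R t u /bc_zeros Gu i; rewrite gmul_bc.
  exact: (@gmul1g k G R (t \o j) u Gu).
- move=> R t u /bc_zeros Gu i; rewrite gmul_bc.
  rewrite -[RHS]/(gone G (t \o j) i) -(gmulVg Gu).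
  by apply: eq_gmul => // a; rewrite ginv_bc.
Defined.

Definition bc_sub (H : subgrp G) : subgrp bc_grp.
Proof.
refine (@SubGrp F bc_grp (bc_ideal j (sideal H)) _ _ _ _).
- move=> f [l lI ->]; exists l => // p /lI; exact: sideal_sub.
- move=> R t u v /bc_zeros Hu /bc_zeros Hv; apply/bc_zeros.
  apply: (@eq_zeros _ _ _ _ (gmul G (t \o j) u v)); last exact: smul_pts.
  by move=> i; rewrite [RHS]gmul_bc.
- move=> R t; apply/bc_zeros; exact: (@sone_pts k G H R (t \o j)).
- move=> R t u /bc_zeros Hu; apply/bc_zeros.
  apply: (@eq_zeros _ _ _ _ (ginv G (t \o j) u)); last exact: sinv_pts.
  by move=> i; rewrite [RHS]ginv_bc.
Defined.

End GroupBaseChange.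

Definition trivial_sub (k : fieldType) (G : affgrp k) (N : subgrp G) :=
  forall (R : comNzRingType) (s : {rmorphism k -> R}) u,
    spts N s u -> u =1 gone G s.

Definition normal_sub (k : fieldType) (G : affgrp k) (N : subgrp G) :=
  forall (R : comNzRingType) (s : {rmorphism k -> R}) g u,
    gpts G s g -> spts N s u ->
    spts N s (gmul G s (gmul G s g u) (ginv G s g)).

(* Infinitesimal lifting property; finite presentation is automatic here. *)
Definition smooth (k : fieldType) (G : affgrp k) :=
  forall (R S : comNzRingType) (s : {rmorphism k -> R}) (q : {rmorphism R -> S}),
    (forall y, exists x, q x = y) ->
    (forall x y, q x = 0 -> q y = 0 -> x * y = 0) ->
    forall v, gpts G (q \o s) v ->
      exists2 w, gpts G s w & forall i, q (w i) = v i.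

(* Connectedness of the spectrum of the coordinate ring, whose points are the
   primes P containing gideal G, for the Zariski topology. *)
Definition connected (k : fieldType) (G : affgrp k) :=
  forall A B : ideal k (gdim G),
    let pt P := prime_ideal P /\ ideal_sub (gideal G) P in
    (forall P, pt P -> ideal_sub A P \/ ideal_sub B P) ->
    (forall P, pt P -> ~ (ideal_sub A P /\ ideal_sub B P)) ->
    (forall P, pt P -> ideal_sub A P) \/ (forall P, pt P -> ideal_sub B P).

Definition grp_rep (k : fieldType) (G : affgrp k) m
    (rho : 'M[{mpoly k[gdim G]}]_m) :=
  forall (R : comNzRingType) (s : {rmorphism k -> R}),
    map_mx (mmap s (gone G s)) rho = 1%:M /\
    forall u v, gpts G s u -> gpts G s v ->
      map_mx (mmap s (gmul G s u v)) rho
        = map_mx (mmap s u) rho *m map_mx (mmap s v) rho.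

(* Every nonzero (finite-dimensional) representation has a nonzero fixed
   vector. *)
Definition unipotent (k : fieldType) (G : affgrp k) :=
  forall m (rho : 'M[{mpoly k[gdim G]}]_m.+1), grp_rep rho ->
    exists2 x : 'cV[k]_m.+1, x != 0 &
      forall (R : comNzRingType) (s : {rmorphism k -> R}) u, gpts G s u ->
        map_mx (mmap s u) rho *m map_mx s x = map_mx s x.

Definition is_Ru (k : fieldType) (G : affgrp k) : subgrp G -> Prop :=
  is_largest (fun N => [/\ smooth (sub_affgrp N), connected (sub_affgrp N),
                           unipotent (sub_affgrp N) & normal_sub N]).

Definition pseudo_reductive (k : fieldType) (G : affgrp k) :=
  [/\ smooth G, connected G & exists2 N : subgrp G, is_Ru N & trivial_sub N].

Section GrpHom.
Variables (k : fieldType) (G Q : affgrp k).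

Definition hom_pts (phi : 'I_(gdim Q) -> {mpoly k[gdim G]})
    (R : comNzRingType) (s : {rmorphism k -> R}) (u : 'I_(gdim G) -> R) i :=
  mmap s u (phi i).

Record grp_hom := GrpHom {
  hom_poly : 'I_(gdim Q) -> {mpoly k[gdim G]};
  hom_gpts : forall (R : comNzRingType) (s : {rmorphism k -> R}) u,
    gpts G s u -> gpts Q s (hom_pts hom_poly s u);
  hom_mul : forall (R : comNzRingType) (s : {rmorphism k -> R}) u v,
    gpts G s u -> gpts G s v ->
    hom_pts hom_poly s (gmul G s u v)
      =1 gmul Q s (hom_pts hom_poly s u) (hom_pts hom_poly s v) }.

Definition hom_app (phi : grp_hom) := hom_pts (hom_poly phi).

(* H' is the scheme-theoretic image of H: its ideal is the kernel of the
   comorphism from the coordinate ring of Q to that of H. *)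
Definition is_image (phi : grp_hom) (H : subgrp G) (H' : subgrp Q) :=
  forall f : {mpoly k[gdim Q]},
    sideal H' f <-> sideal H (mmap (@mpolyC (gdim G) k) (hom_poly phi) f).

End GrpHom.

Arguments hom_app [k G Q] phi [R] s u i.

(* pi : G -> Q is the quotient of G by its normal subgroup N: it has kernel N,
   and it is universal among the homomorphisms that are trivial on N. *)
Definition is_quotient (k : fieldType) (G Q : affgrp k) (N : subgrp G)
    (pi : grp_hom G Q) :=
  (forall (R : comNzRingType) (s : {rmorphism k -> R}) u, gpts G s u ->
     (spts N s u <-> hom_app pi s u =1 gone Q s)) /\
  (forall (L : affgrp k) (phi : grp_hom G L),
     (forall (R : comNzRingType) (s : {rmorphism k -> R}) u,
        spts N s u -> hom_app phi s u =1 gone L s) ->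
     let factors psi :=
       forall (R : comNzRingType) (s : {rmorphism k -> R}) u, gpts G s u ->
         hom_app psi s (hom_app pi s u) =1 hom_app phi s u in
     (exists psi : grp_hom Q L, factors psi) /\
     (forall psi1 psi2 : grp_hom Q L, factors psi1 -> factors psi2 ->
        forall (R : comNzRingType) (s : {rmorphism k -> R}) x, gpts Q s x ->
          hom_app psi1 s x =1 hom_app psi2 s x)).

Definition algebraic_closure (k : fieldType) (K : closedFieldType)
    (iota : {rmorphism k -> K}) := forall z, algebraicOver iota z.

(* The subgroup N of G_K comes from a subgroup of G_F, where k -> F -> K are
   the maps s and e, whose composite is iota. *)
Definition defined_over (k F K : fieldType) (iota : {rmorphism k -> K})
    (s : {rmorphism k -> F}) (e : {rmorphism F -> K})
    (G : affgrp k) (N : subgrp (bc_grp iota G)) :=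
  exists NF : subgrp (bc_grp s G),
    ideal_eq (sideal (bc_sub e NF)) (sideal N : ideal K (gdim G)).

Definition min_field_of_definition (k k' K : fieldType)
    (iota : {rmorphism k -> K}) (j : {rmorphism k -> k'})
    (e' : {rmorphism k' -> K}) (G : affgrp k) (N : subgrp (bc_grp iota G)) :=
  [/\ e' \o j =1 iota, defined_over j e' N &
      forall (F : fieldType) (s : {rmorphism k -> F}) (e : {rmorphism F -> K}),
        e \o s =1 iota -> defined_over s e N ->
        forall x : k', exists y : F, e y = e' x].

(* The tensor product of k' and R over k, for k' a finite extension of k, as
   the free R-module on the k-basis of k' underlying v2r.  The maps tensl, tensr
   exhibit it as a coproduct of commutative k-algebras: see tens_pushout. *)
Section Tensor.
Variables (k : fieldType) (k' : fieldExtType k).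
Variable R : comNzRingType.

Definition tens (s : {rmorphism k -> R}) : Type := 'rV[R]_(dim k').

Variable s : {rmorphism k -> R}.
HB.instance Definition _ := GRing.Zmodule.copy (tens s) 'rV[R]_(dim k').

Definition tbasis (i : 'I_(dim k')) : k' := r2v (delta_mx 0 i).

Definition treg (x : k') : 'M[k]_(dim k') := \matrix_i v2r (tbasis i * x).

Definition tmulmx (u : tens s) : 'M[R]_(dim k') :=
  \sum_i u 0 i *: map_mx s (treg (tbasis i)).

Definition tone : tens s := map_mx s (v2r (1 : k')).
Definition tmul (u v : tens s) : tens s := v *m tmulmx u.

Let v2r_sum (x : k') : x = \sum_i v2r x 0 i *: tbasis i.
Proof.
apply: v2r_inj; rewrite linear_sum {1}[v2r x]row_sum_delta.
by apply: eq_bigr => i _; rewrite linearZ /= /tbasis r2vK.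
Qed.

Let tregE (x y : k') : v2r y *m treg x = v2r (y * x).
Proof.
rewrite {2}[y]v2r_sum mulr_suml linear_sum mulmx_sum_row.
by apply: eq_bigr => i _; rewrite -scalerAl linearZ rowK.
Qed.

Let mul_treg_eq (A B : 'M[k]_(dim k')) :
  (forall y : k', v2r y *m A = v2r y *m B) -> A = B.
Proof.
by move=> eAB; apply/row_matrixP => i; rewrite !rowE -[delta_mx 0 i]r2vK eAB.
Qed.

Let tregM x y : treg x *m treg y = treg (x * y).
Proof. by apply: mul_treg_eq => z; rewrite mulmxA !tregE mulrA. Qed.

Let treg_sum x : treg x = \sum_i v2r x 0 i *: treg (tbasis i).
Proof.
apply: mul_treg_eq => z; rewrite tregE {1}[x]v2r_sum mulr_sumr linear_sum.
rewrite mulmx_sumr; apply: eq_bigr => i _.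
by rewrite -scalerAr linearZ /= -scalemxAr tregE.
Qed.

Let tmulmx_map x : tmulmx (map_mx s (v2r x)) = map_mx s (treg x).
Proof.
rewrite [in RHS]treg_sum raddf_sum; apply: eq_bigr => i _.
by rewrite mxE; apply/esym/map_mxZ.
Qed.

Let tmulmxD u v : tmulmx (u + v) = tmulmx u + tmulmx v.
Proof. by rewrite -big_split; apply: eq_bigr => i _; rewrite !mxE scalerDl. Qed.

Let tmulmxZ a (u : 'rV[R]_(dim k')) : tmulmx (a *: u) = a *: tmulmx u.
Proof. by rewrite scaler_sumr; apply: eq_bigr => i _; rewrite !mxE scalerA. Qed.

Let tmulmx_sum I (r : seq I) (F : I -> 'rV[R]_(dim k')) :
  tmulmx (\sum_(i <- r) F i) = \sum_(i <- r) tmulmx (F i).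
Proof.
elim: r => [|i r IH]; last by rewrite !big_cons tmulmxD IH.
by rewrite !big_nil /tmulmx big1 // => i _; rewrite mxE scale0r.
Qed.

Let tens_sum (u : tens s) :
  u = \sum_i u 0 i *: map_mx s (v2r (tbasis i)) :> 'rV[R]_(dim k').
Proof.
rewrite {1}[u : 'rV_ _]row_sum_delta; apply: eq_bigr => i _.
by rewrite /tbasis r2vK map_delta_mx.
Qed.

Let tmul_map x (v : tens s) : v *m map_mx s (treg x)
  = \sum_i v 0 i *: map_mx s (v2r (tbasis i * x)).
Proof.
rewrite {1}[v]tens_sum mulmx_suml; apply: eq_bigr => i _.
by rewrite -scalemxAl -map_mxM tregE.
Qed.

Let tmulE (u v : tens s) : tmul u v
  = \sum_i \sum_l (u 0 i * v 0 l) *: map_mx s (v2r (tbasis l * tbasis i)).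
Proof.
rewrite /tmul /tmulmx mulmx_sumr; apply: eq_bigr => i _.
rewrite -scalemxAr tmul_map scaler_sumr.
by apply: eq_bigr => l _; rewrite scalerA.
Qed.

Let tmulC : commutative tmul.
Proof.
move=> u v; rewrite !tmulE exchange_big; apply: eq_bigr => i _ /=.
by apply: eq_bigr => l _; rewrite [tbasis i * _]mulrC [u _ _ * _]mulrC.
Qed.

Let tmulmxM u v : tmulmx (tmul u v) = tmulmx v *m tmulmx u.
Proof.
rewrite tmulE tmulmx_sum [tmulmx u]/tmulmx mulmx_sumr; apply: eq_bigr => i _.
rewrite tmulmx_sum [tmulmx v]/tmulmx mulmx_suml; apply: eq_bigr => l _.
rewrite tmulmxZ tmulmx_map -tregM map_mxM -scalemxAl -scalemxAr scalerA.
by rewrite [u _ _ * _]mulrC.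
Qed.

Let tmulA : associative tmul.
Proof.
move=> u v w; rewrite [tmul (tmul _ _) _]/tmul tmulmxM {1}/tmul {1}/tmul.
by rewrite -mulmxA.
Qed.

Let tmul1 : left_id tone tmul.
Proof.
move=> u; rewrite /tmul /tone tmulmx_map tmul_map [RHS]tens_sum.
by apply: eq_bigr => i _; rewrite mulr1.
Qed.

Let tmulDl : left_distributive tmul +%R.
Proof. by move=> u v w; rewrite /tmul tmulmxD mulmxDr. Qed.

Let tone_neq0 : tone != 0 :> tens s.
Proof.
apply/eqP => /matrixP e0; case/eqP: (oner_neq0 k').
apply: v2r_inj; apply/rowP => i; rewrite linear0 [RHS]mxE.
by apply/eqP; rewrite -(fmorph_eq0 s); apply/eqP; have := e0 0 i; rewrite !mxE.
Qed.

HB.instance Definition _ := GRing.Zmodule_isComNzRing.Build (tens s)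
  tmulA tmulC tmul1 tmulDl tone_neq0.

Definition tensl (x : k') : tens s := map_mx s (v2r x).
Definition tensr (a : R) : tens s := (a *: (tone : 'rV[R]_(dim k'))).

Let tensl_additive : zmod_morphism tensl.
Proof. by move=> x y; rewrite /tensl linearB raddfB. Qed.

Let tensl_multiplicative : monoid_morphism tensl.
Proof.
split=> // x y; rewrite /tensl -[RHS]/(tmul _ _) tmulC /tmul tmulmx_map.
by rewrite -map_mxM tregE.
Qed.

HB.instance Definition _ := GRing.isZmodMorphism.Build k' (tens s) tensl
  tensl_additive.
HB.instance Definition _ := GRing.isMonoidMorphism.Build k' (tens s) tensl
  tensl_multiplicative.

Let tensr_additive : zmod_morphism tensr.
Proof. by move=> a b; rewrite /tensr scalerBl. Qed.

Let tensr_multiplicative : monoid_morphism tensr.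
Proof.
split=> [|a b]; first by rewrite /tensr scale1r.
rewrite -[RHS]/(tmul _ _) /tmul /tensr tmulmxZ -scalemxAl -scalemxAr scalerA.
by rewrite mulrC -[tone *m _]/(tmul tone tone) tmul1 mulrC.
Qed.

HB.instance Definition _ := GRing.isZmodMorphism.Build R (tens s) tensr
  tensr_additive.
HB.instance Definition _ := GRing.isMonoidMorphism.Build R (tens s) tensr
  tensr_multiplicative.

Lemma tens_compat (c : k) : tensl (in_alg k' c) = tensr (s c).
Proof. by rewrite /tensl /tensr linearZ; apply/matrixP => a b; rewrite !mxE rmorphM. Qed.

Let tens_split (u : tens s) : u = \sum_i tensr (u 0 i) * tensl (tbasis i).
Proof.
rewrite {1}[u]tens_sum; apply: eq_bigr => i _.
rewrite -[RHS]/(tmul _ _) /tmul /tensr tmulmxZ -scalemxAr.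
congr (_ *: _); rewrite -[RHS]/(tmul tone _) tmul1 //.
Qed.

Lemma tens_pushout (C : comNzRingType)
    (a : {rmorphism k' -> C}) (b : {rmorphism R -> C}) :
    (forall c : k, a (in_alg k' c) = b (s c)) ->
  exists2 h : {rmorphism tens s -> C},
    (h \o tensl =1 a) /\ (h \o tensr =1 b) &
    forall h' : {rmorphism tens s -> C},
      h' \o tensl =1 a -> h' \o tensr =1 b -> h' =1 h.
Proof.
move=> ab; pose h (u : tens s) : C := \sum_i b (u 0 i) * a (tbasis i).
have aZ c x : a (c *: x) = b (s c) * a x.
  by rewrite -mulr_algl rmorphM /= -ab.
have hl x : h (tensl x) = a x.
  rewrite [in RHS](v2r_sum x) rmorph_sum; apply: eq_bigr => i _.
  by rewrite aZ mxE.
have hD : zmod_morphism h.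
  move=> u v; rewrite /h -sumrB; apply: eq_bigr => i _.
  by rewrite !mxE rmorphB mulrBl.
have hS n (E : 'I_n -> 'rV[R]_(dim k')) : h (\sum_i E i) = \sum_i h (E i).
  rewrite /h exchange_big; apply: eq_bigr => i _ /=.
  by rewrite summxE rmorph_sum mulr_suml.
have hZ c (u : 'rV[R]_(dim k')) : h (c *: u) = b c * h u.
  by rewrite /h mulr_sumr; apply: eq_bigr => i _; rewrite mxE rmorphM mulrA.
have hM : monoid_morphism h.
  split; first by rewrite -[1]/(tensl 1) hl rmorph1.
  move=> u v; rewrite -[u * v]/(tmul u v) tmulE hS.
  rewrite [h u]/h mulr_suml; apply: eq_bigr => i _.
  rewrite hS [h v]/h mulr_sumr; apply: eq_bigr => l _ /=.
  rewrite hZ -/(tensl _) hl !rmorphM /= [a (tbasis l) * _]mulrC.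
  by rewrite mulrACA.
pose hR : {rmorphism tens s -> C} := HB.pack_for {rmorphism tens s -> C} h
  (GRing.isZmodMorphism.Build (tens s) C h hD)
  (GRing.isMonoidMorphism.Build (tens s) C h hM).
exists hR.
  split=> [x|c] /=; first exact: hl.
  by rewrite /tensr hZ -[tone]/(tensl 1) hl rmorph1 mulr1.
move=> h' h'l h'r u; rewrite [u in LHS]tens_split rmorph_sum.
apply: eq_bigr => i _; rewrite rmorphM /=.
by rewrite -(h'l (tbasis i)) -(h'r (u 0 i)).
Qed.

End Tensor.

Arguments tens {k} k' {R} s.
Arguments tensl {k} k' {R} s x.
Arguments tensr {k} k' {R} s a.

Section Levitation.
Variables (k : fieldType) (k' : fieldExtType k) (G : affgrp k).
Variables (G' : affgrp k') (pi' : grp_hom (bc_grp (in_alg k') G) G').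

(* R-points of the Weil restriction of G' (resp. of its subgroup H'). *)
Definition weil_pts (R : comNzRingType) (s : {rmorphism k -> R})
    (x : 'I_(gdim G') -> tens k' s) := gpts G' (tensl k' s) x.

Definition weil_sub_pts (H' : subgrp G') (R : comNzRingType)
    (s : {rmorphism k -> R}) (x : 'I_(gdim G') -> tens k' s) :=
  spts H' (tensl k' s) x.

(* The homomorphism i_G on R-points: the unit of the adjunction, which is
   induced by tensr, followed by the Weil restriction of pi'. *)
Definition iG (R : comNzRingType) (s : {rmorphism k -> R})
    (u : 'I_(gdim G) -> R) : 'I_(gdim G') -> tens k' s :=
  hom_app pi' (tensl k' s) (fun i => tensr k' s (u i)).

Definition is_iG_preimage (H' : subgrp G') (M : subgrp G) :=
  forall (R : comNzRingType) (s : {rmorphism k -> R}) u,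
    spts M s u <-> gpts G s u /\ weil_sub_pts H' (iG s u).

Definition levitation (H' : subgrp G') (H : subgrp G) :=
  is_image pi' (bc_sub (in_alg k') H) H'.

Definition smooth_levitation (H' : subgrp G') (H : subgrp G) :=
  levitation H' H /\ smooth (sub_affgrp H).

End Levitation.

Definition is_smooth_part (k : fieldType) (G : affgrp k) (M : subgrp G) :
    subgrp G -> Prop :=
  is_largest (fun S => sub_le S M /\ smooth (sub_affgrp S)).

(* Main.v *)
(* The functor M = i_G^{-1}(R_{k'/k}(H')) is closed in G, with ideal the functions
   vanishing on all its points. Testing on the universal point of a levitation
   shows that every levitation lies in M; and pi'(M_k') lies in H' by the
   definition of M, so every subgroup between a levitation and M is again a
   levitation. This leaves the existence of M^sm over a possibly imperfect k.

   In characteristic p, M^sm is cut out by the smallest ideal J that contains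
   the ideal of M and for which k[X]/J has injective relative Frobenius.
   Injectivity is inherited by preimages and by the tensor product of two copies
   of k[X]/J, so J defines a subgroup. A smooth group S has injective relative
   Frobenius: lifting along k[X]/I^(N+1) gives a map X -> w(X), congruent to the
   identity modulo I = I(S), with f(w) in I^N for f in I; and I^N lies in the
   ideal of p-th powers of I for large N, so p-th powers can be compared
   coefficientwise along X^p. Hence J lies in I(S) for every smooth S in M.

   Conversely injectivity of Frobenius makes J smooth. Let m be the ideal of the
   unit. Left-invariant derivations give a frame dual to local coordinates (y, x)
   with y in J; over the p-th powers, the monomials in (y, x) with exponents < p
   generate the local ring by Nakayama, and applying the derivations kills all
   the coefficients of the x-part of an element of J modulo J. This gives
   J n m^2 = m J. In characteristic 0 the same computation with Taylor expansions
   and Krull's theorem shows that M itself satisfies it (Cartier). Finally, if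
   J n m^2 = m J, an infinitesimal point of the subgroup lifts to a point w of the
   smooth group G, and the obstruction f |-> f(w X) on J factors through J/mJ,
   hence is a tangent vector at the unit by which w can be corrected. *)

Require Import Defs.
From HB Require Import structures.
From mathcomp Require Import all_boot all_order all_algebra all_field.
From mathcomp Require Import mpoly zify ring.
From Stdlib Require Import Classical ClassicalEpsilon FunctionalExtensionality.

Set Implicit Arguments.
Unset Strict Implicit.
Unset Printing Implicit Defensive.

Import GRing.Theory VectorInternalTheory.
Local Open Scope ring_scope.

(** * Ideals, quotients and points modulo an ideal *)

Lemma choice_fun (I : Type) (T : I -> Type) (P : forall i, T i -> Prop) :
  (forall i, exists x, P i x) -> exists f : forall i, T i, forall i, P i (f i).
Proof.
move=> Pex; exists (fun i => proj1_sig (constructive_indefinite_description _ (Pex i))).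
by move=> i; case: constructive_indefinite_description.
Qed.

Record is_ideal (A : comNzRingType) (I : A -> Prop) : Prop := IsIdeal {
  is_ideal0 : I 0;
  is_idealD : forall a b, I a -> I b -> I (a + b);
  is_idealM : forall a b, I b -> I (a * b) }.

Section IdealTheory.
Variables (A : comNzRingType) (I : A -> Prop).
Hypothesis idI : is_ideal I.

Lemma is_idealMr a b : I a -> I (a * b).
Proof. by rewrite mulrC; apply: is_idealM. Qed.

Lemma is_idealN a : I a -> I (- a).
Proof. by rewrite -mulN1r; apply: is_idealM. Qed.

Lemma is_idealB a b : I a -> I b -> I (a - b).
Proof. by move=> Ia Ib; apply: is_idealD => //; apply: is_idealN. Qed.

Lemma is_ideal_sum J (r : seq J) (P : pred J) (F : J -> A) :
  (forall i, P i -> I (F i)) -> I (\sum_(i <- r | P i) F i).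
Proof. by move=> IF; elim/big_ind: _; [case: idI | case: idI | ]. Qed.

Lemma is_ideal_sum_mem (J : eqType) (r : seq J) (F : J -> A) :
  (forall i, i \in r -> I (F i)) -> I (\sum_(i <- r) F i).
Proof. by move=> IF; rewrite big_seq; apply: is_ideal_sum. Qed.

Lemma is_idealBl a b : I a -> I (a - b) -> I b.
Proof. by move=> Ia Iab; rewrite -[b](subKr a); apply: is_idealB. Qed.

Lemma is_idealBr a b : I b -> I (a - b) -> I a.
Proof. by move=> Ib Iab; rewrite -[a](subrK b); apply: is_idealD. Qed.

Lemma is_idealXB a b n : I (a - b) -> I (a ^+ n - b ^+ n).
Proof. by move=> Iab; rewrite subrXX; apply: is_idealMr. Qed.

End IdealTheory.

Lemma idealP (k : fieldType) n (I : ideal k n) : is_ideal I.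
Proof. by case: I => I I0 ID IM. Qed.

Definition mkideal (k : fieldType) n (I : {mpoly k[n]} -> Prop)
  (idI : is_ideal I) : ideal k n :=
  Ideal (is_ideal0 idI) (is_idealD idI) (is_idealM idI).

Section Quotient.
Variables (A : comNzRingType) (I : A -> Prop).
Hypothesis idI : is_ideal I.
Hypothesis I1 : ~ I 1.

Definition ideal_pred : pred A := fun a =>
  if excluded_middle_informative (I a) then true else false.

Lemma ideal_predP a : reflect (I a) (ideal_pred a).
Proof.
by rewrite /ideal_pred; case: excluded_middle_informative => h; constructor.
Qed.

Fact ideal_pred_closed : idealr_closed ideal_pred.
Proof.
split; first by apply/ideal_predP; case: idI.
  by apply/negP => /ideal_predP.
move=> a u v /ideal_predP Iu /ideal_predP Iv; apply/ideal_predP.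
by apply: (is_idealD idI) => //; apply: (is_idealM idI).
Qed.

HB.instance Definition _ := isIdealr.Build A ideal_pred ideal_pred_closed.

Lemma quotient_ring :
  exists (Q : comNzRingType) (pi : {rmorphism A -> Q}),
    (forall x, exists a, pi a = x) /\ (forall a, pi a = 0 <-> I a).
Proof.
pose J : idealr A := ideal_pred; pose pi : A -> {ideal_quot J} := (\pi)%qT.
have piB a b : pi a = pi b <-> I (a - b).
  split=> [/eqP | Iab]; first by rewrite -Quotient.idealrBE => /ideal_predP.
  by apply/eqP; rewrite -Quotient.idealrBE; apply/ideal_predP.
exists {ideal_quot J}, (\pi_{ideal_quot J})%qT; split=> [x | a].
  by exists (repr x); exact: reprK.
by have := piB a 0; rewrite subr0 /pi rmorph0.
Qed.

End Quotient.

(** Rings are nonzero here, so the unit ideal has no quotient ring. Congruences modulo the unit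
    ideal are trivial, and that case is split off. *)
Lemma quotient_or_full (A : comNzRingType) (I : A -> Prop) : is_ideal I ->
  (forall a, I a) \/
  exists (Q : comNzRingType) (pi : {rmorphism A -> Q}),
    (forall x, exists a, pi a = x) /\ (forall a, pi a = 0 <-> I a).
Proof.
move=> idI; case: (excluded_middle_informative (I 1)) => [I1 | I1]; last first.
  by right; apply: quotient_ring.
by left=> a; rewrite -[a]mulr1; apply: is_idealM.
Qed.

Lemma quotient_eq (A Q : comNzRingType) (I : A -> Prop)
    (pi : {rmorphism A -> Q}) (piP : forall a, pi a = 0 <-> I a) a b :
  pi a = pi b <-> I (a - b).
Proof.
rewrite -piP rmorphB; split=> [-> | /eqP]; first by rewrite subrr.
by rewrite subr_eq0 => /eqP.
Qed.

(** * Evaluation of polynomials and its compatibilities *)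

Section Mmap.
Variables (n : nat) (A : nzRingType).

Lemma eq_mmap (S : nzRingType) (f g : A -> S) (u v : 'I_n -> S) p :
  f =1 g -> u =1 v -> mmap f u p = mmap g v p.
Proof.
move=> fg uv; rewrite /mmap; apply: eq_bigr => m _.
by rewrite fg (mmap1_eq _ uv).
Qed.

Lemma rmorph_mmap (S S' : nzRingType) (h : {rmorphism S -> S'}) (f : A -> S)
    (u : 'I_n -> S) p :
  h (mmap f u p) = mmap (h \o f) (h \o u) p.
Proof.
rewrite rmorph_sum; apply: eq_bigr => m _; rewrite rmorphM rmorph_prod.
by congr (_ * _); apply: eq_bigr => i _; rewrite rmorphXn.
Qed.

Lemma mmap_id (p : {mpoly A[n]}) : mmap (@mpolyC n A) (fun i => 'X_i) p = p.
Proof.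
rewrite [RHS]mpolyE /mmap; apply: eq_bigr => m _.
by rewrite mul_mpolyC mmap1_id.
Qed.

End Mmap.

Lemma mmap_comp n m (A S : comNzRingType) (s : {rmorphism A -> S})
    (u : 'I_m -> S) (phi : 'I_n -> {mpoly A[m]}) p :
  mmap s u (mmap (@mpolyC m A) phi p) = mmap s (fun i => mmap s u (phi i)) p.
Proof.
by rewrite (rmorph_mmap (mmap s u)); apply: eq_mmap => // c /=; rewrite mmapC.
Qed.

Lemma mmap_cong n (A T : comNzRingType) (s : {rmorphism A -> T})
    (I : T -> Prop) (u v : 'I_n -> T) (p : {mpoly A[n]}) :
  is_ideal I -> (forall i, I (u i - v i)) -> I (mmap s u p - mmap s v p).
Proof.
move=> idI Iuv; case: (quotient_or_full idI) => [full | [Q [pi [_ piP]]]];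
  first by do ?[move=> ?]; apply: full.
apply/(quotient_eq piP); rewrite !rmorph_mmap; apply: eq_mmap => // i /=.
exact/(quotient_eq piP).
Qed.

(** * Group laws on points, over a ring and modulo an ideal *)

Section Points.
Variables (k : fieldType) (G : affgrp k).

Lemma rmorph_gmul (R S : comNzRingType) (h : {rmorphism R -> S})
    (s : {rmorphism k -> R}) u v :
  h \o gmul G s u v = gmul G (h \o s) (h \o u) (h \o v).
Proof.
apply: functional_extensionality => i; rewrite /= /gmul rmorph_mmap.
by apply: eq_mmap => // j; rewrite /join_pts /=; case: split.
Qed.

Lemma rmorph_ginv (R S : comNzRingType) (h : {rmorphism R -> S})
    (s : {rmorphism k -> R}) u :
  h \o ginv G s u = ginv G (h \o s) (h \o u).
Proof.
by apply: functional_extensionality => i; rewrite /= /ginv rmorph_mmap.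
Qed.

Section Group.
Variables (R : comNzRingType) (s : {rmorphism k -> R}).
Implicit Types u v w : 'I_(gdim G) -> R.
Local Notation "u ** v" := (gmul G s u v) (at level 40, left associativity).
Local Notation e := (gone G s).

Lemma pt_mulA u v w : gpts G s u -> gpts G s v -> gpts G s w ->
  u ** (v ** w) = u ** v ** w.
Proof. by move=> *; apply: functional_extensionality => i; apply: gmulA. Qed.

Lemma pt_mul1g u : gpts G s u -> e ** u = u.
Proof. by move=> *; apply: functional_extensionality => i; apply: gmul1g. Qed.

Lemma pt_mulVg u : gpts G s u -> ginv G s u ** u = e.
Proof. by move=> *; apply: functional_extensionality => i; apply: gmulVg. Qed.

Lemma pt_mulgV u : gpts G s u -> u ** ginv G s u = e.
Proof.
move=> Gu; have Gi := ginv_pts Gu; have Gii := ginv_pts Gi.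
have Gm := gmul_pts Gu Gi.
rewrite -[LHS]pt_mul1g // -(pt_mulVg Gi) -pt_mulA // [X in _ ** X]pt_mulA //.
by rewrite pt_mulVg // pt_mul1g.
Qed.

Lemma pt_mulg1 u : gpts G s u -> u ** e = u.
Proof.
move=> Gu; rewrite -(pt_mulVg Gu) pt_mulA ?pt_mulgV ?pt_mul1g //.
exact: ginv_pts.
Qed.

Lemma pt_mulgI u v : gpts G s u -> gpts G s v -> u ** v = u -> v = e.
Proof.
move=> Gu Gv uv; rewrite -[v]pt_mul1g // -(pt_mulVg Gu) -pt_mulA ?uv //.
exact: ginv_pts.
Qed.

Lemma pt_inv_unique u v : gpts G s u -> gpts G s v -> v ** u = e ->
  v = ginv G s u.
Proof.
move=> Gu Gv vu; rewrite -[v]pt_mulg1 // -(pt_mulgV Gu) pt_mulA ?vu //.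
  by rewrite pt_mul1g //; apply: ginv_pts.
exact: ginv_pts.
Qed.

Lemma pt_invK u : gpts G s u -> ginv G s (ginv G s u) = u.
Proof.
move=> Gu; apply/esym/pt_inv_unique => //; last exact: pt_mulgV.
exact: ginv_pts.
Qed.

End Group.

Section Modulo.
Variables (T : comNzRingType) (s : {rmorphism k -> T}) (I : T -> Prop).
Hypothesis idI : is_ideal I.

(** Points of the quotient of [T] by [I] are represented by lifts to [T], so that the unit ideal is
    allowed and several ideals can be used on one ring. *)
Definition zeros_mod n (J : ideal k n) (u : 'I_n -> T) :=
  forall f, J f -> I (mmap s u f).

Definition eq_mod n (u v : 'I_n -> T) := forall i, I (u i - v i).

Lemma zeros_modP n (J : ideal k n) (Q : comNzRingType) (pi : {rmorphism T -> Q})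
    (piP : forall a, pi a = 0 <-> I a) (u : 'I_n -> T) :
  zeros_mod J u <-> zeros J (pi \o s) (pi \o u).
Proof.
by split=> Ju f Jf; move: (Ju f Jf); rewrite -piP rmorph_mmap.
Qed.

Lemma eq_modP n (Q : comNzRingType) (pi : {rmorphism T -> Q})
    (piP : forall a, pi a = 0 <-> I a) (u v : 'I_n -> T) :
  eq_mod u v <-> pi \o u = pi \o v.
Proof.
split=> uv; last first.
  by move=> i; apply/(quotient_eq piP); apply: (equal_f uv i).
by apply: functional_extensionality => i; apply/(quotient_eq piP).
Qed.

Lemma eq_mod_refl n (u : 'I_n -> T) : eq_mod u u.
Proof. by move=> i; rewrite subrr; apply: is_ideal0. Qed.

Lemma eq_mod_sym n (u v : 'I_n -> T) : eq_mod u v -> eq_mod v u.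
Proof. by move=> uv i; rewrite -opprB; apply: is_idealN. Qed.

Lemma eq_mod_trans n (u v w : 'I_n -> T) :
  eq_mod u v -> eq_mod v w -> eq_mod u w.
Proof.
by move=> uv vw i; rewrite -[u i](subrK (v i)) -addrA; apply: is_idealD.
Qed.

Lemma smul_mod (H : subgrp G) u v : zeros_mod (sideal H) u ->
  zeros_mod (sideal H) v -> zeros_mod (sideal H) (gmul G s u v).
Proof.
case: (quotient_or_full idI) => [full | [Q [pi [_ piP]]]];
  first by do ?[move=> ?]; apply: full.
rewrite !(zeros_modP _ piP) rmorph_gmul; exact: smul_pts.
Qed.

Lemma sinv_mod (H : subgrp G) u : zeros_mod (sideal H) u ->
  zeros_mod (sideal H) (ginv G s u).
Proof.
case: (quotient_or_full idI) => [full | [Q [pi [_ piP]]]];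
  first by do ?[move=> ?]; apply: full.
rewrite !(zeros_modP _ piP) rmorph_ginv; exact: sinv_pts.
Qed.

Lemma sub_zeros_mod (H : subgrp G) u :
  zeros_mod (sideal H) u -> zeros_mod (gideal G) u.
Proof. by move=> Hu f Gf; apply: Hu; apply: sideal_sub. Qed.

Lemma mulA_mod u v w : zeros_mod (gideal G) u -> zeros_mod (gideal G) v ->
  zeros_mod (gideal G) w ->
  eq_mod (gmul G s u (gmul G s v w)) (gmul G s (gmul G s u v) w).
Proof.
case: (quotient_or_full idI) => [full | [Q [pi [_ piP]]]];
  first by do ?[move=> ?]; apply: full.
by rewrite !(zeros_modP _ piP) (eq_modP piP) !rmorph_gmul; apply: pt_mulA.
Qed.

Lemma mul1g_mod u : zeros_mod (gideal G) u -> eq_mod (gmul G s (gone G s) u) u.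
Proof.
case: (quotient_or_full idI) => [full | [Q [pi [_ piP]]]];
  first by do ?[move=> ?]; apply: full.
by rewrite !(zeros_modP _ piP) (eq_modP piP) !rmorph_gmul; apply: pt_mul1g.
Qed.

Lemma mulg1_mod u : zeros_mod (gideal G) u -> eq_mod (gmul G s u (gone G s)) u.
Proof.
case: (quotient_or_full idI) => [full | [Q [pi [_ piP]]]];
  first by do ?[move=> ?]; apply: full.
by rewrite !(zeros_modP _ piP) (eq_modP piP) !rmorph_gmul; apply: pt_mulg1.
Qed.

Lemma mulgV_mod u : zeros_mod (gideal G) u ->
  eq_mod (gmul G s u (ginv G s u)) (gone G s).
Proof.
case: (quotient_or_full idI) => [full | [Q [pi [_ piP]]]];
  first by do ?[move=> ?]; apply: full.
rewrite !(zeros_modP _ piP) (eq_modP piP) !rmorph_gmul rmorph_ginv.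
exact: pt_mulgV.
Qed.

Lemma gmul_cong u u' v v' : eq_mod u u' -> eq_mod v v' ->
  eq_mod (gmul G s u v) (gmul G s u' v').
Proof.
move=> uu' vv' i; apply: mmap_cong => // j.
by rewrite /join_pts; case: split.
Qed.

End Modulo.
End Points.

(** * The preimage of the Weil restriction and levitations *)

Section TensorCoordinates.
Variables (k : fieldType) (k' : fieldExtType k).

Lemma tensr_mul (R : comNzRingType) (s : {rmorphism k -> R}) a
    (x : tens k' s) : tensr k' s a * x = (a *: (x : 'rV[R]_(dim k'))).
Proof.
rewrite -[LHS]/(x *m tmulmx _) -[x in RHS]mul1r -[1 * x]/(x *m tmulmx _).
rewrite scalemxAr; congr (_ *m _); rewrite /tmulmx scaler_sumr.
by apply: eq_bigr => i _; rewrite [tensr _ _ _ _ _]mxE scalerA.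
Qed.

(* The coordinates of the equations on a k-basis of k' are the equations of the
   Weil restriction. *)
Definition mcoord n (i : 'I_(dim k')) (F : {mpoly k'[n]}) : {mpoly k[n]} :=
  \sum_(m <- msupp F) v2r F@_m 0 i *: 'X_[m].

Lemma mcoordE n (R : comNzRingType) (s : {rmorphism k -> R}) (u : 'I_n -> R)
    (F : {mpoly k'[n]}) i :
  (mmap (tensl k' s) (tensr k' s \o u) F : 'rV[R]_(dim k')) 0 i
    = mmap s u (mcoord i F).
Proof.
rewrite [RHS]rmorph_sum /= [mmap (tensl _ _) _ _]/mmap summxE.
apply: eq_bigr => m _.
have -> : mmap1 (tensr k' s \o u) m = tensr k' s (mmap1 u m).
  by rewrite /mmap1 rmorph_prod; apply: eq_bigr => j _; rewrite rmorphXn.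
rewrite mulrC tensr_mul !mxE.
by rewrite mmapZ mmapX mulrC.
Qed.

Lemma mcoord_decomp n (F : {mpoly k'[n]}) :
  F = \sum_i (tbasis i)%:MP * map_mpoly (in_alg k') (mcoord i F).
Proof.
rewrite [LHS]mpolyE.
have E i : (tbasis i)%:MP * map_mpoly (in_alg k') (mcoord i F)
   = \sum_(m <- msupp F) (v2r F@_m 0 i *: tbasis i) *: 'X_[m].
  rewrite rmorph_sum mulr_sumr; apply: eq_bigr => m _ /=.
  rewrite /map_mpoly mmapZ mmapX mmap1_id -mul_mpolyC !mulrA -!rmorphM /=.
  by rewrite mulr_algr mul_mpolyC.
rewrite (eq_bigr _ (fun i _ => E i)) exchange_big; apply: eq_bigr => m _ /=.
rewrite -scaler_suml; congr (_ *: _); apply: v2r_inj; rewrite linear_sum.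
rewrite {1}[v2r _]row_sum_delta.
by apply: eq_bigr => i _; rewrite linearZ /= /tbasis r2vK.
Qed.

End TensorCoordinates.

Section Levitations.
Variables (k : fieldType) (k' : fieldExtType k) (G : affgrp k).
Variables (G' : affgrp k') (pi' : grp_hom (bc_grp (in_alg k') G) G').
Variable (H' : subgrp G').

Definition pullback (f : {mpoly k'[gdim G']}) : {mpoly k'[gdim G]} :=
  mmap (@mpolyC (gdim G) k') (hom_poly pi') f.

Section Functor.
Variables (R : comNzRingType) (s : {rmorphism k -> R}).
Implicit Types u v : 'I_(gdim G) -> R.

Let bcs_eq n (u : 'I_n -> R) (f : {mpoly k[n]}) :
  mmap (tensl k' s \o in_alg k') (tensr k' s \o u) f = tensr k' s (mmap s u f).
Proof.
rewrite (rmorph_mmap (tensr k' s)).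
by apply: eq_mmap => // c; apply: tens_compat.
Qed.

Lemma tensr_zeros n (I : ideal k n) (u : 'I_n -> R) : zeros I s u ->
  zeros (bc_ideal (in_alg k') I) (tensl k' s) (tensr k' s \o u).
Proof. by move=> Iu; apply/bc_zeros => f If; rewrite bcs_eq Iu // rmorph0. Qed.

Lemma tensr_gpts u : gpts G s u ->
  gpts (bc_grp (in_alg k') G) (tensl k' s) (tensr k' s \o u).
Proof. exact: tensr_zeros. Qed.

Lemma tensr_gmul u v :
  tensr k' s \o gmul G s u v
  = gmul (bc_grp (in_alg k') G) (tensl k' s) (tensr k' s \o u) (tensr k' s \o v).
Proof.
apply: functional_extensionality => i; rewrite /gmul /= mmap_map_mpoly.
rewrite -bcs_eq; apply: eq_mmap => // j.
by rewrite /= /join_pts; case: split.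
Qed.

Lemma iG_pullback u f : mmap (tensl k' s) (iG pi' s u) f
  = mmap (tensl k' s) (tensr k' s \o u) (pullback f).
Proof. by rewrite mmap_comp. Qed.

(** An element of [tens k' s] vanishes exactly when its coordinates on the basis of [k'] do. The
    condition on [u] becomes polynomial over [k], which is why the preimage is closed. *)
Lemma weil_subP u : weil_sub_pts H' (iG pi' s u) <->
  forall f, sideal H' f -> forall i, mmap s u (mcoord i (pullback f)) = 0.
Proof.
split=> [Hu f Hf i | Hu f Hf].
  by rewrite -mcoordE -iG_pullback Hu // mxE.
rewrite iG_pullback; apply/rowP => i; rewrite mcoordE Hu //.
by rewrite [RHS]mxE.
Qed.

End Functor.

Lemma iG_gpts (R : comNzRingType) (s : {rmorphism k -> R}) u :
  gpts G s u -> gpts G' (tensl k' s) (iG pi' s u).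
Proof. by move=> Gu; apply: hom_gpts; apply: tensr_gpts. Qed.

Lemma iG_mul (R : comNzRingType) (s : {rmorphism k -> R}) u v :
  gpts G s u -> gpts G s v ->
  iG pi' s (gmul G s u v) = gmul G' (tensl k' s) (iG pi' s u) (iG pi' s v).
Proof.
move=> Gu Gv; rewrite /iG -!/(_ \o _) tensr_gmul.
by apply: functional_extensionality; apply: hom_mul; apply: tensr_gpts.
Qed.

Lemma iG_one (R : comNzRingType) (s : {rmorphism k -> R}) :
  iG pi' s (gone G s) = gone G' (tensl k' s).
Proof.
have G1 : gpts G s (gone G s) by exact: gone_pts.
apply: (@pt_mulgI _ _ _ _ (iG pi' s (gone G s))); try exact: iG_gpts.
by rewrite -iG_mul // pt_mul1g.
Qed.

Lemma iG_inv (R : comNzRingType) (s : {rmorphism k -> R}) u :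
  gpts G s u -> iG pi' s (ginv G s u) = ginv G' (tensl k' s) (iG pi' s u).
Proof.
move=> Gu; have Gi := ginv_pts Gu.
apply: pt_inv_unique; try exact: iG_gpts.
by rewrite -iG_mul // pt_mulVg // iG_one.
Qed.

Definition iG_preimage_mem (f : {mpoly k[gdim G]}) :=
  forall (R : comNzRingType) (s : {rmorphism k -> R}) u,
    gpts G s u -> weil_sub_pts H' (iG pi' s u) -> mmap s u f = 0.

Lemma iG_preimage_ideal : is_ideal iG_preimage_mem.
Proof.
split=> [R s u _ _ | f g If Ig R s u Gu Hu | f g Ig R s u Gu Hu].
- by rewrite rmorph0.
- by rewrite rmorphD /= If // Ig // addr0.
- by rewrite rmorphM /= Ig // mulr0.
Qed.

(** The ideal of all functions vanishing on the functor recovers it, because it contains the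
    equations of [G] and the polynomials [mcoord i (pullback f)] that cut the functor out. *)
Lemma iG_preimage_zeros (R : comNzRingType) (s : {rmorphism k -> R}) u :
  zeros (mkideal iG_preimage_ideal) s u <->
  gpts G s u /\ weil_sub_pts H' (iG pi' s u).
Proof.
split=> [Mu | [Gu Hu] f]; last exact.
split; first by move=> f Gf; apply: Mu => S t v Gv _; apply: Gv.
apply/weil_subP => f Hf i; apply: Mu => S t v Gv /weil_subP; exact.
Qed.

Definition iG_preimage : subgrp G.
Proof.
refine (@SubGrp k G (mkideal iG_preimage_ideal) _ _ _ _).
- by move=> f Gf R s u Gu _; apply: Gu.
- move=> R s u v /iG_preimage_zeros[Gu Hu] /iG_preimage_zeros[Gv Hv].
  apply/iG_preimage_zeros; split; first exact: gmul_pts.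
  by rewrite iG_mul //; apply: smul_pts.
- move=> R s; apply/iG_preimage_zeros; split; first exact: gone_pts.
  by rewrite iG_one; apply: sone_pts.
- move=> R s u /iG_preimage_zeros[Gu Hu].
  apply/iG_preimage_zeros; split; first exact: ginv_pts.
  by rewrite iG_inv //; apply: sinv_pts.
Defined.

Lemma iG_preimageP : is_iG_preimage pi' H' iG_preimage.
Proof. exact: iG_preimage_zeros. Qed.

(** This says that [pi'] maps the base change of the preimage into [H']. By [mcoord_decomp],
    [pullback f] is a combination over [k'] of its coordinates, each of which vanishes on the
    preimage. *)
Lemma pullback_iG_preimage f :
  sideal H' f -> bc_ideal (in_alg k') (sideal iG_preimage) (pullback f).
Proof.
move=> Hf; rewrite [pullback f]mcoord_decomp.
apply: (is_ideal_sum (idealP _)) => i _; apply: idealM.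
exists [:: (1, mcoord i (pullback f))]; last by rewrite big_seq1 mul1r.
move=> p; rewrite inE => /eqP-> R s u Gu /weil_subP; exact.
Qed.

Lemma levitation_le (H : subgrp G) :
  levitation pi' H' H -> sub_le H iG_preimage.
Proof.
move=> Hlev f Mf.
(* The unit is a point of [H], so the coordinate ring of [H] is nonzero and carries the universal
   point. *)
have H1 : ~ sideal H 1.
  move=> /(@sone_pts _ _ H k idfun)/eqP.
  by rewrite rmorph1 oner_eq0.
have [Q [pi [_ piP]]] := quotient_ring (idealP (sideal H)) H1.
pose s : {rmorphism k -> Q} := pi \o (@mpolyC (gdim G) k).
have ev g : mmap s (fun i => pi 'X_i) g = pi g.
  by rewrite -[in RHS](mmap_id g) rmorph_mmap.
have Hu : zeros (sideal H) s (fun i => pi 'X_i).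
  by move=> g Hg; rewrite ev; apply/piP.
apply/piP; rewrite -ev; apply: Mf.
  by move=> g Gg; apply: Hu; apply: sideal_sub.
by move=> g /Hlev Hg; rewrite iG_pullback; apply: (tensr_zeros Hu).
Qed.

(** The upper bound puts the image of [K] inside [H']; the lower bound [H], whose image is already
    [H'], gives the converse. *)
Lemma levitation_sandwich (H K : subgrp G) : levitation pi' H' H ->
  sub_le H K -> sub_le K iG_preimage -> levitation pi' H' K.
Proof.
move=> Hlev HK KM f; split=> [/pullback_iG_preimage | Kf].
  by move=> [l lM E]; exists l => // p /lM /KM.
by apply/Hlev; case: Kf => l lK E; exists l => // p /lK /HK.
Qed.

Lemma largest_levitation : (exists H, levitation pi' H' H) ->
  is_largest (levitation pi' H') iG_preimage.
Proof.
move=> [H Hlev]; split; last exact: levitation_le.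
by apply: (levitation_sandwich Hlev) => //; apply: levitation_le.
Qed.

Lemma largest_smooth_levitation (K : subgrp G) :
  is_smooth_part iG_preimage K -> (exists H, smooth_levitation pi' H' H) ->
  is_largest (smooth_levitation pi' H') K.
Proof.
move=> [[KM Ksm] Kmax] [H [Hlev Hsm]].
split=> [|L [Llev Lsm]]; last by apply: Kmax; split=> //; apply: levitation_le.
split=> //; apply: (levitation_sandwich Hlev) => //.
by apply: Kmax; split=> //; apply: levitation_le.
Qed.

End Levitations.

(** * Hilbert's basis theorem and Krull's intersection theorem *)

Definition generates (A : comNzRingType) (l : seq A) (S : A -> Prop) :=
  forall J, is_ideal J -> (forall y, y \in l -> J y) -> forall a, S a -> J a.

Definition noetherian (A : comNzRingType) := forall I : A -> Prop, is_ideal I ->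
  exists2 l : seq A, (forall y, y \in l -> I y) & generates l I.

(** The elements generated by some finite part of [S] form an ideal, and each of its finitely many
    generators involves only finitely many elements of [S]. *)
Lemma noetherian_set (A : comNzRingType) (S : A -> Prop) : noetherian A ->
  exists2 l : seq A, (forall y, y \in l -> S y) & generates l S.
Proof.
move=> noA.
pose I a := exists2 l : seq A, (forall y, y \in l -> S y) & generates l (eq a).
have idI : is_ideal I.
  split=> [|a b [l lS la] [l' l'S l'b]|a b [l lS lb]].
  - by exists [::] => // J [J0 _ _] _ _ <-.
  - exists (l ++ l') => [y|J idJ Jl _ <-].
      by rewrite mem_cat => /orP[/lS|/l'S].
    apply: (is_idealD idJ); [apply: la => // y yl | apply: l'b => // y yl];
      by apply: Jl; rewrite mem_cat yl ?orbT.
  - by exists l => // J idJ Jl _ <-; apply: (is_idealM idJ); apply: lb.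
have [l lI lgen] := noA _ idI.
have [l' l'S l'gen] : exists2 l' : seq A, (forall y, y \in l' -> S y) &
    forall y, y \in l -> generates l' (eq y).
  elim: l lI {lgen} => [|x l IH] lI; first by exists [::].
  have [|l1 l1S l1gen] := IH; first by move=> y yl; apply: lI; rewrite inE yl orbT.
  have [|l2 l2S l2gen] := lI x; first by rewrite inE eqxx.
  exists (l1 ++ l2) => [y|y]; first by rewrite mem_cat => /orP[/l1S|/l2S].
  rewrite inE => yl J idJ Jl _ <-.
  have Jl1 z : z \in l1 -> J z by move=> zl; apply: Jl; rewrite mem_cat zl.
  have Jl2 z : z \in l2 -> J z by move=> zl; apply: Jl; rewrite mem_cat zl orbT.
  by case/orP: yl => [/eqP->|/l1gen]; [apply: l2gen | apply].
exists l' => // J idJ Jl' a Sa; apply: (lgen J idJ) => [y yl|].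
  exact: (l'gen y yl J idJ Jl' y erefl).
exists [:: a] => [y|K _ Kl _ <-]; first by rewrite inE => /eqP->.
by apply: Kl; rewrite inE.
Qed.

Lemma noetherian_surj (A B : comNzRingType) (f : {rmorphism A -> B}) :
  (forall b, exists a, f a = b) -> noetherian A -> noetherian B.
Proof.
move=> fsurj noA I idI.
have idfI : is_ideal (I \o f).
  split=> [|a b Ia Ib|a b Ib] /=; first by rewrite rmorph0; case: idI.
    by rewrite rmorphD; apply: (is_idealD idI).
  by rewrite rmorphM; apply: (is_idealM idI).
have [l lI lgen] := noA _ idfI.
exists (map f l) => [_ /mapP[a /lI Ia ->] //|J idJ Jl b Ib].
have [a fa] := fsurj b; rewrite -fa.
apply: (lgen (J \o f)) => [|a' a'l|]; last by rewrite /= fa.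
  split=> [|x y Jx Jy|x y Jy] /=; first by rewrite rmorph0; case: idJ.
    by rewrite rmorphD; apply: (is_idealD idJ).
  by rewrite rmorphM; apply: (is_idealM idJ).
by apply: Jl; apply: map_f.
Qed.

Lemma noetherian_field (k : fieldType) : noetherian k.
Proof.
move=> I idI; case: (excluded_middle_informative (exists2 a, I a & a != 0)).
  move=> [a Ia a0]; exists [:: a] => [y|J idJ Jl b _].
    by rewrite inE => /eqP->.
  rewrite -(divfK a0 b); apply: (is_idealM idJ); apply: Jl; exact: mem_head.
move=> I0; exists [::] => // J [J0 _ _] _ a Ia.
have [-> //|a0] := eqVneq a 0; by case: I0; exists a.
Qed.

Section HilbertBasis.
Variables (A : comNzRingType) (noA : noetherian A).
Variables (I : {poly A} -> Prop) (idI : is_ideal I).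

Let leadc d a := exists2 f, I f & (size f <= d.+1)%N /\ f`_d = a.

Let leadc_ideal (J : {poly A} -> Prop) d : is_ideal J ->
  is_ideal (fun a => exists2 f, J f & (size f <= d.+1)%N /\ f`_d = a).
Proof.
move=> idJ; split.
- exists 0; first by case: idJ.
  by rewrite size_poly0 coef0.
- move=> a b [f Jf [sf <-]] [g Jg [sg <-]]; exists (f + g).
    exact: (is_idealD idJ).
  by rewrite coefD (leq_trans (size_polyD _ _)) // geq_max sf sg.
- move=> a b [g Jg [sg <-]]; exists (a%:P * g).
    exact: (is_idealM idJ).
  rewrite coefCM; split=> //.
  by rewrite mul_polyC (leq_trans (size_scale_leq _ _)).
Qed.

Let leadc_mono (J : {poly A} -> Prop) : is_ideal J -> forall d e a, (d <= e)%N ->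
  (exists2 f, J f & (size f <= d.+1)%N /\ f`_d = a) ->
  exists2 f, J f & (size f <= e.+1)%N /\ f`_e = a.
Proof.
move=> idJ d e a le_de [f Jf [sf fa]]; exists ('X^(e - d) * f).
  exact: (is_idealM idJ).
split; last by rewrite coefXnM ltnNge leq_subr /= subKn.
rewrite (leq_trans (size_polyMleq _ _)) // size_polyXn.
by rewrite addSn /= -[X in (_ <= X.+1)%N](subnK le_de) -addnS leq_add2l.
Qed.

Let IJ (J : {poly A} -> Prop) f := I f /\ J f.

Let IJ_ideal J : is_ideal J -> is_ideal (IJ J).
Proof.
move=> idJ; split=> [|a b [Ia Ja] [Ib Jb]|a b [Ib Jb]].
- by split; [case: idI | case: idJ].
- by split; [apply: (is_idealD idI) | apply: (is_idealD idJ)].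
- by split; [apply: (is_idealM idI) | apply: (is_idealM idJ)].
Qed.

Let lifts (S : A -> Prop) d : (forall a, S a -> leadc d a) ->
  forall l : seq A, (forall y, y \in l -> S y) ->
  exists2 p : seq {poly A}, (forall f, f \in p -> I f) &
    forall J, is_ideal J -> (forall f, f \in p -> J f) ->
      forall y, y \in l -> exists2 f, IJ J f & (size f <= d.+1)%N /\ f`_d = y.
Proof.
move=> SL; elim=> [|y l IH] lS; first by exists [::].
have [|p pI pJ] := IH; first by move=> x xl; apply: lS; rewrite inE xl orbT.
have [f If fy] := SL _ (lS y (mem_head _ _)).
exists (f :: p) => [g|J idJ Jp x]; first by rewrite inE => /orP[/eqP->|/pI].
rewrite inE => /orP[/eqP->|]; first by exists f => //; split=> //; exact/Jp/mem_head.
by apply: pJ => // g gp; apply: Jp; rewrite inE gp orbT.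
Qed.

Let lead_gens d : exists2 p : seq {poly A}, (forall f, f \in p -> I f) &
  forall J, is_ideal J -> (forall f, f \in p -> J f) ->
    forall a, leadc d a -> exists2 f, IJ J f & (size f <= d.+1)%N /\ f`_d = a.
Proof.
have [l lL lgen] := noA (leadc_ideal d idI).
have [p pI pJ] := lifts (fun a La => La) lL.
exists p => // J idJ Jp; apply: lgen (leadc_ideal d (IJ_ideal idJ)) _.
exact: pJ.
Qed.

(** The leading coefficients of [I] form an ideal of [A] whose generators all occur in some degree
    [D]. Lifts of generators of the leading ideals in degrees up to [D] generate [I], since they
    suffice to cancel a leading term of any degree. *)
Lemma hilbert_poly :
  exists2 p : seq {poly A}, (forall f, f \in p -> I f) & generates p I.
Proof.
have [|l lL lgen] := noA (I := fun a => exists d, leadc d a).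
  split=> [|a b [d Ld] [e Le]|a b [d Ld]].
  - by exists 0%N; apply: (is_ideal0 (leadc_ideal 0 idI)).
  - exists (maxn d e); apply: (is_idealD (leadc_ideal _ idI)).
      by apply: leadc_mono Ld => //; apply: leq_maxl.
    by apply: leadc_mono Le => //; apply: leq_maxr.
  - by exists d; apply: (is_idealM (leadc_ideal _ idI)).
have [D DL] : exists D, forall y, y \in l -> leadc D y.
  elim: l lL {lgen} => [|x l IH] lL; first by exists 0%N.
  have [|D DL] := IH; first by move=> y yl; apply: lL; rewrite inE yl orbT.
  have [d xd] := lL x (mem_head _ _); exists (maxn d D) => y.
  rewrite inE => /orP[/eqP->|/DL Ly].
    by apply: leadc_mono xd => //; apply: leq_maxl.
  by apply: leadc_mono Ly => //; apply: leq_maxr.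
have [p pI pJ] : exists2 p : seq {poly A}, (forall f, f \in p -> I f) &
    forall J, is_ideal J -> (forall f, f \in p -> J f) -> forall d, (d <= D)%N ->
    forall a, leadc d a -> exists2 f, IJ J f & (size f <= d.+1)%N /\ f`_d = a.
  elim: {DL} D => [|D [p pI pJ]].
    have [p pI pJ] := lead_gens 0.
    by exists p => // J idJ Jp d; rewrite leqn0 => /eqP->; apply: pJ.
  have [q qI qJ] := lead_gens D.+1.
  exists (p ++ q) => [f|J idJ Jpq d]; first by rewrite mem_cat => /orP[/pI|/qI].
  rewrite leq_eqVlt ltnS => /orP[/eqP->|].
    by apply: qJ => // f fq; apply: Jpq; rewrite mem_cat fq orbT.
  by apply: pJ => // f fp; apply: Jpq; rewrite mem_cat fp.
exists p => // J idJ Jp.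
have Jlead d a : leadc d a -> exists2 f, IJ J f & (size f <= d.+1)%N /\ f`_d = a.
  case: (leqP d D) => [led La|ltDd La]; first exact: (pJ J idJ Jp d led a La).
  have idK := leadc_ideal D (IJ_ideal idJ).
  apply: (leadc_mono (IJ_ideal idJ) (ltnW ltDd)); apply: (lgen _ idK).
    by move=> y /DL; apply: pJ.
  by exists d.
move=> f; have [m] := ubnP (size f); elim: m f => // m IH f sf If.
have [->|f0] := eqVneq f 0; first by case: idJ.
have sf' : size f = (size f).-1.+1 by rewrite prednK // size_poly_gt0.
have [|g [Ig Jg] [sg gf]] := Jlead (size f).-1 (f`_(size f).-1).
  by exists f => //; rewrite -sf'.
rewrite -[f](subrK g); apply: (is_idealD idJ) => //; apply: IH.
  have sfg : (size (f - g)%R <= size f)%N.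
    rewrite (leq_trans (size_polyD _ _)) // size_polyN geq_max leqnn /=.
    by rewrite [X in (_ <= X)%N]sf'.
  rewrite ltnNge; apply/negP => lt_m.
  have es : size (f - g) = size f.
    by apply/eqP; rewrite eqn_leq sfg (leq_trans _ lt_m).
  have : lead_coef (f - g) = 0 by rewrite lead_coefE es coefB gf subrr.
  move/eqP; rewrite lead_coef_eq0 -size_poly_eq0 es size_poly_eq0.
  by rewrite (negPf f0).
exact: (is_idealB idI).
Qed.

End HilbertBasis.

Lemma noetherian_poly (A : comNzRingType) : noetherian A -> noetherian {poly A}.
Proof. by move=> noA I idI; apply: hilbert_poly. Qed.

Lemma noetherian_mpoly (A : comNzRingType) n : noetherian A ->
  noetherian {mpoly A[n]}.
Proof.
move=> noA; elim: n => [|n IH].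
  apply: (noetherian_surj (f := @mpolyC 0 A)) noA => p.
  by exists p@_0%MM; apply: mpolyKC.
pose f : {rmorphism {poly {mpoly A[n]}} -> {mpoly A[n.+1]}} :=
  horner_eval 'X_ord_max \o map_poly (@mwiden n A).
apply: (noetherian_surj (f := f)) (noetherian_poly IH) => p.
elim/mpolyind: p => [|c m p _ _ [q <-]]; first by exists 0; rewrite rmorph0.
suff [r <-] : exists r, f r = c *: 'X_[m] by exists (r + q); rewrite rmorphD.
have [r <-] : exists r, f r = 'X_[m].
  rewrite mpolyXE_id; elim/big_ind: _ => [|x y [a <-] [b <-]|i _].
  - by exists 1; rewrite rmorph1.
  - by exists (a * b); rewrite rmorphM.
  suff [a <-] : exists a, f a = 'X_i by exists (a ^+ m i); rewrite rmorphXn.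
  have [j ->|->] := unliftP ord_max i.
    exists ('X_j)%:P; rewrite /f /= map_polyC /horner_eval hornerC /= mwidenX.
    rewrite mnmwiden1; congr 'X_[U_(_)]; apply: val_inj.
    by rewrite /= /bump leqNgt ltn_ord.
  by exists 'X; rewrite /f /= map_polyX /horner_eval hornerX.
exists (c%:MP%:P * r); rewrite rmorphM -mul_mpolyC; congr (_ * _).
by rewrite /f /= map_polyC /horner_eval hornerC /= mwidenC.
Qed.

(** * Powers of a finitely generated ideal *)

Section Powers.
Variables (A : comNzRingType) (r : nat) (y : 'I_r -> A).

Fixpoint idpow N (a : A) : Prop :=
  if N is N'.+1 then
    exists2 b : 'I_r -> A, (forall i, idpow N' (b i)) & a = \sum_i y i * b i
  else True.

Lemma idpow_ideal N : is_ideal (idpow N).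
Proof.
elim: N => [|N [I0 ID IM]]; first by split.
split=> [|a b [f If ->] [g Ig ->]|a b [g Ig ->]] /=.
- by exists (fun=> 0) => //; rewrite big1 // => i _; rewrite mulr0.
- exists (fun i => f i + g i).
    by move=> i; exact: (ID _ _ (If i) (Ig i)).
  by rewrite -big_split; apply: eq_bigr => i _; rewrite mulrDr.
- exists (fun i => a * g i); first by move=> i; exact: (IM _ _ (Ig i)).
  by rewrite mulr_sumr; apply: eq_bigr => i _; rewrite mulrCA.
Qed.

Lemma idpowS N a : idpow N.+1 a -> idpow N a.
Proof.
move=> [b Ib ->]; apply: (is_ideal_sum (idpow_ideal N)) => i _.
exact: (is_idealM (idpow_ideal N) _ (Ib i)).
Qed.

Lemma idpow_leq M N a : (M <= N)%N -> idpow N a -> idpow M a.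
Proof.
move=> le_MN; rewrite -(subnK le_MN); elim: (N - M)%N => // d IH.
by rewrite addSn => /idpowS.
Qed.

Lemma idpow_mul M N a b : idpow M a -> idpow N b -> idpow (M + N) (a * b).
Proof.
elim: M a => [|M IH] a /=; first by move=> _; apply: (is_idealM (idpow_ideal N)).
move=> [c Ic ->] Ib; exists (fun i => c i * b); first by move=> i; apply: IH.
by rewrite mulr_suml; apply: eq_bigr => i _; rewrite mulrA.
Qed.

Lemma idpow_exp M a n : idpow M a -> idpow (M * n) (a ^+ n).
Proof.
move=> Ia; elim: n => [|n IH]; first by rewrite muln0.
by rewrite mulnS exprS; apply: idpow_mul.
Qed.

Lemma idpow_gen i : idpow 1 (y i).
Proof.
exists (fun j => (i == j)%:R) => //.
rewrite (bigD1 i) //= eqxx mulr1 big1 ?addr0 // => j.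
by rewrite eq_sym => /negPf->; rewrite mulr0.
Qed.

Lemma idpow_monomial (m : 'X_{1..r}) : idpow (mdeg m) (mmap1 y m).
Proof.
rewrite mdegE /mmap1; elim/big_ind2: _ => // [a b c d Ia Ic|i _].
  exact: idpow_mul.
by rewrite -[X in idpow X]mul1n; apply/idpow_exp/idpow_gen.
Qed.

Lemma idpow_ex_homog N a : idpow N a ->
  exists2 F : {mpoly A[r]}, F \is N.-homog & a = F.@[y].
Proof.
elim: N a => [|N IH] a.
  by exists a%:MP; rewrite ?mevalC // -[_%:MP]mulr1 mul_mpolyC dhomogZ ?dhomog1.
move=> [b Ib ->].
have /choice_fun[F FP] : forall i, exists F : {mpoly A[r]},
    F \is N.-homog /\ b i = F.@[y].
  by move=> i; have [F] := IH _ (Ib i); exists F.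
exists (\sum_i 'X_i * F i).
  apply: rpred_sum => i _; rewrite -[N.+1]add1n; apply: dhomogM; last by case: (FP i).
  by rewrite dhomogX /= mdeg1.
rewrite rmorph_sum; apply: eq_bigr => i _; rewrite rmorphM /= mevalXU.
by have [_ ->] := FP i.
Qed.

(** Pigeonhole: a monomial in [r] variables of degree exceeding [r * p.-1] has an exponent at least
    [p]. *)
Lemma idpow_frobenius p N a : (r * p.-1 < N)%N -> idpow N a ->
  exists b : 'I_r -> A, a = \sum_i b i * y i ^+ p.
Proof.
move=> ltN /idpow_ex_homog[F /dhomogP hF ->].
pose J a := exists b : 'I_r -> A, a = \sum_i b i * y i ^+ p.
have idJ : is_ideal J.
  split=> [|_ _ [b ->] [c ->]|d _ [b ->]].
  - by exists (fun=> 0); rewrite big1 // => i _; rewrite mul0r.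
  - exists (fun i => b i + c i); rewrite -big_split; apply: eq_bigr => i _.
    by rewrite mulrDl.
  - exists (fun i => d * b i); rewrite mulr_sumr; apply: eq_bigr => i _.
    by rewrite mulrA.
have Jy i : J (y i ^+ p).
  exists (fun j => (i == j)%:R); rewrite (bigD1 i) //= eqxx mul1r big1 ?addr0 // => j.
  by rewrite eq_sym => /negPf->; rewrite mul0r.
apply: (is_ideal_sum_mem idJ) => m /hF dm; apply: (is_idealM idJ).
have {}dm : mdeg m = N := dm.
have [i ltpi] : exists i, (p.-1 < m i)%N.
  apply/existsP; apply: contraLR ltN; rewrite negb_exists => /forallP small.
  rewrite -leqNgt -dm mdegE -[X in (_ <= X * _)%N]card_ord -sum_nat_const.
  by apply: leq_sum => i _; rewrite leqNgt.
rewrite /mmap1 (bigD1 i) //=; apply: (is_idealMr idJ).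
have -> : m i = (p + (m i - p))%N by lia.
by rewrite exprD; apply: (is_idealMr idJ).
Qed.

End Powers.

Lemma pihomogMX n (A : comNzRingType) d (m : 'X_{1..n}) (F : {mpoly A[n]}) :
  pihomog mdeg d ('X_[m] * F)
  = if (mdeg m <= d)%N then 'X_[m] * pihomog mdeg (d - mdeg m) F else 0.
Proof.
rewrite [F]mpolyE mulr_sumr !raddf_sum /=.
rewrite (eq_bigr (fun i => if (mdeg m <= d)%N then
    'X_[m] * pihomog mdeg (d - mdeg m) (F@_i *: 'X_[i]) else 0)).
  by case: leqP => _; rewrite ?mulr_sumr // big1.
move=> i _; rewrite -scalerAr -mpolyXD !linearZ /= !pihomogX /= mdegD.
case: leqP => le_md; last by rewrite gtn_eqF ?scaler0 // ltn_addr.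
have -> : (mdeg i == d - mdeg m)%N = (mdeg m + mdeg i == d)%N by lia.
by case: eqP => _; rewrite -scalerAr -?mpolyXD ?mulr0.
Qed.

(** Consider the homogeneous [H] with [H(y)] congruent to [a] modulo [J]. Finitely many of them, of
    degrees at most [M], generate all others. One of degree [M.+1] is then a combination with
    coefficients of positive degree, and evaluation at [y] gives the multiplier [c]. *)
Lemma krull_intersection (A : comNzRingType) r (y : 'I_r -> A) (J : A -> Prop) a :
  noetherian A -> is_ideal J ->
  (forall N, exists2 b, J b & idpow y N (a - b)) ->
  exists2 c, idpow y 1 c & J (a - c * a).
Proof.
move=> noA idJ aJ.
pose S (H : {mpoly A[r]}) := exists2 N, H \is N.-homog & J (a - H.@[y]).
have [l lS lgen] := noetherian_set S (noetherian_mpoly (n := r) noA).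
have [M HM] : exists M, forall H, H \in l ->
    exists2 N, (N <= M)%N & H \is N.-homog /\ J (a - H.@[y]).
  elim: l lS {lgen} => [|H l IH] lS; first by exists 0%N.
  have [|M HM] := IH; first by move=> F Fl; apply: lS; rewrite inE Fl orbT.
  have [N HN JH] := lS H (mem_head _ _).
  exists (maxn M N) => F; rewrite inE => /orP[/eqP->|/HM[N' le_N' FP]].
    by exists N => //; apply: leq_maxr.
  by exists N' => //; apply: leq_trans le_N' (leq_maxl _ _).
(* [K] records this on homogeneous components: each evaluates to a multiple of [a] modulo [J], with
   multiplier in the ideal of [y] in degrees above [M]. *)
pose K (F : {mpoly A[r]}) := forall d, exists2 c,
  J ((pihomog mdeg d F).@[y] - c * a) & (M < d)%N -> idpow y 1 c.
have id1 := idpow_ideal y 1.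
have idK : is_ideal K.
  have KD F G : K F -> K G -> K (F + G).
    move=> KF KG d; have [b Jb Ib] := KF d; have [c Jc Ic] := KG d.
    exists (b + c); last by move=> Md; apply: (is_idealD id1); auto.
    rewrite raddfD /= rmorphD mulrDl opprD addrACA; exact: (is_idealD idJ).
  have K0 : K 0.
    move=> d; exists 0; last by move=> _; apply: (is_ideal0 id1).
    by rewrite raddf0 rmorph0 mul0r subr0; apply: (is_ideal0 idJ).
  split=> // F G KG; elim/mpolyind: F => [|c m F _ _ KF]; first by rewrite mul0r.
  rewrite mulrDl; apply: KD => // d.
  rewrite -scalerAl linearZ /= pihomogMX; case: (leqP (mdeg m) d) => [le_md|_]; last first.
    exists 0; last by move=> _; apply: (is_ideal0 id1).
    by rewrite scaler0 rmorph0 mul0r subr0; apply: (is_ideal0 idJ).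
  have [b Jb Ib] := KG (d - mdeg m)%N.
  exists (c * (mmap1 y m * b)).
    rewrite mevalZ mevalM mevalX -/(mmap1 y m) -!mulrA -mulrBr -mulrBr.
    by do 2!apply: (is_idealM idJ).
  move=> Md; apply: (is_idealM id1).
  have [m0|m0] := posnP (mdeg m).
    by apply: (is_idealM id1); apply: Ib; rewrite m0 subn0.
  by apply: (is_idealMr id1); apply: idpow_leq m0 (idpow_monomial _ _).
have [b Jb /idpow_ex_homog[H Hh bH]] := aJ M.+1.
have [||c Jc Ic] := lgen K idK _ H _ M.+1.
- move=> F /HM[N le_NM [Fh JF]] d.
  have [<-|neq] := eqVneq N d.
    exists 1; first by rewrite mul1r pihomog_dE // -opprB; apply: (is_idealN idJ).
    by rewrite ltnNge le_NM.
  exists 0; last by move=> _; apply: (is_ideal0 id1).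
  by rewrite (pihomog_ne0 neq Fh) rmorph0 mul0r subr0; apply: (is_ideal0 idJ).
- by exists M.+1 => //; rewrite -bH subKr.
exists c; first exact: Ic.
move: Jc; rewrite pihomog_dE // -bH => Jc; rewrite -[a in a - _](subrK b).
by rewrite -addrA addrCA; apply: (is_idealD idJ).
Qed.

(** * Formal derivatives and first-order Taylor expansion *)

Lemma mpoly_ring_ind n (A : comNzRingType) (P : {mpoly A[n]} -> Prop) :
  (forall c, P c%:MP) -> (forall i, P 'X_i) ->
  (forall f g, P f -> P g -> P (f + g)) ->
  (forall f g, P f -> P g -> P (f * g)) -> forall f, P f.
Proof.
move=> PC PX PD PM f; rewrite [f]mpolyE.
elim/big_ind: _ => [|? ?|m _]; [by rewrite -[0](mpolyC0 n A)|exact: PD|].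
rewrite -mul_mpolyC; apply: (PM) => //; rewrite mpolyXE_id.
elim/big_ind: _ => [|? ?|i _]; [by rewrite -[1](mpolyC1 n A)|exact: PM|].
elim: (m i) => [|d IH]; first by rewrite expr0 -[1](mpolyC1 n A).
by rewrite exprS; apply: (PM).
Qed.

Lemma mderivXU n (A : comNzRingType) (i j : 'I_n) :
  ('X_i : {mpoly A[n]})^`M(j) = (i == j)%:R.
Proof.
rewrite mderivX mnm1E; case: eqP => [->|_]; last by rewrite scale0r.
have -> : (U_(j) - U_(j) = 0)%MM by apply/mnmP => b; rewrite mnmBE subnn mnm0E.
by rewrite mpolyX0 scale1r.
Qed.

Lemma mmap_taylor1 n (A R : comNzRingType) (s : {rmorphism A -> R})
    (u d : 'I_n -> R) (f : {mpoly A[n]}) :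
  (forall a b, d a * d b = 0) ->
  mmap s (fun i => u i + d i) f
    = mmap s u f + \sum_b d b * mmap s u f^`M(b).
Proof.
move=> dd; elim/mpoly_ring_ind: f => [c|i|f g Ef Eg|f g Ef Eg].
- rewrite !mmapC big1 ?addr0 // => b _.
  by rewrite mderivC raddf0 mulr0.
- rewrite !mmapX !mmap1U (bigD1 i) //= big1 ?addr0 => [|b bi].
    by rewrite mderivXU eqxx rmorph1 mulr1.
  by rewrite mderivXU eq_sym (negPf bi) raddf0 mulr0.
- rewrite !raddfD /= Ef Eg addrACA -big_split /=; congr (_ + _).
  by apply: eq_bigr => b _; rewrite mderivD raddfD mulrDr.
- rewrite !rmorphM /= Ef Eg; set F := \sum_b _; set H := \sum_b _.
  have FH0 : F * H = 0.
    rewrite mulr_suml big1 // => b _; rewrite mulr_sumr big1 // => c _.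
    by rewrite mulrACA dd mul0r.
  have -> : \sum_b d b * mmap s u (f * g)^`M(b)
      = F * mmap s u g + mmap s u f * H.
    rewrite mulr_suml mulr_sumr -big_split; apply: eq_bigr => b _ /=.
    by rewrite mderivM raddfD /= !rmorphM /= mulrDr mulrA mulrCA.
  by rewrite mulrDl !mulrDr FH0 addr0 -addrA; congr (_ + _); rewrite addrC.
Qed.

(** * Regularity at the unit implies smoothness *)

Section PairIdeal.
Variables (k : fieldType) (n : nat) (J : {mpoly k[n]} -> Prop).

Definition lvars (i : 'I_n) : {mpoly k[n + n]} := 'X_(lshift n i).
Definition rvars (i : 'I_n) : {mpoly k[n + n]} := 'X_(rshift n i).
Definition lemb (f : {mpoly k[n]}) := mmap (@mpolyC (n + n) k) lvars f.
Definition remb (f : {mpoly k[n]}) := mmap (@mpolyC (n + n) k) rvars f.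

HB.instance Definition _ := GRing.RMorphism.copy lemb
  (mmap (@mpolyC (n + n) k) lvars).
HB.instance Definition _ := GRing.RMorphism.copy remb
  (mmap (@mpolyC (n + n) k) rvars).

Lemma mmap_lemb (R : comNzRingType) (s : {rmorphism k -> R}) u v f :
  mmap s (join_pts u v) (lemb f) = mmap s u f.
Proof.
rewrite mmap_comp; apply: eq_mmap => // i.
by rewrite mmapX mmap1U /join_pts -[lshift n i]/(unsplit (inl i)) unsplitK.
Qed.

Lemma mmap_remb (R : comNzRingType) (s : {rmorphism k -> R}) u v f :
  mmap s (join_pts u v) (remb f) = mmap s v f.
Proof.
rewrite mmap_comp; apply: eq_mmap => // i.
by rewrite mmapX mmap1U /join_pts -[rshift n i]/(unsplit (inr i)) unsplitK.
Qed.

Lemma join_vars : join_pts lvars rvars = fun i => 'X_i.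
Proof.
apply: functional_extensionality => i; rewrite /join_pts /lvars /rvars.
by rewrite -[in RHS](splitK i); case: (split i).
Qed.

(** If [J] cuts out [Z], this cuts out [Z x Z]; the quotient is the tensor square of [k[X]/J]. *)
Definition pair_ideal (F : {mpoly k[n + n]}) :=
  exists l1 l2 : seq ({mpoly k[n + n]} * {mpoly k[n]}),
    [/\ forall p, p \in l1 -> J p.2, forall p, p \in l2 -> J p.2
      & F = \sum_(p <- l1) p.1 * lemb p.2 + \sum_(p <- l2) p.1 * remb p.2].

Lemma pair_ideal_ideal : is_ideal pair_ideal.
Proof.
split=> [|_ _ [l1 [l2 [J1 J2 ->]]] [m1 [m2 [K1 K2 ->]]]|F _ [l1 [l2 [J1 J2 ->]]]].
- by exists [::], [::]; split=> //; rewrite !big_nil addr0.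
- exists (l1 ++ m1), (l2 ++ m2); split; last by rewrite !big_cat /= addrACA.
    by move=> p; rewrite mem_cat => /orP[/J1|/K1].
  by move=> p; rewrite mem_cat => /orP[/J2|/K2].
- exists [seq (F * p.1, p.2) | p <- l1], [seq (F * p.1, p.2) | p <- l2]; split.
  + by move=> p /mapP[q /J1 Jq ->].
  + by move=> p /mapP[q /J2 Jq ->].
  + rewrite !big_map mulrDr !mulr_sumr.
    by congr (_ + _); apply: eq_bigr => p _; rewrite mulrA.
Qed.

Lemma pair_ideal_lemb f : J f -> pair_ideal (lemb f).
Proof.
move=> Jf; exists [:: (1, f)], [::].
split=> //; first by move=> p; rewrite inE => /eqP->.
by rewrite big_seq1 big_nil mul1r addr0.
Qed.

Lemma pair_ideal_remb f : J f -> pair_ideal (remb f).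
Proof.
move=> Jf; exists [::], [:: (1, f)].
split=> //; first by move=> p; rewrite inE => /eqP->.
by rewrite big_seq1 big_nil mul1r add0r.
Qed.

End PairIdeal.

Section Comultiplication.
Variables (k : fieldType) (G : affgrp k).
Local Notation n := (gdim G).

Definition comul (f : {mpoly k[n]}) : {mpoly k[n + n]} :=
  mmap (@mpolyC (n + n) k) (@gmulp k G) f.

HB.instance Definition _ := GRing.RMorphism.copy comul
  (mmap (@mpolyC (n + n) k) (@gmulp k G)).

Lemma mmap_comul (R : comNzRingType) (s : {rmorphism k -> R}) u v f :
  mmap s (join_pts u v) (comul f) = mmap s (gmul G s u v) f.
Proof. exact: mmap_comp. Qed.

(** The two copies of the variables are points of [H] modulo the pair ideal, hence so is their
    product. *)
Lemma comul_pair_ideal (H : subgrp G) f :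
  sideal H f -> pair_ideal (sideal H) (comul f).
Proof.
move=> Hf; rewrite -[comul f](mmap_id).
rewrite -join_vars (mmap_comul (@mpolyC (n + n) k)).
apply: (smul_mod (pair_ideal_ideal _)) (Hf) => g Hg.
  exact: pair_ideal_lemb.
exact: pair_ideal_remb.
Qed.

Definition full_sub : subgrp G :=
  @SubGrp k G (gideal G) (fun f Gf => Gf) (@gmul_pts k G) (@gone_pts k G)
    (@ginv_pts k G).

End Comultiplication.

Section Gradient.
Variables (k : fieldType) (n : nat).

(** Take a family in [J] with independent gradients and of maximal size; such sizes are at most
    [n]. *)
Lemma gradient_basis (J : {mpoly k[n]} -> Prop) (e : 'I_n -> k) :
  exists t (Y : 'I_t -> {mpoly k[n]}),
    [/\ forall i, J (Y i), row_free (\matrix_(i, b) (Y i)^`M(b).@[e]) &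
      forall f, J f ->
        (\row_b f^`M(b).@[e] <= \matrix_(i, b) (Y i)^`M(b).@[e])%MS].
Proof.
pose M t (Y : 'I_t -> {mpoly k[n]}) := \matrix_(i < t, b < n) (Y i)^`M(b).@[e].
pose P t := exists2 Y : 'I_t -> {mpoly k[n]}, forall i, J (Y i) & row_free (M t Y).
suff [t [Y JY frY] Nt] : exists2 t, P t & ~ P (t + 1)%N.
  exists t, Y; split=> // f Jf; apply/negPn/negP => nsub; apply: Nt.
  pose Z (i : 'I_(t + 1)) := if split i is inl a then Y a else f.
  exists Z => [i|]; first by rewrite /Z; case: split.
  have -> : M _ Z = col_mx (M _ Y) (\row_b f^`M(b).@[e]).
    apply/matrixP => i b; rewrite !mxE /Z; case: split => a; first by rewrite mxE.
    by rewrite mxE.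
  have lt_sub : (M _ Y < M _ Y + \row_b f^`M(b).@[e])%MS.
    by rewrite /ltmx addsmxSl addsmx_sub submx_refl.
  rewrite /row_free eqn_leq rank_leq_row -addsmxE addn1.
  by rewrite -[X in (X < _)%N](eqP frY) rank_ltmx.
have P0 : P 0%N.
  by exists (fun i => 0) => [[]//|]; rewrite /row_free -leqn0 rank_leq_row.
have Pn t : P t -> (t <= n)%N.
  by move=> [Y _ /eqP <-]; apply: rank_leq_col.
apply: NNPP => allP; have allP' t : P t.
  elim: t => // t Pt; apply: NNPP => NP; apply: allP.
  by exists t => //; rewrite addn1.
by have := Pn _ (allP' n.+1); rewrite ltnn.
Qed.

End Gradient.

Definition aug_mul (k : fieldType) n (e : 'I_n -> k) (J : {mpoly k[n]} -> Prop) f :=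
  exists2 q : 'I_n -> {mpoly k[n]},
    forall i, J (q i) & f = \sum_i ('X_i - (e i)%:MP) * q i.

(* With m the maximal ideal of e: the intersection of J and m^2 lies in m J. *)
Definition regular_at (k : fieldType) n (e : 'I_n -> k)
    (J : {mpoly k[n]} -> Prop) :=
  forall f, J f -> (forall b, f^`M(b).@[e] = 0) -> aug_mul e J f.

Section SpanIdeal.
Variables (k : fieldType) (n : nat) (J : ideal k n).
Variables (R : comNzRingType) (s : {rmorphism k -> R}).

(** The extension of [J] to [R[X]]. Scalars from [R] suffice as coefficients, because [J] is already
    stable under multiplication by monomials. *)
Definition span_ideal (F : {mpoly R[n]}) :=
  exists2 l : seq (R * {mpoly k[n]}),
    forall p, p \in l -> J p.2 & F = \sum_(p <- l) p.1 *: map_mpoly s p.2.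

Lemma span_ideal_ideal : is_ideal span_ideal.
Proof.
have I0 : span_ideal 0 by exists [::]; rewrite ?big_nil.
have ID F G : span_ideal F -> span_ideal G -> span_ideal (F + G).
  move=> [l Jl ->] [m Jm ->]; exists (l ++ m); last by rewrite big_cat.
  by move=> p; rewrite mem_cat => /orP[/Jl|/Jm].
split=> // F G [l Jl ->]; rewrite [F]mpolyE mulr_suml.
elim/big_ind: _ => // m _.
exists [seq (F@_m * p.1, 'X_[m] * p.2) | p <- l].
  by move=> p /mapP[q /Jl Jq ->]; apply: idealM.
rewrite big_map mulr_sumr; apply: eq_bigr => p _ /=.
rewrite rmorphM /= -scalerAl -scalerAr scalerA; congr (_ *: (_ * _)).
by rewrite /map_mpoly mmapX mmap1_id.
Qed.

Lemma span_idealP f : J f -> span_ideal (map_mpoly s f).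
Proof.
move=> Jf; exists [:: (1, f)]; last by rewrite big_seq1 scale1r.
by move=> p; rewrite inE => /eqP->.
Qed.

Section Kernel.
Variables (S : comNzRingType) (q : {rmorphism R -> S}).
Hypothesis q2 : forall x y, q x = 0 -> q y = 0 -> x * y = 0.

(** As [J] is a direct summand of [k[X]] over the field [k], an element of its extension with
    coefficients in the kernel of [q] is a combination of elements of [J] with scalars in that
    kernel. Its value at [w] is a sum of products of two kernel elements. *)
Lemma span_ideal_kernel (w : 'I_n -> R) F :
  (forall f, J f -> q (mmap s w f) = 0) ->
  span_ideal F -> (forall m, q F@_m = 0) -> F.@[w] = 0.
Proof.
move=> Jw [l]; have [N] := ubnP (size l); elim: N l F => // N IH [|[r h] l] F.
  by move=> _ _ -> _; rewrite big_nil rmorph0.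
rewrite ltnS => sl Jl; rewrite big_cons /= => F0 qF.
have Jh : J h := Jl _ (mem_head _ _).
have Jl' p : p \in l -> J p.2 by move=> pl; apply: Jl; rewrite inE pl orbT.
have ev g : (map_mpoly s g).@[w] = mmap s w g.
  rewrite (rmorph_mmap (meval w)).
  by apply: eq_mmap => i /=; rewrite ?mevalC ?mevalXU.
have [h0|h0] := eqVneq h 0.
  by apply: (IH l) => //; rewrite F0 h0 raddf0 scaler0 add0r.
have [m hm] : exists m, h@_m != 0.
  by exists (mlead h); rewrite mleadc_eq0.
(* Gaussian elimination at the monomial [m]: every other term loses its coefficient there, so the
   coefficient of [F] at [m] forces [q r' = 0]. *)
pose c (p : R * {mpoly k[n]}) := p.2@_m / h@_m.
pose l' := [seq (p.1, p.2 - c p *: h) | p <- l].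
pose r' := r + \sum_(p <- l) p.1 * s (c p).
have EF : F = r' *: map_mpoly s h + \sum_(p <- l') p.1 *: map_mpoly s p.2.
  rewrite F0 /r' scalerDl -addrA; congr (_ + _); rewrite big_map scaler_suml.
  rewrite -big_split; apply: eq_bigr => p _ /=.
  have -> : map_mpoly s (p.2 - c p *: h)
    = map_mpoly s p.2 - s (c p) *: map_mpoly s h.
    rewrite raddfB /= -[c p *: h]mul_mpolyC rmorphM /= /map_mpoly mmapC.
    by rewrite mul_mpolyC.
  by rewrite scalerBr scalerA addrC subrK.
have qr' : q r' = 0.
  have := qF m; rewrite EF mcoeffD mcoeffZ mcoeff_map_mpoly.
  rewrite (raddf_sum (mcoeff m)) big_map big1 => [|p _].
    rewrite addr0 rmorphM => /(congr1 ( *%R^~ (q (s (h@_m)^-1)))).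
    by rewrite -mulrA -!rmorphM /= mulfV // !rmorph1 mulr1 mul0r.
  rewrite /= mcoeffZ mcoeff_map_mpoly mcoeffB mcoeffZ divfK // subrr.
  by rewrite raddf0 mulr0.
rewrite EF rmorphD /= mevalZ ev q2 ?add0r ?Jw //.
apply: (IH l') => [|p /mapP[p' /Jl' Jp' ->]||a].
- by rewrite size_map.
- by apply: (is_idealB (idealP _)) => //; rewrite -mul_mpolyC; apply: idealM.
- by [].
have := qF a; rewrite EF mcoeffD rmorphD mcoeffZ rmorphM qr' mul0r add0r.
exact.
Qed.

End Kernel.
End SpanIdeal.

(** * Lifting an infinitesimal point to a regular subgroup *)

Section Lifting.
Variables (k : fieldType) (G : affgrp k) (H : subgrp G).
Hypothesis Hreg : regular_at (@gonep k G) (sideal H).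
Local Notation n := (gdim G).
Local Notation J := (sideal H).
Local Notation e := (@gonep k G).

Variables (R S : comNzRingType) (s : {rmorphism k -> R}).
Variable q : {rmorphism R -> S}.
Hypothesis q2 : forall x y, q x = 0 -> q y = 0 -> x * y = 0.
Variables (v : 'I_n -> S) (w : 'I_n -> R).
Hypothesis Hv : zeros J (q \o s) v.
Hypothesis Gw : gpts G s w.
Hypothesis qw : forall i, q (w i) = v i.

Local Notation w' := (ginv G s w).
Local Notation T := {mpoly R[n]}.

Let sT : {rmorphism k -> T} := @mpolyC n R \o s.
Let wT i : T := (w i)%:MP.
Let xT i : T := 'X_i.
Let NT (F : T) := forall m, q F@_m = 0.
Let JT := span_ideal J s.

Let Jw f : J f -> q (mmap s w f) = 0.
Proof.
by move=> Jf; rewrite rmorph_mmap -(Hv Jf); apply: eq_mmap => // i; apply: qw.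
Qed.

Let Jw' f : J f -> q (mmap s w' f) = 0.
Proof.
move=> Jf; rewrite rmorph_mmap rmorph_ginv; apply: sinv_pts (Jf) => g Jg.
by rewrite -rmorph_mmap; apply: Jw.
Qed.

Let Jone f : J f -> f.@[e] = 0.
Proof. exact: (@sone_pts k G H k idfun). Qed.

Let mmap_one f : mmap s (gone G s) f = s f.@[e].
Proof. by rewrite (rmorph_mmap s). Qed.

Let idJT : is_ideal JT := span_ideal_ideal J s.

Let NTE F : NT F <-> map_mpoly q F = 0.
Proof.
split=> [NF | E m].
  by apply/mpolyP => m; rewrite mcoeff_map_mpoly mcoeff0; apply: NF.
by rewrite -[LHS]mcoeff_map_mpoly E mcoeff0.
Qed.

Let idNT : is_ideal NT.
Proof.
split=> [|a b /NTE Na /NTE Nb|a b /NTE Nb]; apply/NTE.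
- by rewrite raddf0.
- by rewrite raddfD /= Na Nb addr0.
- by rewrite rmorphM /= Nb mulr0.
Qed.

Let evT N (u : 'I_N -> T) (f : {mpoly k[N]}) (z : 'I_n -> R) :
  (mmap sT u f).@[z] = mmap s (fun i => (u i).@[z]) f.
Proof.
rewrite (rmorph_mmap (meval z)); apply: eq_mmap => // c /=.
by rewrite mevalC.
Qed.

Let JTx f : J f -> JT (mmap sT xT f).
Proof. exact: span_idealP. Qed.

Let Gw_T f : gideal G f -> mmap sT wT f = 0.
Proof.
move=> Gf; rewrite -[RHS](rmorph0 (@mpolyC n R)) -(Gw Gf).
by rewrite (rmorph_mmap (@mpolyC n R)).
Qed.

(* [value F a]: modulo [JT], [F] has a representative with coefficients in the
   kernel of [q], and [a] is its value at the inverse of [w]. *)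
Definition value (F : T) (a : R) :=
  exists2 F1, NT F1 /\ JT (F - F1) & a = F1.@[w'].

Let value_fun F a b : value F a -> value F b -> a = b.
Proof.
move=> [F1 [N1 J1] ->] [F2 [N2 J2] ->]; apply/eqP; rewrite -subr_eq0 -rmorphB.
apply/eqP; apply: (span_ideal_kernel q2 Jw') => [|m].
  have -> : F1 - F2 = (F - F2) - (F - F1) by rewrite opprB [RHS]addrC addrA subrK.
  exact: (is_idealB idJT).
by rewrite mcoeffB rmorphB N1 N2 subrr.
Qed.

Let value_ker F a : value F a -> q a = 0.
Proof.
move=> [F1 [N1 _] ->]; rewrite rmorph_sum big1 // => m _.
by rewrite rmorphM N1 mul0r.
Qed.

Let value_JT F : JT F -> value F 0.
Proof.
exists 0; last by rewrite rmorph0.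
by split; [apply: (is_ideal0 idNT) | rewrite subr0].
Qed.

Let value_NT F : NT F -> value F F.@[w'].
Proof. by exists F => //; split=> //; rewrite subrr; apply: (is_ideal0 idJT). Qed.

Let valueD F F' a b : value F a -> value F' b -> value (F + F') (a + b).
Proof.
move=> [F1 [N1 J1] ->] [F2 [N2 J2] ->]; exists (F1 + F2); last by rewrite rmorphD.
split; first exact: (is_idealD idNT).
by rewrite opprD addrACA; apply: (is_idealD idJT).
Qed.

Let valueM g F a : value F a -> value (g * F) (g.@[w'] * a).
Proof.
move=> [F1 [N1 J1] ->]; exists (g * F1); last by rewrite rmorphM.
by split; [apply: (is_idealM idNT) | rewrite -mulrBr; apply: (is_idealM idJT)].
Qed.

Let value_sum (I : eqType) (l : seq I) (F : I -> T) (a : I -> R) :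
  (forall i, i \in l -> value (F i) (a i)) ->
  value (\sum_(i <- l) F i) (\sum_(i <- l) a i).
Proof.
elim: l => [|i l IH] Fa; first by rewrite !big_nil; apply/value_JT/(is_ideal0 idJT).
rewrite !big_cons; apply: valueD; first by apply: Fa; rewrite mem_head.
by apply: IH => j jl; apply: Fa; rewrite inE jl orbT.
Qed.

Let value_mod F F' a : JT (F - F') -> value F' a -> value F a.
Proof. by move=> JF Fa; rewrite -[F](subrK F') -[a]add0r; apply: valueD => //; apply: value_JT. Qed.

Let wx := gmul G sT wT xT.

(** The polynomials having a value form the ideal [JT + NT]. Modulo it both [w] and the generic
    point [X] lie in [H], hence so does their product. *)
Let value_wx f : J f -> exists a, value (mmap sT wx f) a.
Proof.
move=> Jf; pose I F := exists a, value F a.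
have idI : is_ideal I.
  split=> [|a b [x Vx] [y Vy]|a b [y Vy]].
  - by exists 0; apply/value_JT/(is_ideal0 idJT).
  - by exists (x + y); apply: valueD.
  - by exists (a.@[w'] * y); apply: valueM.
apply: (smul_mod idI) (Jf) => g Jg; last first.
  by exists 0; apply/value_JT/JTx.
exists (mmap sT wT g).@[w']; apply: value_NT => m.
have -> : mmap sT wT g = (mmap s w g)%:MP by rewrite (rmorph_mmap (@mpolyC n R)).
by rewrite mcoeffC rmorphM Jw // mul0r.
Qed.

Let ev_wx i : (wx i).@[w'] = gone G s i.
Proof.
rewrite -(pt_mulgV Gw) /wx /gmul evT; apply: eq_mmap => // j.
by rewrite /join_pts; case: split => a; rewrite ?mevalC ?mevalXU.
Qed.

(** [rho] is the obstruction to [w] being a point of [H]; it is constrained only on [J]. *)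
Let rho_ex : exists rho : {mpoly k[n]} -> R,
  forall f, J f -> value (mmap sT wx f) (rho f).
Proof.
apply: (choice_fun (P := fun f a => J f -> value (mmap sT wx f) a)) => f.
case: (classic (J f)) => [/value_wx[a Va] | nJ]; first by exists a.
by exists 0.
Qed.

Section Rho.
Variable rho : {mpoly k[n]} -> R.
Hypothesis rhoP : forall f, J f -> value (mmap sT wx f) (rho f).

Let rhoD f g : J f -> J g -> rho (f + g) = rho f + rho g.
Proof.
move=> Jf Jg; apply: (value_fun (rhoP (idealD Jf Jg))); rewrite rmorphD.
by apply: valueD; apply: rhoP.
Qed.

(** Since [w X] specializes to the unit at the inverse of [w], the factor [f] acts through [f(e)].
    Hence [rho] will kill the maximal ideal of [e] times [J]. *)
Let rhoM f g : J g -> rho (f * g) = s f.@[e] * rho g.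
Proof.
move=> Jg; apply: (value_fun (rhoP (idealM _ Jg))); rewrite rmorphM /=.
suff -> : s f.@[e] = (mmap sT wx f).@[w'] by apply: valueM; apply: rhoP.
by rewrite evT -mmap_one; apply: eq_mmap.
Qed.

Let rho0 : rho 0 = 0.
Proof. by have := rhoM 0 (ideal0 J); rewrite mul0r rmorph0 rmorph0 mul0r. Qed.

Let rho_sum I (l : seq I) (F : I -> {mpoly k[n]}) : (forall i, J (F i)) ->
  J (\sum_(i <- l) F i) /\ rho (\sum_(i <- l) F i) = \sum_(i <- l) rho (F i).
Proof.
move=> JF; elim: l => [|i l [JS IH]]; first by rewrite !big_nil rho0; split=> //; apply: ideal0.
by rewrite !big_cons rhoD // IH; split=> //; apply: idealD.
Qed.

Let rho_gideal f : gideal G f -> rho f = 0.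
Proof.
move=> Gf; apply: (value_fun (rhoP (@sideal_sub _ _ H f Gf))); apply: value_JT.
apply: (smul_mod idJT (H := full_sub G)) (Gf) => g /= Gg.
  by rewrite Gw_T //; apply: (is_ideal0 idJT).
exact/JTx/sideal_sub.
Qed.

Let rho_aug_mul f : aug_mul e J f -> rho f = 0.
Proof.
move=> [g Jg ->].
have [|_ ->] := rho_sum (index_enum 'I_n) (F := fun i => ('X_i - (e i)%:MP) * g i).
  by move=> i; apply: idealM.
rewrite big1 // => i _; rewrite rhoM // rmorphB /= mevalXU mevalC subrr.
by rewrite rmorph0 mul0r.
Qed.

(** By regularity [rho f] depends only on the gradient of [f] at [e]; a pseudo-inverse extends this
    linear map from the span of the gradients to all row vectors. As [rho] takes values in the
    kernel of [q], so do the entries of [d]. *)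
Let rho_gradient : exists2 d : 'I_n -> R, forall b, q (d b) = 0 &
  forall f, J f -> rho f = \sum_b d b * s f^`M(b).@[e].
Proof.
have [t [Y [JY _ subY]]] := gradient_basis J e.
pose M := \matrix_(i, b) (Y i)^`M(b).@[e]; pose P := pinvmx M.
have qrho f : J f -> q (rho f) = 0 by move=> /rhoP/value_ker.
exists (fun b => \sum_i s (P b i) * rho (Y i)) => [b|f Jf].
  by rewrite rmorph_sum big1 // => i _; rewrite rmorphM qrho ?mulr0.
pose u := \row_b f^`M(b).@[e].
have uE : u *m P *m M = u by apply: mulmxKpV; apply: subY.
pose c i := (u *m P) 0 i.
have Jc i : J (c i *: Y i) by rewrite -mul_mpolyC; apply: idealM.
have rhoc i : rho (c i *: Y i) = s (c i) * rho (Y i).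
  by rewrite -mul_mpolyC rhoM // mevalC.
have [JS rhoS] := rho_sum (index_enum 'I_t) Jc.
have : rho (f - \sum_i c i *: Y i) = 0.
  apply: rho_aug_mul; apply: Hreg; first exact: (is_idealB (idealP J)).
  move=> b; have := congr1 (fun x : 'rV_n => x 0 b) uE; rewrite /= !mxE => uEb.
  rewrite mderivB mevalB -uEb (raddf_sum (mderiv b)) (raddf_sum (meval e)).
  apply/eqP; rewrite subr_eq0; apply/eqP; apply: eq_bigr => i _.
  by rewrite [M _ _]mxE -mevalZ -mderivZ.
have JN : J (- \sum_i c i *: Y i) by apply: (is_idealN (idealP J)).
rewrite rhoD // -[- (\sum_i _)]mulN1r rhoM // rmorphN rmorph1 rmorphN rmorph1.
rewrite mulN1r => /eqP; rewrite subr_eq0 => /eqP ->; rewrite rhoS.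
rewrite (eq_bigr (fun i => \sum_b s f^`M(b).@[e] * s (P b i) * rho (Y i))).
  rewrite exchange_big; apply: eq_bigr => b _; rewrite mulr_suml.
  by apply: eq_bigr => i _ /=; rewrite -mulrA mulrC.
move=> i _; rewrite rhoc /c mxE rmorph_sum mulr_suml; apply: eq_bigr => b _.
by rewrite mxE rmorphM.
Qed.

Lemma lift_rho : exists2 z, zeros J s z & forall i, q (z i) = v i.
Proof.
have [d qd rhod] := rho_gradient.
(* Multiplication by this point infinitesimally near the unit keeps the image [v] of [w]; on [J] the
   point takes the values [- rho]. *)
pose g i := gone G s i + - d i.
have qg i : q (g i) = q (gone G s i) by rewrite /g rmorphD rmorphN qd subr0.
have Jg f : J f -> mmap s g f = - rho f.
  move=> Jf; rewrite /g mmap_taylor1 => [|a b]; last by rewrite mulrNN q2.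
  rewrite mmap_one Jone // rmorph0 add0r rhod // -sumrN; apply: eq_bigr => b _.
  by rewrite mmap_one mulNr.
have Gg : gpts G s g by move=> f Gf; rewrite Jg ?rho_gideal ?oppr0 //; apply: sideal_sub.
exists (gmul G s g w); last first.
  have qg1 : q \o g = gone G (q \o s).
    by apply: functional_extensionality => i; rewrite /= qg.
  have qwv : q \o w = v by apply: functional_extensionality => i; apply: qw.
  have Gv : gpts G (q \o s) v by move=> f Gf; apply: Hv; apply: sideal_sub.
  move=> i; have := equal_f (rmorph_gmul q s g w) i.
  by rewrite /= qg1 qwv pt_mul1g.
move=> f Jf; have [l1 [l2 [Jl1 Jl2 Ef]]] := comul_pair_ideal Jf.
have evf (A : comNzRingType) (t : {rmorphism k -> A}) a b :
    mmap t (gmul G t a b) f = \sum_(p <- l1) mmap t (join_pts a b) p.1 * mmap t a p.2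
       + \sum_(p <- l2) mmap t (join_pts a b) p.1 * mmap t b p.2.
  rewrite -mmap_comul Ef rmorphD !rmorph_sum /=.
  by congr (_ + _); apply: eq_bigr => p _; rewrite rmorphM /= ?mmap_lemb ?mmap_remb.
have congN (u u' : 'I_(n + n) -> R) F a : q a = 0 ->
    (forall i, q (u i) = q (u' i)) -> mmap s u F * a = mmap s u' F * a.
  move=> qa uu; apply/eqP; rewrite -subr_eq0 -mulrBl; apply/eqP/q2 => //.
  apply/eqP; rewrite rmorphB subr_eq0; apply/eqP.
  by rewrite !rmorph_mmap; apply: eq_mmap.
have qjoin i : q (join_pts g w i) = q (join_pts (gone G s) w i).
  by rewrite /join_pts; case: split.
pose c p := mmap s (join_pts (gone G s) w) p.1 * rho p.2.
(* Compute the value of [f((w X) X^-1)] in two ways: the argument is congruent to [w] modulo [JT],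
   and the comultiplication of [f] expands the expression through [rho]. *)
have key : mmap s w f = \sum_(p <- l1) c p.
  pose y := ginv G sT xT.
  have JTy : zeros_mod sT JT J y by apply: sinv_mod => // h; apply: JTx.
  have GTx : zeros_mod sT JT (gideal G) xT by apply: (sub_zeros_mod (H := H)) => h; apply: JTx.
  have GTy : zeros_mod sT JT (gideal G) y by apply: (sub_zeros_mod (H := H)).
  have GTw : zeros_mod sT JT (gideal G) wT.
    by move=> h Gh; rewrite Gw_T //; apply: (is_ideal0 idJT).
  have eqw : eq_mod JT (gmul G sT wx y) wT.
    apply: (eq_mod_trans idJT (eq_mod_sym idJT (mulA_mod idJT GTw GTx GTy))).
    apply: (eq_mod_trans idJT _ (mulg1_mod idJT GTw)).
    apply: gmul_cong (mulgV_mod idJT GTx) => //; exact: eq_mod_refl.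
  have NTw : NT (mmap s w f)%:MP.
    by move=> m; rewrite mcoeffC rmorphM Jw // mul0r.
  have mapC h : mmap sT wT h = (mmap s w h)%:MP.
    by rewrite (rmorph_mmap (@mpolyC n R)).
  apply: (@value_fun (mmap sT (gmul G sT wx y) f)).
    rewrite -[X in value _ X](mevalC w'); apply: value_mod (value_NT NTw).
    by rewrite -mapC; apply: mmap_cong eqw.
  rewrite evf -[\sum_(p <- l1) c p]addr0; apply: valueD; last first.
    apply: value_JT; apply: (is_ideal_sum_mem idJT) => p pl.
    by apply: (is_idealM idJT); apply: JTy; apply: Jl2.
  apply: value_sum => p pl.
  have -> : c p = (mmap sT (join_pts wx y) p.1).@[w'] * rho p.2.
    congr (_ * _); rewrite evT; apply: eq_mmap => // i.
    rewrite /join_pts; case: split => a; first by rewrite ev_wx.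
    rewrite -[w a](equal_f (pt_invK Gw) a) /y /ginv evT.
    by apply: eq_mmap => // b; rewrite mevalXU.
  by apply: valueM; apply: rhoP; apply: Jl1.
rewrite evf.
rewrite (eq_big_seq (fun p => - c p)) => [|p pl]; last first.
  rewrite (Jg _ (Jl1 p pl)) mulrN; congr (- _); apply: congN => //.
  by apply: (value_ker (rhoP (Jl1 p pl))).
rewrite sumrN -key.
rewrite (eq_big_seq (fun p => mmap s (join_pts (gone G s) w) p.1 * mmap s w p.2));
  last by move=> p pl; apply: congN => //; apply: Jw; apply: Jl2.
(* With the unit in place of [g] the first sum vanishes, so the second one equals [f(w)] and cancels
   the contribution of [rho]. *)
have : mmap s w f = mmap s (gmul G s (gone G s) w) f by rewrite pt_mul1g.
rewrite evf [X in _ = X + _]big_seq [X in _ = X + _]big1 => [|p pl]; last first.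
  by rewrite mmap_one (Jone (Jl1 p pl)) rmorph0 mulr0.
by rewrite add0r => <-; rewrite addNr.
Qed.

End Rho.

Lemma lift_point : exists2 z, zeros J s z & forall i, q (z i) = v i.
Proof. by have [rho rhoP] := rho_ex; apply: lift_rho rhoP. Qed.

End Lifting.

Lemma regular_smooth (k : fieldType) (G : affgrp k) (H : subgrp G) :
  smooth G -> regular_at (@gonep k G) (sideal H) -> smooth (sub_affgrp H).
Proof.
move=> Gsm Hreg R S s q qsurj q2 v Hv.
have [|w Gw qw] := Gsm R S s q qsurj q2 v; first by move=> f Gf; apply: (Hv); apply: sideal_sub.
by have [z Hz qz] := lift_point Hreg q2 Hv Gw qw; exists z.
Qed.

Lemma mderiv_comp n N (A : comNzRingType) (h : 'I_n -> {mpoly A[N]}) b f :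
  (mmap (@mpolyC N A) h f)^`M(b)
    = \sum_a mmap (@mpolyC N A) h f^`M(a) * (h a)^`M(b).
Proof.
elim/mpoly_ring_ind: f => [c|i|f g Ef Eg|f g Ef Eg].
- rewrite mmapC mderivC big1 // => a _.
  by rewrite mderivC raddf0 mul0r.
- rewrite mmapX mmap1U (bigD1 i) //= big1 ?addr0 => [|a ai].
    by rewrite mderivXU eqxx rmorph1 mul1r.
  by rewrite mderivXU eq_sym (negPf ai) raddf0 mul0r.
- rewrite raddfD mderivD Ef Eg -big_split; apply: eq_bigr => a _ /=.
  by rewrite mderivD raddfD mulrDl.
- rewrite rmorphM mderivM Ef Eg mulr_suml mulr_sumr -big_split.
  apply: eq_bigr => a _ /=; rewrite mderivM raddfD /= !rmorphM /= mulrDl.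
  by congr (_ + _); [rewrite mulrAC | rewrite mulrA].
Qed.

(** * Invariant derivations *)

Section AugmentationIdeal.
Variables (k : fieldType) (n : nat) (e : 'I_n -> k).

Definition augm (i : 'I_n) : {mpoly k[n]} := 'X_i - (e i)%:MP.

Lemma augm_one i : (augm i).@[e] = 0.
Proof. by rewrite rmorphB /= mevalXU mevalC subrr. Qed.

Lemma augm_taylor f :
  idpow augm 2 (f - ((f.@[e])%:MP + \sum_b augm b * (f^`M(b).@[e])%:MP)).
Proof.
have [full|[Q [pi [_ piP]]]] := quotient_or_full (idpow_ideal augm 2).
  exact: full.
apply/(quotient_eq piP).
pose s : {rmorphism k -> Q} := pi \o @mpolyC n k.
have ev u : s u.@[e] = mmap s (fun i => s (e i)) u.
  by rewrite (rmorph_mmap s).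
have -> : pi f = mmap s (fun i => s (e i) + pi (augm i)) f.
  rewrite -{1}[f]mmap_id rmorph_mmap; apply: eq_mmap => // i /=.
  by rewrite rmorphB addrC subrK.
rewrite mmap_taylor1 => [|a b]; last first.
  rewrite -rmorphM; apply/piP; apply: (@idpow_mul _ _ _ 1 1); exact: idpow_gen.
rewrite rmorphD; congr (_ + _); [exact: esym (ev f) | rewrite rmorph_sum].
by apply: eq_bigr => b _; rewrite rmorphM; congr (_ * _); exact: esym (ev _).
Qed.

Lemma idpow_augm1 f : f.@[e] = 0 -> idpow augm 1 f.
Proof.
move=> fe; apply: (is_idealBr (idpow_ideal augm 1) _ (idpowS (augm_taylor f))).
rewrite fe mpolyC0 add0r; apply: (is_ideal_sum (idpow_ideal augm 1)) => b _.
by apply: (is_idealMr (idpow_ideal augm 1)); apply: idpow_gen.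
Qed.

Lemma idpow_augm2 f : f.@[e] = 0 -> (forall b, f^`M(b).@[e] = 0) ->
  idpow augm 2 f.
Proof.
move=> fe dfe; have := augm_taylor f.
rewrite fe mpolyC0 add0r big1 ?subr0 // => b _.
by rewrite dfe mpolyC0 mulr0.
Qed.

Lemma idpow1_eval f : idpow augm 1 f -> f.@[e] = 0.
Proof.
move=> [b _ ->]; rewrite rmorph_sum big1 // => i _.
by rewrite rmorphM /= augm_one mul0r.
Qed.

Definition derivation (D : {mpoly k[n]} -> {mpoly k[n]}) :=
  [/\ forall f g, D (f + g) = D f + D g,
      forall f g, D (f * g) = D f * g + f * D g & forall c, D c%:MP = 0].

Lemma mderiv_derivation i : derivation (mderiv i).
Proof.
split=> [f g|f g|c]; [exact: mderivD|exact: mderivM|exact: mderivC].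
Qed.

Lemma derivation_comb d (D : 'I_d -> {mpoly k[n]} -> {mpoly k[n]})
    (c : 'I_d -> {mpoly k[n]}) :
  (forall i, derivation (D i)) -> derivation (fun f => \sum_i c i * D i f).
Proof.
move=> DD; split=> [f g|f g|a].
- rewrite -big_split; apply: eq_bigr => i _ /=.
  by case: (DD i) => -> _ _; rewrite mulrDr.
- rewrite mulr_suml mulr_sumr -big_split; apply: eq_bigr => i _ /=.
  by case: (DD i) => _ -> _; rewrite mulrDr mulrA mulrCA.
- by rewrite big1 // => i _; case: (DD i) => _ _ ->; rewrite mulr0.
Qed.

Section Derivation.
Variables (D : {mpoly k[n]} -> {mpoly k[n]}) (DD : derivation D).

Lemma der0 : D 0 = 0.
Proof. by case: DD => _ _ /(_ 0); rewrite mpolyC0. Qed.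

Lemma derD f g : D (f + g) = D f + D g.
Proof. by case: DD. Qed.

Lemma derM f g : D (f * g) = D f * g + f * D g.
Proof. by case: DD. Qed.

Lemma derZ c f : D (c *: f) = c *: D f.
Proof.
by rewrite -mul_mpolyC derM; case: DD => _ _ ->; rewrite mul0r add0r mul_mpolyC.
Qed.

Lemma der_sum I (r : seq I) (P : pred I) F :
  D (\sum_(i <- r | P i) F i) = \sum_(i <- r | P i) D (F i).
Proof. exact: (big_morph D derD der0). Qed.

Lemma derX f m : D (f ^+ m) = (f ^+ m.-1 * D f) *+ m.
Proof.
case: m => [|m]; first by rewrite expr0 mulr0n -mpolyC1; case: DD.
elim: m => [|m IH]; first by rewrite expr1 expr0 mul1r.
rewrite exprS derM IH /= mulrnAr mulrA -exprS [D f * _]mulrC.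
by rewrite -mulrS.
Qed.

Lemma der_idpow l f : idpow augm l.+1 f -> idpow augm l (D f).
Proof.
elim: l f => // l IH f [b Ib ->]; rewrite der_sum.
apply: (is_ideal_sum (idpow_ideal augm _)) => i _; rewrite derM.
apply: (is_idealD (idpow_ideal augm _)).
  by apply: (is_idealM (idpow_ideal augm l.+1)); apply: Ib.
apply: (@idpow_mul _ _ _ 1 l); first exact: idpow_gen.
exact: (IH _ (Ib i)).
Qed.

End Derivation.
End AugmentationIdeal.

Section Frame.
Variables (k : fieldType) (G : affgrp k) (H : subgrp G).
Local Notation n := (gdim G).
Local Notation J := (sideal H).
Local Notation e := (@gonep k G).

Lemma sideal_one f : J f -> f.@[e] = 0.
Proof. exact: (@sone_pts k G H k idfun). Qed.

(** The comorphism of [x -> (x, e)]. *)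
Definition restr_unit : {mpoly k[n + n]} -> {mpoly k[n]} :=
  mmap (@mpolyC n k) (join_pts (fun i => 'X_i) (fun i => (e i)%:MP)).

HB.instance Definition _ := GRing.RMorphism.copy restr_unit
  (mmap (@mpolyC n k) (join_pts (fun i => 'X_i) (fun i => (e i)%:MP))).

Section Tangent.
Variable dl : 'I_n -> k.
Hypothesis dlJ : forall f, J f -> \sum_b dl b * f^`M(b).@[e] = 0.

Definition shift_der (F : {mpoly k[n + n]}) : {mpoly k[n]} :=
  \sum_b (dl b)%:MP * restr_unit F^`M(rshift n b).

(* The left-invariant derivation with value [dl] at the unit. *)
Definition inv_der (f : {mpoly k[n]}) : {mpoly k[n]} :=
  \sum_a shift_der (gmulp a) * f^`M(a).

Lemma inv_der_derivation : derivation inv_der.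
Proof. by apply: derivation_comb => a; apply: mderiv_derivation. Qed.

Lemma shift_derM F F' : shift_der (F * F')
  = shift_der F * restr_unit F' + restr_unit F * shift_der F'.
Proof.
rewrite /shift_der mulr_suml mulr_sumr -big_split; apply: eq_bigr => b _ /=.
by rewrite mderivM rmorphD !rmorphM mulrDr !mulrA [restr_unit F * _]mulrC.
Qed.

Lemma shift_derD F F' : shift_der (F + F') = shift_der F + shift_der F'.
Proof.
rewrite /shift_der -big_split; apply: eq_bigr => b _ /=.
by rewrite mderivD rmorphD mulrDr.
Qed.

Lemma restr_lemb f : restr_unit (lemb f) = f.
Proof. by rewrite /restr_unit mmap_lemb mmap_id. Qed.

Lemma mmap_const f : mmap (@mpolyC n k) (fun i => (e i)%:MP) f = (f.@[e])%:MP.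
Proof. by rewrite (rmorph_mmap (@mpolyC n k)). Qed.

Lemma restr_remb f : restr_unit (remb f) = (f.@[e])%:MP.
Proof. by rewrite /restr_unit mmap_remb mmap_const. Qed.

Lemma shift_der_lemb f : shift_der (lemb f) = 0.
Proof.
rewrite /shift_der big1 // => b _; rewrite mderiv_comp big1 ?raddf0 ?mulr0 //.
by move=> a _; rewrite mderivXU eq_lrshift mulr0.
Qed.

Lemma shift_der_remb f :
  shift_der (remb f) = (\sum_b dl b * f^`M(b).@[e])%:MP.
Proof.
rewrite rmorph_sum; apply: eq_bigr => b _; rewrite rmorphM; congr (_ * _).
rewrite mderiv_comp (bigD1 b) //= big1 ?addr0 => [|a ab].
  by rewrite mderivXU eqxx mulr1; apply: restr_remb.
by rewrite mderivXU (inj_eq (@rshift_inj _ _)) (negPf ab) mulr0.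
Qed.

(** The unit axiom of the group law holds modulo the ideal of [G], not as an identity of
    polynomials. *)
Lemma restr_comul f : J (restr_unit (comul f) - f).
Proof.
rewrite -[X in _ - X](mmap_id f) [restr_unit _]mmap_comp.
apply: mmap_cong => [|i]; first exact: idealP.
have := @mulg1_mod k G _ (@mpolyC n k) J (idealP J) (fun i => 'X_i) _ i; apply.
by move=> g Gg; rewrite mmap_id; apply: sideal_sub.
Qed.

(** Modulo [J], [inv_der f] is the derivative of [comul f] in its second argument at the unit. As
    [comul f] lies in the pair ideal and [dl] is tangent to [J], the result lies in [J]. *)
Lemma inv_der_ideal f : J f -> J (inv_der f).
Proof.
move=> Jf; have idJ := idealP J.
have E : shift_der (comul f)
    = \sum_a restr_unit (comul f^`M(a)) * shift_der (gmulp a).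
  rewrite /shift_der; under [RHS]eq_bigr do rewrite mulr_sumr.
  rewrite exchange_big; apply: eq_bigr => b _ /=.
  rewrite mderiv_comp rmorph_sum mulr_sumr; apply: eq_bigr => a _.
  by rewrite rmorphM mulrCA.
apply: (is_idealBl idJ (a := shift_der (comul f))).
  have [l1 [l2 [J1 J2 ->]]] := comul_pair_ideal Jf.
  pose K F := J (shift_der F).
  have KD F F' : K F -> K F' -> K (F + F').
    by move=> KF KF'; rewrite /K shift_derD; apply: (is_idealD idJ).
  have K0 : K 0 by rewrite /K -(rmorph0 (@lemb k n)) shift_der_lemb; apply: ideal0.
  have KS (l : seq ({mpoly k[n + n]} * {mpoly k[n]})) g :
      (forall p, p \in l -> K (g p)) -> K (\sum_(p <- l) g p).
    by move=> Kg; rewrite big_seq; elim/big_ind: _.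
  apply: KD; apply: KS => p pl; rewrite /K shift_derM.
    rewrite shift_der_lemb mulr0 addr0 restr_lemb; apply: (is_idealM idJ).
    exact: J1.
  rewrite shift_der_remb restr_remb dlJ ?sideal_one ?mpolyC0 ?mulr0 ?addr0;
    by [apply: ideal0 | apply: J2].
rewrite E /inv_der -sumrB; apply: (is_ideal_sum idJ) => a _.
rewrite mulrC -mulrBr; apply: (is_idealM idJ); exact: restr_comul.
Qed.

Lemma inv_der_one f : (inv_der f).@[e] = \sum_a dl a * f^`M(a).@[e].
Proof.
rewrite rmorph_sum; apply: eq_bigr => a _; rewrite rmorphM; congr (_ * _).
pose h : 'I_(n + n) -> {mpoly k[n]} :=
  join_pts (fun i => (e i)%:MP) (fun i => 'X_i).
have Ja : J (mmap (@mpolyC n k) h (gmulp a) - 'X_a).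
  have := @mul1g_mod k G _ (@mpolyC n k) J (idealP J) (fun i => 'X_i) _ a; apply.
  by move=> g Gg; rewrite mmap_id; apply: sideal_sub.
have := dlJ Ja; under eq_bigr => b _ do rewrite mderivB rmorphB mulrBr.
rewrite sumrB => /eqP; rewrite subr_eq0 => /eqP E.
transitivity (\sum_b dl b * ('X_a : {mpoly k[n]})^`M(b).@[e]); last first.
  rewrite (bigD1 a) //= big1 ?addr0 => [|b ba].
    by rewrite mderivXU eqxx rmorph1 mulr1.
  by rewrite mderivXU eq_sym (negPf ba) rmorph0 mulr0.
rewrite -E rmorph_sum; apply: eq_bigr => b _; rewrite rmorphM.
congr (_ * _); first exact: mevalC.
have dh c : (h c)^`M(b) = (c == rshift n b)%:R.
  rewrite /h /join_pts; case: splitP => j cj.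
    rewrite mderivC; case: eqP => // cb; move: (ltn_ord j).
    by rewrite -cj cb /= ltnNge leq_addr.
  by rewrite mderivXU -(inj_eq (@rshift_inj n n)); congr (_ == _)%:R; apply: val_inj.
rewrite mderiv_comp (bigD1 (rshift n b)) //= [X in _ + X]big1 => [|c cb]; last first.
  by rewrite dh (negPf cb) mulr0.
rewrite addr0 dh eqxx mulr1 /restr_unit !(rmorph_mmap (meval e)).
apply: eq_mmap => i //=; rewrite /h /join_pts.
by case: split => j; rewrite ?mevalC ?mevalXU.
Qed.

End Tangent.
(** The [y] have gradients forming a basis of those of [J]. The linear [x] are dual to a basis of
    the tangent space, and the vectors of that basis yield the invariant derivations. Together [y]
    and [x] span the maximal ideal modulo its square. *)
Lemma local_frame : exists (t d : nat) (y : 'I_t -> {mpoly k[n]})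
    (x : 'I_d -> {mpoly k[n]}) (D : 'I_d -> {mpoly k[n]} -> {mpoly k[n]}) u,
  [/\ (forall j, J (y j)) /\ (forall i, (x i).@[e] = 0),
      (forall i, derivation (D i)) /\ (forall i f, J f -> J (D i f)),
      (forall i j, D i (x j) = (i == j)%:R * u) /\ u.@[e] = 1,
      forall (a : 'I_t -> k) (b : 'I_d -> k),
        (forall c, \sum_j a j * (y j)^`M(c).@[e]
                   + \sum_i b i * (x i)^`M(c).@[e] = 0) ->
        forall j, a j = 0
    & forall c, exists (a : 'I_t -> k) (b : 'I_d -> k),
        idpow (augm e) 2
          (augm e c - (\sum_j a j *: y j + \sum_i b i *: x i))].
Proof.
have [t [y [Jy]]] := gradient_basis J e.
set M := \matrix_(i, b) _ => Mfree Msub.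
(* The rows of [K] are a basis of the tangent space, the vectors killed by all gradients; the rows
   of [X] below are dual to them. *)
pose K := row_base (kermx M^T); pose d := \rank (kermx M^T).
have KM : K *m M^T = 0 by apply/sub_kermxP; rewrite eq_row_base.
have Kfree : row_free K by apply: row_base_free.
pose X := (pinvmx K)^T.
have KX : K *m X^T = 1%:M by rewrite trmxK mulmxVp.
have XK : X *m K^T = 1%:M by rewrite -[LHS]trmxK trmx_mul trmxK KX trmx1.
have MK : M *m K^T = 0 by rewrite -[LHS]trmxK trmx_mul trmxK KM trmx0.
pose x i : {mpoly k[n]} := \sum_b X i b *: augm e b.
have xe i : (x i).@[e] = 0.
  by rewrite rmorph_sum big1 // => b _; rewrite [LHS]mevalZ augm_one mulr0.
have dx i c : (x i)^`M(c) = (X i c)%:MP.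
  rewrite /x (raddf_sum (mderiv c)) (bigD1 c) //= big1 ?addr0 => [|b bc].
    rewrite mderivZ mderivB mderivC subr0 mderivXU eqxx.
    by rewrite -mul_mpolyC mulr1.
  by rewrite mderivZ mderivB mderivC subr0 mderivXU (negPf bc) scaler0.
have tangent i f : J f -> \sum_b K i b * f^`M(b).@[e] = 0.
  move=> Jf; have := mulmxKpV (Msub f Jf); set v := _ *m pinvmx _ => vM.
  have : (K *m (v *m M)^T) i 0 = 0 by rewrite trmx_mul mulmxA KM mul0mx mxE.
  by rewrite vM mxE => E; rewrite -[RHS]E; apply: eq_bigr => b _; rewrite !mxE.
pose D i := inv_der (K i).
have De i j : (D i (x j)).@[e] = (i == j)%:R.
  rewrite inv_der_one; last exact: tangent.
  transitivity ((K *m X^T) i j); last by rewrite KX mxE.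
  by rewrite mxE; apply: eq_bigr => b _; rewrite dx mevalC !mxE.
(* [C] is the identity only at [e]. Its adjugate makes the derivations dual to the [x] up to the
   factor [\det C], which is 1 at [e], without leaving the polynomial ring. *)
pose C := \matrix_(i, j) D i (x j).
pose D' i f := \sum_j \adj C i j * D j f.
have Dd i : derivation (D i) by apply: inv_der_derivation.
exists t, d, y, x, D', (\det C); split.
- by [].
- split=> [i|i f Jf]; first exact: derivation_comb.
  apply: (is_ideal_sum (idealP J)) => j _; apply: idealM.
  by apply: inv_der_ideal => // g; apply: tangent.
- split=> [i j|].
    transitivity ((\adj C *m C) i j); last by rewrite mul_adj_mx mxE mulr_natl.
    by rewrite [RHS]mxE; apply: eq_bigr => l _; rewrite [C l j]mxE.
  rewrite -det_map_mx -[RHS](det1 k d); congr (\det _).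
  by apply/matrixP => i j; rewrite !mxE; apply: De.
- move=> a b ab0; pose ra := \row_j a j; pose rb := \row_i b i.
  have E : ra *m M + rb *m X = 0.
    apply/rowP => c; rewrite !mxE -[RHS](ab0 c).
    congr (_ + _); apply: eq_bigr => j _; first by rewrite mxE [M _ _]mxE.
    by rewrite dx mevalC [rb _ _]mxE.
  have rb0 : rb = 0.
    have := congr1 (mulmx^~ K^T) E.
    by rewrite /= mulmxDl -!mulmxA MK XK mulmx0 mul0mx mulmx1 add0r.
  move: E; rewrite rb0 mul0mx addr0 => /eqP; rewrite mulmx_free_eq0 // => /eqP ra0 j.
  by have := congr1 (fun r : 'rV_t => r 0 j) ra0; rewrite !mxE.
- move=> c.
  (* A vector orthogonal to [M] is a combination of rows of [K], and orthogonality to [X] then kills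
     its coefficients. *)
  have full : row_full (col_mx M X).
    rewrite /row_full -mxrank_tr; change (row_free (col_mx M X)^T).
    rewrite -kermx_eq0; apply/eqP/row_matrixP => i; rewrite row0.
    have := row_sub i (kermx (col_mx M X)^T) => /sub_kermxP.
    set w := row _ _; rewrite tr_col_mx mul_mx_row => /eqP.
    rewrite row_mx_eq0 => /andP[/eqP wM /eqP wX].
    have /submxP[z wz] : (w <= K)%MS by rewrite eq_row_base; apply/sub_kermxP.
    by move: wX; rewrite wz -mulmxA KX mulmx1 => ->; rewrite mul0mx.
  have /submxP[v vE] := submx_full (delta_mx (0 : 'I_1) c) full.
  exists (fun j => v 0 (lshift d j)), (fun i => v 0 (rshift t i)).
  apply: idpow_augm2.
    rewrite mevalB augm_one mevalD !(raddf_sum (meval e)) !big1 ?addr0 ?subr0 // => i _.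
      by rewrite [LHS]mevalZ xe mulr0.
    by rewrite [LHS]mevalZ sideal_one ?mulr0.
  move=> b; rewrite mderivB mderivB mderivC subr0 mderivXU mderivD.
  rewrite !(raddf_sum (mderiv b)) mevalB mevalD !(raddf_sum (meval e)).
  have := congr1 (fun r : 'rV_n => r 0 b) vE.
  rewrite /= -[v in v *m _]hsubmxK mul_row_col !mxE eqxx /= [c == b]eq_sym.
  rewrite rmorph_nat => ->; apply/eqP; rewrite subr_eq0; apply/eqP.
  congr (_ + _); apply: eq_bigr => i _.
    by rewrite [lsubmx _ _ _]mxE [M _ _]mxE -mevalZ -mderivZ.
  by rewrite [rsubmx _ _ _]mxE -[X i b](mevalC e) -dx -mevalZ -mderivZ.
Qed.

End Frame.

(** * Spans of p-th powers *)

Section PowerSpan.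
Variables (k : fieldType) (p : nat) (n : nat).
Local Notation mp := {mpoly k[n]}.

(** In characteristic [p], taking the whole ring for [J] gives [k[X_1^p, ..., X_n^p]]; in general
    this is the [k]-span of the image of [J] under Frobenius. *)
Definition pspan (J : mp -> Prop) (g : mp) :=
  exists2 l : seq (k * mp), forall q, q \in l -> J q.2
    & g = \sum_(q <- l) q.1 *: q.2 ^+ p.

Local Notation pspanT := (pspan (fun _ => True)).

Section Basics.
Variable J : mp -> Prop.

Lemma pspan0 : pspan J 0.
Proof. by exists [::]; rewrite ?big_nil. Qed.

Lemma pspanD f g : pspan J f -> pspan J g -> pspan J (f + g).
Proof.
move=> [l Jl ->] [m Jm ->]; exists (l ++ m); last by rewrite big_cat.
by move=> q; rewrite mem_cat => /orP[/Jl|/Jm].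
Qed.

Lemma pspanX c f : J f -> pspan J (c *: f ^+ p).
Proof.
move=> Jf; exists [:: (c, f)]; last by rewrite big_seq1.
by move=> q; rewrite inE => /eqP->.
Qed.

Lemma pspan_sum I (r : seq I) (P : pred I) F :
  (forall i, P i -> pspan J (F i)) -> pspan J (\sum_(i <- r | P i) F i).
Proof.
by move=> PF; elim/big_ind: _ => //; [apply: pspan0 | move=> *; apply: pspanD].
Qed.

End Basics.

Lemma pspanM f g : pspanT f -> pspanT g -> pspanT (f * g).
Proof.
move=> [l _ ->] [m _ ->]; rewrite mulr_suml; apply: pspan_sum => q _.
rewrite mulr_sumr; apply: pspan_sum => r _.
by rewrite -scalerAl -scalerAr scalerA -exprMn; apply: pspanX.
Qed.

Lemma pspanC c : pspanT c%:MP.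
Proof. by rewrite -[c%:MP]mulr1 mul_mpolyC -(expr1n _ p); apply: pspanX. Qed.

Lemma pspan_pow f : pspanT (f ^+ p).
Proof. by rewrite -[f ^+ p]scale1r; apply: pspanX. Qed.

Lemma pspan_prod I (r : seq I) (P : pred I) F :
  (forall i, P i -> pspanT (F i)) -> pspanT (\prod_(i <- r | P i) F i).
Proof.
move=> PF; elim/big_ind: _ => //; last by move=> *; apply: pspanM.
by rewrite -mpolyC1; apply: pspanC.
Qed.

Lemma pspan_sign i f : pspanT f -> pspanT ((-1) ^+ i * f).
Proof.
by rewrite -mpolyC1 -mpolyCN -rmorphXn => h; apply: pspanM => //; apply: pspanC.
Qed.

Lemma pspan_det m (A : 'M[mp]_m) : (forall i j, pspanT (A i j)) -> pspanT (\det A).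
Proof.
move=> PA; apply: pspan_sum => s _; apply: pspan_sign.
by apply: pspan_prod => i _.
Qed.

Lemma pspan_adj m (A : 'M[mp]_m) i j :
  (forall i j, pspanT (A i j)) -> pspanT (\adj A i j).
Proof.
move=> PA; rewrite mxE; apply: pspan_sign; apply: pspan_det => a b.
by rewrite !mxE.
Qed.

Hypothesis pk : p \in [pchar k].

Lemma p_prime : prime p. Proof. exact: pcharf_prime pk. Qed.
Lemma p_gt0 : (0 < p)%N. Proof. exact: prime_gt0 p_prime. Qed.

Lemma pchar_nz j : (0 < j < p)%N -> j%:R != 0 :> k.
Proof.
move=> /andP[j0 jp]; rewrite -(dvdn_pcharf pk); apply/negP => /(dvdn_leq j0).
by rewrite leqNgt jp.
Qed.

Lemma pchar_mpoly : p \in [pchar mp].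
Proof. by rewrite (pchar_lalg mp). Qed.

Lemma exprDp (f g : mp) : (f + g) ^+ p = f ^+ p + g ^+ p.
Proof. by apply: exprDn_pchar; rewrite pnatE ?pchar_mpoly ?p_prime. Qed.

Lemma der_pspan (D : mp -> mp) g : derivation D -> pspanT g -> D g = 0.
Proof.
move=> DD [l _ ->]; rewrite (der_sum DD) big1 // => q _.
by rewrite (derZ DD) (derX DD) -mulr_natl (pcharf0 pchar_mpoly) mul0r scaler0.
Qed.

Section Representation.
Variables (N : nat) (z : 'I_N -> mp).

Definition prepr (g : mp) :=
  exists2 b : {ffun 'I_N -> 'I_p} -> mp, forall E, pspanT (b E)
    & g = \sum_E b E * \prod_i z i ^+ E i.

Lemma prepr0 : prepr 0.
Proof.
exists (fun=> 0); first by move=> _; apply: pspan0.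
by rewrite big1 // => E _; rewrite mul0r.
Qed.

Lemma preprD f g : prepr f -> prepr g -> prepr (f + g).
Proof.
move=> [b Pb ->] [c Pc ->]; exists (fun E => b E + c E).
  by move=> E; apply: pspanD.
by rewrite -big_split; apply: eq_bigr => E _; rewrite mulrDl.
Qed.

Lemma preprM a g : pspanT a -> prepr g -> prepr (a * g).
Proof.
move=> Pa [b Pb ->]; exists (fun E => a * b E).
  by move=> E; apply: pspanM.
by rewrite mulr_sumr; apply: eq_bigr => E _; rewrite mulrA.
Qed.

Lemma prepr_sum I (r : seq I) (P : pred I) F :
  (forall i, P i -> prepr (F i)) -> prepr (\sum_(i <- r | P i) F i).
Proof.
by move=> PF; elim/big_ind: _ => //; [apply: prepr0 | move=> *; apply: preprD].
Qed.

Lemma prepr_monomial m : prepr (mmap1 z m).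
Proof.
have lt_p i : (m i %% p < p)%N by rewrite ltn_pmod // p_gt0.
pose E0 : {ffun 'I_N -> 'I_p} := [ffun i => Ordinal (lt_p i)].
pose a := (\prod_i z i ^+ (m i %/ p)) ^+ p.
exists (fun E => if E == E0 then a else 0).
  by move=> E; case: eqP => _; [apply: pspan_pow | apply: pspan0].
rewrite (bigD1 E0) //= eqxx [X in _ + X]big1 => [|E EE0]; last by rewrite (negPf EE0) mul0r.
rewrite addr0.
rewrite /a -prodrXl -big_split /mmap1; apply: eq_bigr => i _ /=.
by rewrite ffunE /= -exprM -exprD -divn_eq.
Qed.

Lemma prepr_mmap (F : {mpoly k[N]}) : prepr (mmap (@mpolyC n k) z F).
Proof.
by apply: prepr_sum => m _; apply: preprM; [apply: pspanC | apply: prepr_monomial].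
Qed.

End Representation.

Lemma prepr_vars f : prepr (fun i => 'X_i) f.
Proof. by rewrite -[f]mmap_id; apply: prepr_mmap. Qed.

(* Nakayama's lemma over the ring of p-th powers: if [z] generates the local
   ring at [e] modulo the p-th powers of the maximal ideal, then it generates
   the local ring. *)
Lemma prepr_nakayama (e : 'I_n -> k) N (z : 'I_N -> mp) :
  (forall l f, exists F : {mpoly k[N]},
     idpow (augm e) l (f - mmap (@mpolyC n k) z F)) ->
  exists2 t, t.@[e] != 0 & forall f, prepr z (t * f).
Proof.
move=> expand.
pose I := {ffun 'I_n -> 'I_p}; pose q := #|{: I}|.
pose X (E : I) : mp := \prod_i 'X_i ^+ E i.
pose w (r : 'I_q) := X (enum_val r).
have sumI (F : I -> mp) : \sum_E F E = \sum_(r < q) F (enum_val r).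
  by rewrite (reindex (@enum_val I predT)) //; apply/onW_bij/enum_val_bij.
have row r : exists c : mp * ('I_q -> mp), [/\ prepr z c.1,
    forall s, pspanT (c.2 s), forall s, (c.2 s).@[e] = 0
    & w r = c.1 + \sum_s c.2 s * w s].
  (* At this order [idpow_frobenius] writes the error as a combination of [p]-th powers of the
     generators of the maximal ideal, and these vanish at [e]. *)
  have [F] := expand (n * p.-1).+1 (w r).
  move/(idpow_frobenius (leqnn _)) => [c wc].
  have [b bP] : exists b : 'I_n -> I -> mp, forall i,
      (forall E, pspanT (b i E)) /\ c i = \sum_E b i E * X E.
    apply: (choice_fun (P := fun i b => (forall E, pspanT (b E)) /\
      c i = \sum_E b E * X E)) => i.
    by have [b Pb cE] := prepr_vars (c i); exists b.
  exists (mmap (@mpolyC n k) z F,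
    fun s => \sum_i augm e i ^+ p * b i (enum_val s)); split=> /=.
  - exact: prepr_mmap.
  - move=> s; apply: pspan_sum => i _; apply: pspanM; first exact: pspan_pow.
    by have [] := bP i.
  - move=> s; rewrite rmorph_sum big1 // => i _.
    by rewrite rmorphM rmorphXn /= augm_one expr0n (gtn_eqF p_gt0) mul0r.
  rewrite -[LHS](subrK (mmap (@mpolyC n k) z F)) wc addrC; congr (_ + _).
  under [RHS]eq_bigr do rewrite mulr_suml.
  rewrite exchange_big; apply: eq_bigr => i _ /=.
  have [_ ->] := bP i; rewrite sumI mulr_suml; apply: eq_bigr => s _.
  by rewrite -/(w s); ring.
have [c cP] := choice_fun row.
(* The relations become a linear system for [w] whose matrix is the identity at [e]; Cramer's rule
   solves it up to [\det B]. *)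
pose B := \matrix_(r, s) ((r == s)%:R - (c r).2 s).
have PB r s : pspanT (B r s).
  rewrite mxE; apply: pspanD.
    by rewrite -mpolyC_nat; apply: pspanC.
  by have [_ Pc _ _] := cP r; rewrite -mulN1r -[-1]expr1; apply: pspan_sign.
exists (\det B).
  rewrite -det_map_mx (_ : map_mx _ B = 1%:M) ?det1 ?oner_neq0 //.
  apply/matrixP => r s; rewrite !mxE rmorphB rmorph_nat /=.
  by have [_ _ -> _] := cP r; rewrite subr0.
have Bw r : \sum_s B r s * w s = (c r).1.
  under eq_bigr do rewrite mxE mulrBl.
  rewrite sumrB (bigD1 r) //= eqxx mul1r big1 ?addr0 => [|s sr]; last first.
    by rewrite eq_sym (negPf sr) mul0r.
  by have [_ _ _ {1}->] := cP r; rewrite addrK.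
have detw r : \det B * w r = \sum_s \adj B r s * (c s).1.
  under eq_bigr => s _ do rewrite -Bw mulr_sumr.
  rewrite exchange_big /=.
  transitivity (\sum_s (\adj B *m B) r s * w s).
    rewrite mul_adj_mx (bigD1 r) //= mxE eqxx mulr1n big1 ?addr0 // => s sr.
    by rewrite mxE eq_sym (negPf sr) mulr0n mul0r.
  apply: eq_bigr => s _; rewrite mxE mulr_suml.
  by apply: eq_bigr => i _; rewrite mulrA.
move=> f; have [b Pb ->] := prepr_vars f; rewrite sumI mulr_sumr.
apply: prepr_sum => r _; rewrite mulrCA -/(w r) detw mulr_sumr.
apply: prepr_sum => s _; rewrite mulrA; apply: preprM; last by case: (cP s).
by apply: pspanM => //; apply: pspan_adj.
Qed.

End PowerSpan.

Section DerivationChain.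
Variables (k : fieldType) (n N : nat) (D : {mpoly k[n]} -> {mpoly k[n]}).
Hypothesis DD : derivation D.
Variable z : 'I_N -> {mpoly k[n]}.

Lemma der_mmap (F : {mpoly k[N]}) : D (mmap (@mpolyC n k) z F)
  = \sum_a mmap (@mpolyC n k) z F^`M(a) * D (z a).
Proof.
elim/mpoly_ring_ind: F => [c|i|f g Ef Eg|f g Ef Eg].
- rewrite mmapC big1 => [|a _]; first by case: DD => _ _ ->.
  by rewrite mderivC raddf0 mul0r.
- rewrite mmapX mmap1U (bigD1 i) //= big1 ?addr0 => [|a ai].
    by rewrite mderivXU eqxx rmorph1 mul1r.
  by rewrite mderivXU eq_sym (negPf ai) raddf0 mul0r.
- rewrite raddfD (derD DD) Ef Eg -big_split; apply: eq_bigr => a _ /=.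
  by rewrite mderivD raddfD mulrDl.
- rewrite rmorphM (derM DD) Ef Eg mulr_suml mulr_sumr -big_split.
  apply: eq_bigr => a _; rewrite mderivM raddfD /= !rmorphM /= mulrDl.
  by congr (_ + _); [rewrite mulrAC | rewrite mulrA].
Qed.

Lemma der_meval (F : {mpoly {mpoly k[n]}[N]}) : (forall m, D F@_m = 0) ->
  D F.@[z] = \sum_a F^`M(a).@[z] * D (z a).
Proof.
move=> DF; rewrite [in LHS]mevalE (der_sum DD).
under [RHS]eq_bigr => a _.
  rewrite [X in X^`M(a)]mpolyE (raddf_sum (mderiv a)) (raddf_sum (meval z)).
  rewrite mulr_suml; over.
rewrite exchange_big; apply: eq_bigr => m _ /=.
rewrite (derM DD) DF mul0r add0r -/(mmap1 z m).
have -> : mmap1 z m = mmap (@mpolyC n k) z 'X_[m] by rewrite mmapX.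
rewrite der_mmap mulr_sumr; apply: eq_bigr => a _.
rewrite mderivZ mevalZ !mderivX mevalZ mmapZ mmapX mevalX -!mulrA.
by rewrite !rmorph_nat.
Qed.

End DerivationChain.

(** * Regularity at the unit *)

Section Expansion.
Variables (k : fieldType) (n : nat) (e : 'I_n -> k) (J : {mpoly k[n]} -> Prop).
Hypothesis idJ : is_ideal J.
Hypothesis Je : forall f, J f -> f.@[e] = 0.
Variables (t d : nat) (y : 'I_t -> {mpoly k[n]}) (x : 'I_d -> {mpoly k[n]}).
Variables (D : 'I_d -> {mpoly k[n]} -> {mpoly k[n]}) (u : {mpoly k[n]}).
Hypotheses (Jy : forall j, J (y j)) (xe : forall i, (x i).@[e] = 0).
Hypotheses (DD : forall i, derivation (D i)) (DJ : forall i f, J f -> J (D i f)).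
Hypotheses (Dx : forall i j, D i (x j) = (i == j)%:R * u) (ue : u.@[e] = 1).
Hypothesis indep : forall (a : 'I_t -> k) (b : 'I_d -> k),
  (forall c, \sum_j a j * (y j)^`M(c).@[e]
             + \sum_i b i * (x i)^`M(c).@[e] = 0) -> forall j, a j = 0.
Hypothesis span : forall c, exists (a : 'I_t -> k) (b : 'I_d -> k),
  idpow (augm e) 2 (augm e c - (\sum_j a j *: y j + \sum_i b i *: x i)).

Local Notation N := (t + d)%N.
Local Notation mp := {mpoly k[n]}.
Local Notation m_ := (idpow (augm e)).

Definition frame (i : 'I_N) : mp :=
  match split i with inl j => y j | inr j => x j end.

Lemma frame_l j : frame (lshift d j) = y j.
Proof. by rewrite /frame -[lshift d j]/(unsplit (inl j)) unsplitK. Qed.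

Lemma frame_r i : frame (rshift t i) = x i.
Proof. by rewrite /frame -[rshift t i]/(unsplit (inr i)) unsplitK. Qed.

Lemma frame_one i : (frame i).@[e] = 0.
Proof. by rewrite /frame; case: split => j; rewrite ?xe ?Je. Qed.

Lemma augm_frame c : exists F : {mpoly k[N]},
  m_ 1 (mmap (@mpolyC n k) frame F) /\
  m_ 2 (augm e c - mmap (@mpolyC n k) frame F).
Proof.
have [a [b ab]] := span c.
exists (\sum_j a j *: 'X_(lshift d j) + \sum_i b i *: 'X_(rshift t i)).
have -> : mmap (@mpolyC n k) frame
     (\sum_j a j *: 'X_(lshift d j) + \sum_i b i *: 'X_(rshift t i))
   = \sum_j a j *: y j + \sum_i b i *: x i.
  rewrite raddfD /= !raddf_sum /=; congr (_ + _); apply: eq_bigr => i _.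
    by rewrite mmapZ mmapX mmap1U frame_l mul_mpolyC.
  by rewrite mmapZ mmapX mmap1U frame_r mul_mpolyC.
split=> //; apply: (is_idealBl (idpow_ideal _ _) _ (idpowS ab)).
exact: idpow_gen.
Qed.

(** The frame spans the maximal ideal modulo its square, so products of [l] such combinations span
    its [l]-th power modulo the next one. *)
Lemma frame_graded l f : m_ l f ->
  exists F : {mpoly k[N]}, m_ l.+1 (f - mmap (@mpolyC n k) frame F).
Proof.
elim: l f => [|l IH] f.
  move=> _; exists (f.@[e])%:MP; rewrite mmapC; apply: idpow_augm1.
  by rewrite mevalB mevalC subrr.
move=> [g /= mg ->].
have [F FP] := choice_fun (fun c => augm_frame c).
have [F' F'P] := choice_fun (fun c => IH _ (mg c)).
exists (\sum_c F c * F' c); rewrite (raddf_sum (mmap (@mpolyC n k) frame)) -sumrB.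
apply: (is_ideal_sum (idpow_ideal (augm e) l.+2)) => c _ /=; rewrite rmorphM /=.
have [F1 F2] := FP c; set P := mmap _ _ (F c) in F1 F2 *.
set P' := mmap _ _ (F' c); have := F'P c; rewrite -/P' => F3.
have -> : augm e c * g c - P * P' = (augm e c - P) * g c + P * (g c - P').
  by ring.
apply: (is_idealD (idpow_ideal (augm e) l.+2)).
  exact: (@idpow_mul _ _ _ 2 l _ _ F2 (mg c)).
exact: (@idpow_mul _ _ _ 1 l.+1 _ _ F1 F3).
Qed.

Lemma frame_expansion l f :
  exists F : {mpoly k[N]}, m_ l (f - mmap (@mpolyC n k) frame F).
Proof.
elim: l => [|l [F mF]]; first by exists 0.
have [F' mF'] := frame_graded mF; exists (F + F').
by rewrite raddfD opprD addrA.
Qed.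

(** These monomials involve no [y]; all the others evaluate into [J]. *)
Definition xmon (m : 'X_{1..N}) := [forall j : 'I_t, m (lshift d j) == 0%N].

Lemma xmonPn (m : 'X_{1..N}) : reflect (exists j, m (lshift d j) != 0%N) (~~ xmon m).
Proof. by rewrite negb_forall; apply: existsP. Qed.

Lemma mmap1_frame_one m : (mmap1 frame m).@[e] = (m == 0%MM)%:R.
Proof.
have [->|m0] := eqVneq m 0%MM; first by rewrite mmap11 rmorph1.
have [i mi] : exists i, m i != 0%N.
  apply/existsP; apply: contraNT m0; rewrite negb_exists => /forallP h.
  by apply/eqP/mnmP => i; rewrite mnm0E; apply/eqP; have := h i; rewrite negbK.
rewrite rmorph_prod (bigD1 i) //= rmorphXn /= frame_one.
by rewrite expr0n (negPf mi) mul0r.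
Qed.

Lemma mmap1_frame_split (m : 'X_{1..N}) (i : 'I_N) : m i != 0%N ->
  mmap1 frame m = frame i * mmap1 frame (m - U_(i)).
Proof.
move=> mi; rewrite -[X in X * _](mmap1U frame i) -commr_mmap1_M.
  by rewrite addmC submK // lep1mP.
by move=> j a; apply: mulrC.
Qed.

Lemma mmap1_frame_idpow m : m_ (mdeg m) (mmap1 frame m).
Proof.
rewrite mdegE /mmap1; elim/big_ind2: _ => // [a b c f Ia Ic|i _].
  exact: idpow_mul.
by rewrite -[X in idpow _ X]mul1n; apply/idpow_exp/idpow_augm1/frame_one.
Qed.

Lemma meval_frame_one (F : {mpoly mp[N]}) : F.@[frame].@[e] = (F@_0%MM).@[e].
Proof.
rewrite [F.@[frame]]mevalE (raddf_sum (meval e)) /=.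
under eq_bigr => m _ do rewrite mevalM -/(mmap1 frame m) mmap1_frame_one.
have [F0|F0] := boolP (0%MM \in msupp F).
  rewrite (bigD1_seq 0%MM) ?msupp_uniq //= eqxx mulr1 big1 ?addr0 // => m m0.
  by rewrite (negPf m0) mulr0.
rewrite (memN_msupp_eq0 F0) rmorph0 big_seq big1 // => m mF.
case: eqP => [m0|_]; last by rewrite mulr0.
by rewrite m0 (negPf F0) in mF.
Qed.

Definition is_aug (f : mp) := aug_mul e J f.

Lemma aug_mul_ideal : is_ideal is_aug.
Proof.
split=> [|_ _ [f Jf ->] [g Jg ->]|a _ [g Jg ->]].
- exists (fun=> 0); first by move=> _; case: idJ.
  by rewrite big1 // => i _; rewrite mulr0.
- exists (fun i => f i + g i); first by move=> i; apply: (is_idealD idJ).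
  by rewrite -big_split; apply: eq_bigr => i _; rewrite mulrDr.
- exists (fun i => a * g i); first by move=> i; apply: (is_idealM idJ).
  by rewrite mulr_sumr; apply: eq_bigr => i _; rewrite mulrCA.
Qed.

Lemma aug_mulP a f : a.@[e] = 0 -> J f -> is_aug (a * f).
Proof.
move=> /idpow_augm1[b _ ->] Jf; exists (fun i => b i * f).
  by move=> i; apply: (is_idealM idJ).
by rewrite mulr_suml; apply: eq_bigr => i _; rewrite mulrA.
Qed.

Lemma y_part_ideal (F : {mpoly mp[N]}) :
  J (\sum_(m <- msupp F | ~~ xmon m) F@_m * mmap1 frame m).
Proof.
apply: (is_ideal_sum idJ) => m /xmonPn[j mj]; apply: (is_idealM idJ).
rewrite (mmap1_frame_split mj) frame_l; exact: (is_idealMr idJ).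
Qed.

(** Removing one factor [y j] leaves a cofactor vanishing at [e]: either another frame element
    remains, or the coefficient vanishes by hypothesis. *)
Lemma y_part_aug (F : {mpoly mp[N]}) :
  (forall j, (F@_(U_(lshift d j))).@[e] = 0) ->
  is_aug (\sum_(m <- msupp F | ~~ xmon m) F@_m * mmap1 frame m).
Proof.
move=> Fj; apply: (is_ideal_sum aug_mul_ideal) => m /xmonPn[j mj].
rewrite (mmap1_frame_split mj) frame_l mulrCA mulrC; apply: aug_mulP => //.
rewrite mevalM mmap1_frame_one; case: eqP => [m0|_]; last by rewrite mulr0.
suff -> : m = U_(lshift d j)%MM by rewrite Fj mul0r.
have : (U_(lshift d j) <= m)%MM by rewrite lep1mP.
by move=> /submK <-; rewrite m0 add0m.
Qed.

(** By the chain rule the gradient at [e] combines the gradients of the frame with the linear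
    coefficients of [F], and [indep] applies. *)
Lemma gradient_vanish (F : {mpoly mp[N]}) :
  (forall c m, (F@_m)^`M(c) = 0) -> (forall c, F.@[frame]^`M(c).@[e] = 0) ->
  forall j, (F@_(U_(lshift d j))).@[e] = 0.
Proof.
move=> Fc F0; apply: (indep (b := fun i => (F@_(U_(rshift t i))).@[e])) => c.
rewrite -[RHS](F0 c) (der_meval (mderiv_derivation k c)) // (raddf_sum (meval e)) big_split_ord /=.
congr (_ + _); apply: eq_bigr => i _; rewrite mevalM ?frame_l ?frame_r;
  congr (_ * _); rewrite [RHS]meval_frame_one mcoeff_mderiv add0m mnm0E mulr1n //.
Qed.

Lemma xmon_split (F : {mpoly mp[N]}) : exists2 Fx : {mpoly mp[N]},
  forall m, Fx@_m = (if xmon m then F@_m else 0) &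
  F.@[frame]
    = Fx.@[frame] + \sum_(m <- msupp F | ~~ xmon m) F@_m * mmap1 frame m.
Proof.
exists (\sum_(m <- msupp F | xmon m) F@_m *: 'X_[m]) => [m|].
  rewrite (raddf_sum (mcoeff m)) /=.
  under eq_bigr => m' _ do rewrite mcoeffZ mcoeffX.
  have [Fm|Fm] := boolP (m \in msupp F); last first.
    rewrite (memN_msupp_eq0 Fm) if_same big_seq_cond big1 // => m' /andP[Fm' _].
    by case: eqP Fm => [<-|]; rewrite ?Fm' ?mulr0.
  rewrite big_mkcond (bigD1_seq m) ?msupp_uniq //= eqxx mulr1 big1 ?addr0 //.
  by move=> m' m'm; rewrite (negPf m'm) mulr0 if_same.
rewrite {1}mevalE (bigID xmon) /= (raddf_sum (meval frame)) /=; congr (_ + _).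
by apply: eq_bigr => m _; rewrite mevalZ mevalX.
Qed.

(** Polynomials in [x] alone whose coefficients are constants for every [D i], so that [D i] acts on
    their values as [u] times a partial derivative. *)
Definition admissible (F : {mpoly mp[N]}) :=
  (forall m, F@_m != 0 -> xmon m) /\ (forall i m, D i F@_m = 0).

Lemma admissible_deriv F i : admissible F -> admissible F^`M(rshift t i).
Proof.
move=> [Fx FD]; split=> [m|i' m]; rewrite mcoeff_mderiv; last first.
  by rewrite -mulr_natl (derM (DD i')) FD mulr0 addr0 -mpolyC_nat;
     case: (DD i') => _ _ ->; rewrite mul0r.
move=> Fm; have /Fx/forallP h : F@_(m + U_(rshift t i)) != 0.
  by apply: contraNneq Fm => ->; rewrite mul0rn.
by apply/forallP => j; have := h j; rewrite mnmDE addn_eq0 => /andP[].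
Qed.

Lemma admissible_chain F i : admissible F ->
  D i F.@[frame] = F^`M(rshift t i).@[frame] * u.
Proof.
move=> [Fx FD]; rewrite (der_meval (DD i)) // big_split_ord /= big1 ?add0r => [|j _].
  rewrite (bigD1 i) //= big1 ?addr0 => [|i' ii'].
    by rewrite frame_r Dx eqxx mul1r.
  by rewrite frame_r Dx eq_sym (negPf ii') mul0r mulr0.
suff -> : F^`M(lshift d j) = 0 by rewrite rmorph0 mul0r.
apply/mpolyP => m; rewrite mcoeff_mderiv mcoeff0.
have [->|/Fx/forallP/(_ j)] := eqVneq F@_(m + U_(lshift d j)) 0.
  by rewrite mul0rn.
by rewrite mnmDE mnm1E eqxx addn1.
Qed.

(* Applying [D i] and then cross-multiplying by [v] removes the term in which
   the multiplier [v] is differentiated. *)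
Lemma admissible_step F i v ep : admissible F -> J (v * F.@[frame] + ep) ->
  J (v * v * u * F^`M(rshift t i).@[frame] + (v * D i ep - D i v * ep)).
Proof.
move=> aF JF; have := DJ i JF; rewrite (derD (DD i)) (derM (DD i)).
rewrite admissible_chain // => /(is_idealM idJ v) J1.
have := is_idealB idJ J1 (is_idealM idJ (D i v) JF).
by congr J; ring.
Qed.

Lemma mnm_pred (m : 'X_{1..N}) i : m i != 0%N ->
  (m - U_(i) + U_(i))%MM = m /\ (mdeg (m - U_(i))%MM).+1 = mdeg m.
Proof.
move=> mi; have E : (m - U_(i) + U_(i))%MM = m by rewrite submK // lep1mP.
by split=> //; rewrite -[in RHS]E mdegD mdeg1 addn1.
Qed.

Lemma mcoeff_mderiv_pred (F : {mpoly mp[N]}) (m : 'X_{1..N}) i : m i != 0%N ->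
  F^`M(i)@_(m - U_(i)) = F@_m *+ m i.
Proof.
move=> mi; have [E _] := mnm_pred mi; rewrite mcoeff_mderiv E; congr (_ *+ _).
by rewrite mnmBE mnm1E eqxx subn1 prednK // lt0n.
Qed.

Lemma admissible_var F (m : 'X_{1..N}) : admissible F -> F@_m != 0 ->
  m != 0%MM -> exists i, m (rshift t i) != 0%N.
Proof.
move=> [Fx _] Fm m0; apply/existsP; apply: contraNT m0.
rewrite negb_exists => /forallP h; apply/eqP/mnmP => i; rewrite mnm0E.
rewrite -[i]splitK; case: (split i) => j /=; apply/eqP.
  exact: (forallP (Fx m Fm)).
by have := h j; rewrite negbK.
Qed.

(** The constant coefficient is read off at [e]. Any other one is reached by differentiating along a
    variable of its monomial, which lowers degree and precision by one and multiplies the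
    coefficient by a nonzero integer. *)
Lemma admissible_char0 l F v ep : (forall m, m.+1%:R != 0 :> k) ->
  admissible F -> v.@[e] != 0 -> m_ l ep -> J (v * F.@[frame] + ep) ->
  forall m, (mdeg m < l)%N -> (F@_m).@[e] = 0.
Proof.
move=> char0; elim: l F v ep => // l IH F v ep aF v0 mep JF m lt_ml.
have [->|m0] := eqVneq m 0%MM.
  have /eqP := Je JF; rewrite mevalD mevalM meval_frame_one.
  rewrite (idpow1_eval (idpow_leq (ltn0Sn l) mep)) addr0 mulf_eq0 (negPf v0) /=.
  exact: eqP.
have [Fm0|Fm] := eqVneq F@_m 0; first by rewrite Fm0 rmorph0.
have [i mi] := admissible_var aF Fm m0; have [_ dm] := mnm_pred mi.
have m_ideal := idpow_ideal (augm e) l.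
have : (F^`M(rshift t i)@_(m - U_(rshift t i))).@[e] = 0.
  apply: (IH _ (v * v * u) _ (admissible_deriv i aF) _ _ (admissible_step i aF JF)).
  - by rewrite !mevalM ue mulr1 mulf_neq0.
  - apply: (is_idealB m_ideal); apply: (is_idealM m_ideal); last exact: idpowS.
    exact: (der_idpow (DD i)).
  - by rewrite -ltnS dm.
rewrite mcoeff_mderiv_pred // mevalMn -mulr_natl => /eqP.
by rewrite mulf_eq0 -[m _]prednK ?lt0n // (negPf (char0 _)) /= => /eqP.
Qed.

(** The same descent without error term, so the conclusion is membership in [J] up to a multiplier
    nonzero at [e]. Exponents below [q] keep the integer factors invertible. *)
Lemma admissible_coeffs q L F v : (forall j, (0 < j < q)%N -> j%:R != 0 :> k) ->
  admissible F -> (forall m i, F@_m != 0 -> (m i < q)%N) ->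
  (forall m, F@_m != 0 -> (mdeg m < L)%N) -> v.@[e] != 0 ->
  J (v * F.@[frame]) ->
  exists2 w, w.@[e] != 0 & forall m, J (w * F@_m).
Proof.
move=> charq; have J0 : J 0 by case: idJ.
elim: L F v => [|L IH] F v aF expF degF v0 JF.
  exists 1 => [|m]; first by rewrite rmorph1 oner_neq0.
  have [->|/degF //] := eqVneq F@_m 0.
  by rewrite mulr0.
have loc m : exists w, w.@[e] != 0 /\ (m != 0%MM -> J (w * F@_m)).
  have [->|m0] := eqVneq m 0%MM.
    by exists 1; rewrite rmorph1 oner_neq0.
  have [->|Fm] := eqVneq F@_m 0.
    by exists 1; rewrite rmorph1 oner_neq0 mulr0.
  have [i mi] := admissible_var aF Fm m0.
  have aF' := admissible_deriv i aF.
  have nz m' : F^`M(rshift t i)@_m' != 0 -> F@_(m' + U_(rshift t i)) != 0.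
    by rewrite mcoeff_mderiv; apply: contraNneq => ->; rewrite mul0rn.
  have JF0 : J (v * F.@[frame] + 0) by rewrite addr0.
  have := admissible_step i aF JF0.
  rewrite (der0 (DD i)) !mulr0 subrr addr0 => JF'.
  have [|||w w0 wJ] := IH _ _ aF' _ _ _ JF'.
  - move=> m' j /nz/(expF _ j); rewrite mnmDE; apply: leq_ltn_trans.
    exact: leq_addr.
  - by move=> m' /nz/degF; rewrite mdegD mdeg1 addn1 ltnS.
  - by rewrite !mevalM ue mulr1 mulf_neq0.
  exists w; split=> // _; have := wJ (m - U_(rshift t i))%MM.
  rewrite mcoeff_mderiv_pred // => wJm.
  have mk : (m (rshift t i))%:R != 0 :> k.
    by apply: charq; rewrite lt0n mi expF.
  have := is_idealM idJ ((m (rshift t i))%:R^-1)%:MP wJm.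
  rewrite !mulrnAr -mulrnAl -mpolyCMn -[_^-1 *+ _]mulr_natr mulVf // mpolyC1 mul1r; exact.
have [w wP] := choice_fun loc.
(* A common multiplier for the nonconstant coefficients; the constant one is then what remains of
   [F.@[frame]]. *)
pose W := \prod_(m <- msupp F) w m.
have W0 : W.@[e] != 0.
  rewrite /W rmorph_prod; elim/big_ind: _ => [|a b|m _] /=.
  - exact: oner_neq0.
  - exact: mulf_neq0.
  - by case: (wP m).
have WJ m : m != 0%MM -> J (W * F@_m).
  move=> m0; have [Fm|Fm] := boolP (m \in msupp F); last first.
    by rewrite (memN_msupp_eq0 Fm) mulr0.
  rewrite /W (bigD1_seq m) ?msupp_uniq //= mulrAC; apply: (is_idealMr idJ).
  by have [_] := wP m; apply.
exists (W * v) => [|m]; first by rewrite mevalM mulf_neq0.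
have [->|m0] := eqVneq m 0%MM; last first.
  by rewrite mulrAC; apply: (is_idealMr idJ); apply: WJ.
have JWF : J (W * v * F.@[frame]) by rewrite -mulrA; apply: (is_idealM idJ).
have [F0|F0] := boolP (0%MM \in msupp F); last first.
  by rewrite (memN_msupp_eq0 F0) mulr0.
apply: (is_idealBl idJ JWF); rewrite mevalE (bigD1_seq 0%MM) ?msupp_uniq //=.
rewrite -/(mmap1 frame 0%MM) mmap11 mulr1 mulrDr addrAC subrr add0r mulr_sumr.
apply: (is_ideal_sum idJ) => m' m'0; rewrite mulrA [W * v * _]mulrAC.
by do 2!apply: (is_idealMr idJ); apply: WJ.
Qed.

(* Cartier: in characteristic zero no reducedness hypothesis is needed; Krull's
   theorem turns the approximations modulo powers of the augmentation ideal
   into membership. *)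
Lemma regular_char0 : (forall m, m.+1%:R != 0 :> k) -> regular_at e J.
Proof.
move=> char0 f Jf df.
(* Precision [l.+2] allows the error to be differentiated once and still vanish at [e], even for
   [l = 0]. *)
suff approx l : exists2 b, is_aug b & m_ l.+2 (f - b).
  have [|c c1 augc] := krull_intersection (noetherian_mpoly (@noetherian_field k))
    aug_mul_ideal (y := augm e) (a := f) _.
    by move=> l; have [b ab mb] := approx l; exists b => //; apply: idpow_leq mb; lia.
  rewrite -[f](subrK (c * f)); apply: (is_idealD aug_mul_ideal) => //.
  by apply: aug_mulP => //; apply: idpow1_eval.
have [F0 mF0] := frame_expansion l.+2 f.
pose F : {mpoly mp[N]} := map_mpoly (@mpolyC n k) F0.
have FE : F.@[frame] = mmap (@mpolyC n k) frame F0.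
  rewrite (rmorph_mmap (meval frame)).
  by apply: eq_mmap => i /=; rewrite ?mevalC ?mevalXU.
rewrite -FE in mF0; have Fm m : F@_m = (F0@_m)%:MP by rewrite mcoeff_map_mpoly.
have Fe m : (F@_m).@[e] = F0@_m by rewrite Fm mevalC.
have Fy : forall j, (F@_(U_(lshift d j))).@[e] = 0.
  apply: gradient_vanish => [c m|c]; first by rewrite Fm mderivC.
  have := der_idpow (mderiv_derivation k c) mF0; move/(idpow_leq (ltn0Sn l)).
  by move/idpow1_eval/eqP; rewrite mderivB mevalB df sub0r oppr_eq0 => /eqP.
have [Fx FxE split_F] := xmon_split F.
have aFx : admissible Fx.
  split=> [m|i m]; rewrite FxE; case: ifP; rewrite ?eqxx // => _.
    by rewrite Fm; case: (DD i) => _ _ ->.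
  exact: (der0 (DD i)).
set Py := (X in _ = _ + X) in split_F.
exists Py; first exact: y_part_aug.
have mFx : m_ l.+2 (Fx.@[frame]).
  rewrite mevalE; apply: (is_ideal_sum (idpow_ideal _ _)) => m _.
  have [le_lm|lt_ml] := leqP l.+2 (mdeg m).
    apply: (is_idealM (idpow_ideal _ _)); apply: idpow_leq le_lm _.
    exact: mmap1_frame_idpow.
  have := @admissible_char0 l.+2 Fx 1 (f - F.@[frame]) char0 aFx.
  rewrite rmorph1 oner_neq0 mul1r => /(_ isT mF0) h.
  have /h/(_ m lt_ml) : J (Fx.@[frame] + (f - F.@[frame])).
    have -> : Fx.@[frame] + (f - F.@[frame]) = f - Py by rewrite split_F; ring.
    by apply: (is_idealB idJ) => //; apply: y_part_ideal.
  rewrite FxE; case: ifP => _; last by rewrite mul0r; case: (idpow_ideal (augm e) l.+2).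
  by rewrite Fe Fm => ->; rewrite mpolyC0 mul0r; case: (idpow_ideal (augm e) l.+2).
have -> : f - Py = (f - F.@[frame]) + Fx.@[frame] by rewrite split_F; ring.
exact: (is_idealD (idpow_ideal _ _)).
Qed.

(** In a [p]-th power one factor stays in [J] and the [p.-1] others vanish at [e]. *)
Lemma pspan_aug p g : (1 < p)%N -> pspan p J g -> is_aug g.
Proof.
move=> p1 [l Jl ->]; apply: (is_ideal_sum_mem aug_mul_ideal) => q /Jl Jq.
rewrite -[p]prednK ?(ltnW p1) // exprSr scalerAl; apply: aug_mulP => //.
by rewrite mevalZ rmorphXn /= Je // expr0n gtn_eqF ?mulr0 // -ltnS prednK // ltnW.
Qed.

(** Up to a multiplier nonzero at [e], Nakayama expands [f] in the frame with exponents below [p]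
    and coefficients in the span of [p]-th powers. The part involving [y] lies in the maximal ideal
    times [J] because the gradient of [f] vanishes. The coefficients of the [x] part lie in [J] up
    to such a multiplier, hence in [pspan p J] by hypothesis, and [pspan_aug] applies. *)
Lemma regular_charp p : p \in [pchar k] ->
  (forall g, pspan p (fun _ => True) g -> J g -> pspan p J g) ->
  regular_at e J.
Proof.
move=> pk Jp f Jf df; have p1 : (1 < p)%N := prime_gt1 (p_prime pk).
have [T T0 TP] := prepr_nakayama pk frame_expansion.
have [b Pb Tf] := TP f.
pose mE (E : {ffun 'I_N -> 'I_p}) : 'X_{1..N} := [multinom (E i : nat) | i < N].
pose F : {mpoly mp[N]} := \sum_E b E *: 'X_[mE E].
have FE : F.@[frame] = T * f.
  rewrite Tf (raddf_sum (meval frame)); apply: eq_bigr => E _ /=.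
  rewrite mevalZ mevalX; congr (_ * _); apply: eq_bigr => i _.
  by rewrite mnmE.
have Fm m : F@_m = \sum_E b E * (mE E == m)%:R.
  rewrite (raddf_sum (mcoeff m)); apply: eq_bigr => E _ /=.
  by rewrite mcoeffZ mcoeffX.
have PF m : pspan p (fun _ => True) F@_m.
  rewrite Fm; apply: pspan_sum => E _; apply: pspanM => //.
  by rewrite -mpolyC_nat; apply: pspanC.
have Fp m i : F@_m != 0 -> (m i < p)%N.
  move=> F0; have [E /eqP <-] : exists E, mE E == m.
    apply/existsP; apply: contraNT F0; rewrite negb_exists => /forallP mEm.
    by rewrite Fm big1 // => E _; rewrite (negPf (mEm E)) mulr0.
  by rewrite mnmE.
have Fy : forall j, (F@_(U_(lshift d j))).@[e] = 0.
  apply: gradient_vanish => [c m|c].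
    exact: (der_pspan pk (mderiv_derivation k c)).
  by rewrite FE mderivM mevalD !mevalM df (Je Jf) !mulr0 addr0.
have [Fx FxE split_F] := xmon_split F; set Py := (X in _ = _ + X) in split_F.
have FxF m : Fx@_m != 0 -> F@_m != 0.
  by rewrite FxE; case: ifP; rewrite ?eqxx.
have PFx m : pspan p (fun _ => True) Fx@_m.
  by rewrite FxE; case: ifP => _; [apply: PF | apply: pspan0].
have aFx : admissible Fx.
  split=> [m|i m]; first by rewrite FxE; case: ifP; rewrite ?eqxx.
  exact: (der_pspan pk (DD i)).
have JFx : J (1 * Fx.@[frame]).
  have -> : 1 * Fx.@[frame] = T * f - Py by rewrite -FE split_F; ring.
  by apply: (is_idealB idJ); [apply: (is_idealM idJ) | apply: y_part_ideal].
have [|||w w0 wJ] := admissible_coeffs (L := msize Fx) (pchar_nz pk) aFx _ _ _ JFx.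
- by move=> m i /FxF; apply: Fp.
- by move=> m Fxm; apply: msize_mdeg_lt; rewrite mcoeff_msupp.
- by rewrite rmorph1 oner_neq0.
(* Multiplying by [w ^+ p] rather than [w] keeps the coefficients in the span of [p]-th powers,
   where [Jp] applies. *)
pose a := w ^+ p * T; pose c := a.@[e].
have c0 : c != 0 by rewrite /c mevalM rmorphXn mulf_neq0 ?expf_neq0.
have aug_af : is_aug (a * f).
  rewrite /a -mulrA -FE split_F mulrDr; apply: (is_idealD aug_mul_ideal).
    rewrite mevalE mulr_sumr; apply: (is_ideal_sum aug_mul_ideal) => m _.
    rewrite mulrA; apply: (is_idealMr aug_mul_ideal).
    apply: (pspan_aug p1); apply: Jp.
      by apply: pspanM; [apply: pspan_pow | apply: PFx].
    rewrite -[p]prednK ?(ltnW p1) // exprSr -mulrA; exact: (is_idealM idJ).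
  by apply: (is_idealM aug_mul_ideal); apply: y_part_aug.
(* The multiplier [a] is traded for 1 at the cost of a factor vanishing at [e]. *)
have -> : f = (1 - (c^-1)%:MP * a) * f + (c^-1)%:MP * (a * f) by ring.
apply: (is_idealD aug_mul_ideal); last exact: (is_idealM aug_mul_ideal).
apply: aug_mulP => //; rewrite mevalB meval1 mevalM mevalC mulVf //.
by rewrite subrr.
Qed.

End Expansion.

(** * Injectivity of the relative Frobenius *)

Section Independence.
Variables (k : fieldType) (V : zmodType) (act : k -> V -> V) (V0 : V -> Prop).
Hypotheses (V00 : V0 0) (V0B : forall a b, V0 a -> V0 b -> V0 (a - b)).
Hypothesis V0act : forall c a, V0 a -> V0 (act c a).
Hypotheses (actD : forall c a b, act c (a + b) = act c a + act c b).
Hypotheses (actA : forall c d a, act c (act d a) = act (c * d) a).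
Hypotheses (act1 : forall a, act 1 a = a) (act0 : forall a, act 0 a = 0).
Hypotheses (actN : forall c a, act (- c) a = - act c a).

(** Spans are taken modulo [V0]. The map [act] will be scalar multiplication on polynomials, or the
    Frobenius-twisted action of [k] on itself. *)
Fixpoint inspan (cs : seq V) (v : V) : Prop :=
  if cs is c :: cs' then exists nu, inspan cs' (v - act nu c) else V0 v.

Fixpoint indep (cs : seq V) : Prop :=
  if cs is c :: cs' then ~ inspan cs' c /\ indep cs' else True.

Local Notation comb l := (\sum_(q <- l) act q.2 q.1).

Lemma inspanP cs v :
  inspan cs v <-> exists2 l : seq (V * k), unzip1 l = cs & V0 (v - comb l).
Proof.
elim: cs v => [|c cs IH] v /=.
  split=> [Vv | [[|//] _]]; last by rewrite big_nil subr0.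
  by exists [::]; rewrite ?big_nil ?subr0.
split=> [[nu /IH[l <- Vl]] | [[|[c' nu] l] //= [-> lcs]]].
  by exists ((c, nu) :: l) => //; rewrite big_cons opprD addrA.
by rewrite big_cons opprD addrA => Vl; exists nu; apply/IH; exists l.
Qed.

Lemma act_sum c (l : seq (V * k)) :
  act c (comb l) = comb [seq (q.1, c * q.2) | q <- l].
Proof.
rewrite big_map; elim: l => [|q l IH]; last by rewrite !big_cons actD IH actA.
by rewrite !big_nil -(act0 0) actA mulr0.
Qed.

Lemma unzip1_map2 (T : Type) (f : V * T -> T) (l : seq (V * T)) :
  unzip1 [seq (q.1, f q) | q <- l] = unzip1 l.
Proof. by rewrite /unzip1 -map_comp. Qed.

Lemma indepP cs : indep cs <-> forall l : seq (V * k), unzip1 l = cs ->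
  V0 (comb l) -> forall q, q \in l -> q.2 = 0.
Proof.
elim: cs => [|c cs IH] /=; first by split=> // _ [].
split=> [[ncs ics] [|[c' nu] l] //= [-> lcs]|h].
  rewrite big_cons /= => Vl.
  have nu0 : nu = 0.
    apply/eqP; apply: contraT => nu0; case: ncs; apply/inspanP.
    exists [seq (q.1, - nu^-1 * q.2) | q <- l]; first by rewrite unzip1_map2.
    rewrite -act_sum actN opprK.
    by have := V0act nu^-1 Vl; rewrite actD actA mulVf // act1.
  move=> q; rewrite inE => /orP[/eqP-> //|ql].
  move: Vl; rewrite nu0 act0 add0r => Vl.
  exact: ((IH.1 ics) l lcs Vl).
split.
  move=> /inspanP[l lcs Vl].
  have := h ((c, - 1) :: l) _ _ (c, -1) (mem_head _ _).
  rewrite /= lcs big_cons /= actN act1 => /(_ erefl) e.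
  have /e/eqP : V0 (- c + comb l).
    by have := V0B V00 Vl; rewrite sub0r opprB addrC.
  by rewrite oppr_eq0 oner_eq0.
apply/IH => l lcs Vl q ql.
apply: (h ((c, 0) :: l)); first by rewrite /= lcs.
  by rewrite big_cons /= act0 add0r.
by rewrite inE ql orbT.
Qed.

(** * Elimination in tensor products *)

Section Elimination.
Variables (U : lmodType k) (W : zmodType) (T : U -> V -> W) (K : W -> Prop).
Hypotheses (K0 : K 0) (KB : forall a b, K a -> K b -> K (a - b)).
Hypothesis TDl : forall f g a, T (f + g) a = T f a + T g a.
Hypothesis TDr : forall f a b, T f (a + b) = T f a + T f b.
Hypothesis TZ : forall c f a, T (c *: f) a = T f (act c a).
Hypothesis TV0 : forall f a, V0 a -> K (T f a).

Local Notation tsum l := (\sum_(q <- l) T q.2 q.1).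

Let KN a : K a -> K (- a).
Proof. by rewrite -sub0r; apply: KB. Qed.

Let KD a b : K a -> K b -> K (a + b).
Proof. by move=> Ka Kb; rewrite -[b]opprK; apply: KB => //; apply: KN. Qed.

Let TNl f a : T (- f) a = - T f a.
Proof.
have T0 : T 0 a = 0.
  by apply: (addrI (T 0 a)); rewrite -TDl !addr0.
by apply/eqP; rewrite -addr_eq0 -TDl addNr T0.
Qed.

Definition subspace (I : U -> Prop) :=
  (forall f g, I f -> I g -> I (f + g)) /\ (forall c f, I f -> I (c *: f)).

(** [T] is a tensor pairing modulo [K]. A term on a vector in the span of the family is spread over
    the family, which changes each coefficient by a multiple of [z]; hence the last clause for
    subspaces containing [z]. *)
Lemma absorb (l : seq (V * U)) a z : inspan (unzip1 l) a ->
  exists l' : seq (V * U),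
    [/\ unzip1 l' = unzip1 l, K (tsum l' - (tsum l + T z a)) &
      forall I, subspace I -> I z -> (forall q, q \in l' -> I q.2) ->
        forall q, q \in l -> I q.2].
Proof.
elim: l a => [|[c f] l IH] a /=.
  move=> Va; exists [::]; split=> //.
  by rewrite !big_nil !add0r; apply: KN; apply: TV0.
move=> [nu /IH[l' [l'l Kl' Il']]].
exists ((c, f + nu *: z) :: l'); split; first by rewrite /= l'l.
  rewrite !big_cons /= TDl TZ.
  have -> : T z a = T z (a - act nu c) + T z (act nu c) by rewrite -TDr subrK.
  move: Kl'; congr K; set A := T z _; set B := T z _.
  by rewrite [A + B]addrC [_ + (B + A)]addrACA [- (_ + B + _)]opprD [RHS]addrACA subrr add0r.
move=> I subI Iz Il q; have [ID IZ] := subI.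
have Il'' q' : q' \in l' -> I q'.2 by move=> q'l; apply: Il; rewrite inE q'l orbT.
rewrite inE => /orP[/eqP->|]; last exact: Il'.
have /= If := Il _ (mem_head _ _).
have -> : f = (f + nu *: z) + (-1) *: (nu *: z) by rewrite scaleN1r addrK.
by apply: ID => //; apply: (IZ); apply: (IZ).
Qed.

Lemma indep_rewrite (l : seq (V * U)) :
  exists2 l' : seq (V * U), indep (unzip1 l') & K (tsum l' - tsum l).
Proof.
elim: l => [|[a f] l [l' il' Kl']]; first by exists [::] => //; rewrite big_nil subrr.
case: (classic (inspan (unzip1 l') a)) => [sa | nsa]; last first.
  exists ((a, f) :: l') => //=; rewrite !big_cons /=.
  by rewrite opprD addrACA subrr add0r.
have [l'' [u'' K'' _]] := absorb f sa; exists l''; first by rewrite u''.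
rewrite big_cons /= [T f a + _]addrC -[tsum l''](subrK (tsum l' + T f a)) -addrA.
by apply: KD => //; rewrite opprD addrACA subrr addr0.
Qed.

(** Terms of [l2] are moved to the left one by one: absorbed when their vector is in the span,
    appended otherwise. When none remains, the hypothesis on relations applies. *)
Lemma indep_eliminate (I : U -> Prop) (l l2 : seq (V * U)) : subspace I ->
  (forall l, indep (unzip1 l) -> K (tsum l) -> forall q, q \in l -> I q.2) ->
  indep (unzip1 l) -> (forall q, q \in l2 -> I q.2) -> K (tsum l - tsum l2) ->
  forall q, q \in l -> I q.2.
Proof.
move=> subI base; have [ID IZ] := subI.
elim: l2 l => [|[a z] l2 IH] l il I2.
  by rewrite big_nil subr0; apply: base.
have Iz : I z := I2 _ (mem_head _ _).
have I2' q : q \in l2 -> I q.2 by move=> ql; apply: I2; rewrite inE ql orbT.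
have INz : I (- z) by rewrite -scaleN1r; apply: IZ.
rewrite big_cons /=; case: (classic (inspan (unzip1 l) a)) => [sa | nsa] Kl.
  have [l' [u' K' I']] := absorb (- z) sa.
  apply: (I' I subI INz); apply: IH => //; first by rewrite u'.
  rewrite TNl in K'; rewrite -[tsum l'](subrK (tsum l - T z a)) -addrA.
  by apply: KD => //; rewrite -addrA -opprD.
have Kl' : K (tsum ((a, - z) :: l) - tsum l2).
  by rewrite big_cons /= TNl [- _ + _]addrC -addrA -opprD.
by move=> q ql; apply: (IH ((a, - z) :: l)) => //; rewrite inE ql orbT.
Qed.

End Elimination.
End Independence.

(** * Frobenius injectivity in terms of independent coefficients *)

Section FrobeniusIndependence.
Variables (k : fieldType) (p : nat).
Hypothesis pk : p \in [pchar k].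

(* k as a vector space over its subfield of p-th powers. *)
Definition pact (c a : k) := a * c ^+ p.
Local Notation is0 := (fun a => a = 0).
Local Notation pindep := (indep pact is0).

Let p0 : (0 < p)%N := p_gt0 pk.

Let is0B (V : zmodType) (a b : V) : a = 0 -> b = 0 -> a - b = 0.
Proof. by move=> -> ->; rewrite subr0. Qed.

Let pact_is0 c (a : k) : a = 0 -> pact c a = 0.
Proof. by move=> ->; rewrite /pact mul0r. Qed.

Let pactD c a b : pact c (a + b) = pact c a + pact c b.
Proof. exact: mulrDl. Qed.

Let pactA c d a : pact c (pact d a) = pact (c * d) a.
Proof. by rewrite /pact exprMn -mulrA [c ^+ p * _]mulrC. Qed.

Let pact1 a : pact 1 a = a.
Proof. by rewrite /pact expr1n mulr1. Qed.

Let pact0 a : pact 0 a = 0.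
Proof. by rewrite /pact expr0n gtn_eqF // mulr0. Qed.

Let pactN c a : pact (- c) a = - pact c a.
Proof.
apply/eqP; rewrite -addr_eq0 -mulrDr -exprDn_pchar ?pnatE ?pk ?(p_prime pk) //.
by rewrite addNr expr0n gtn_eqF // mulr0.
Qed.

Definition pindepP := indepP (erefl 0) (@is0B k) pact_is0 pactD pactA pact1 pact0 pactN.

(* Injectivity of the relative Frobenius of k[X]/J, read off on families of
   coefficients that are linearly independent over the p-th powers of k. *)
Definition frob_indep n (J : {mpoly k[n]} -> Prop) :=
  forall l : seq (k * {mpoly k[n]}), pindep (unzip1 l) ->
    J (\sum_(q <- l) q.1 *: q.2 ^+ p) -> forall q, q \in l -> J q.2.

(** The equivalent form by spans: [J] meets [k[X_1^p, ..., X_n^p]] in the span of its own [p]-th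
    powers. The form [frob_indep] is the one visibly stable under intersections and preimages. *)
Definition frob_closed n (J : {mpoly k[n]} -> Prop) :=
  forall g, pspan p (fun _ => True) g -> J g -> pspan p J g.

Lemma expr_sum_p n I (r : seq I) (P : pred I) (F : I -> {mpoly k[n]}) :
  (\sum_(i <- r | P i) F i) ^+ p = \sum_(i <- r | P i) F i ^+ p.
Proof.
apply: (big_morph (fun f => f ^+ p)); first exact: exprDp.
by rewrite expr0n gtn_eqF.
Qed.

Lemma expZp n c (f : {mpoly k[n]}) : (c *: f) ^+ p = c ^+ p *: f ^+ p.
Proof. by rewrite exprZn. Qed.

Lemma mpoly_powE n (f : {mpoly k[n]}) :
  f ^+ p = \sum_(m <- msupp f) f@_m ^+ p *: 'X_[m *+ p].
Proof.
rewrite {1}[f]mpolyE expr_sum_p; apply: eq_bigr => m _.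
by rewrite expZp mpolyXn.
Qed.

Lemma mcoeff_pow n (f : {mpoly k[n]}) m : (f ^+ p)@_(m *+ p) = f@_m ^+ p.
Proof.
rewrite mpoly_powE (raddf_sum (mcoeff (m *+ p)%MM)) /=.
under eq_bigr => m' _ do rewrite mcoeffZ mcoeffX.
have inj m' : ((m' *+ p)%MM == (m *+ p)%MM) = (m' == m).
  apply/eqP/eqP => [/mnmP E|->] //; apply/mnmP => i.
  by have := E i; rewrite !mulmnE => /eqP; rewrite eqn_pmul2r // => /eqP.
have [mf|mf] := boolP (m \in msupp f).
  rewrite (bigD1_seq m) ?msupp_uniq //= eqxx mulr1 big1 ?addr0 // => m' m'm.
  by rewrite inj (negPf m'm) mulr0.
rewrite (memN_msupp_eq0 mf) expr0n gtn_eqF // big_seq big1 // => m' m'f.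
by rewrite inj; case: eqP mf => [<-|]; rewrite ?m'f ?mulr0.
Qed.

Section PolynomialPowers.
Variable n : nat.
Local Notation mp := {mpoly k[n]}.
Let T (f : mp) (a : k) : mp := a *: f ^+ p.

Let TDl f g a : T (f + g) a = T f a + T g a.
Proof. by rewrite /T exprDp // scalerDr. Qed.
Let TDr f a b : T f (a + b) = T f a + T f b.
Proof. exact: scalerDl. Qed.
Let TZ c f a : T (c *: f) a = T f (pact c a).
Proof. by rewrite /T expZp scalerA. Qed.
Let TV0 f a : a = 0 -> T f a = 0.
Proof. by move=> ->; apply: scale0r. Qed.

Lemma indep_powers0 (l : seq (k * mp)) : pindep (unzip1 l) ->
  \sum_(q <- l) q.1 *: q.2 ^+ p = 0 -> forall q, q \in l -> q.2 = 0.
Proof.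
move=> il l0 q ql; apply/mpolyP => m; rewrite mcoeff0.
have h := (pindepP (unzip1 l)).1 il [seq (q.1, q.2@_m) | q <- l].
apply: (h _ _ (q.1, q.2@_m)).
- by rewrite /unzip1 -map_comp.
- have := congr1 (mcoeff (m *+ p)%MM) l0; rewrite mcoeff0 => E; rewrite -[RHS]E.
  rewrite big_map (raddf_sum (mcoeff _)); apply: eq_bigr => r _ /=.
  by rewrite mcoeffZ mcoeff_pow.
- by apply/mapP; exists q.
Qed.

Lemma frob_indep_closed (J : mp -> Prop) : frob_indep J -> frob_closed J.
Proof.
move=> Ji g [l _ gE] Jg.
have [l' il' E] := indep_rewrite (erefl 0) (@is0B mp) TDl TDr TZ TV0 l.
have {}E : g = \sum_(q <- l') q.1 *: q.2 ^+ p.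
  by rewrite gE; apply/esym/eqP; rewrite -subr_eq0; apply/eqP; exact: E.
by exists l' => //; apply: Ji => //; rewrite -E.
Qed.

Lemma frob_closed_indep (J : mp -> Prop) :
  is_ideal J -> frob_closed J -> frob_indep J.
Proof.
move=> idJ Jc l il Jl.
have Pl : pspan p (fun _ => True) (\sum_(q <- l) q.1 *: q.2 ^+ p) by exists l.
have [l2 Jl2 E] := Jc _ Pl Jl.
have subJ : subspace J.
  split=> [f g|c f Jf]; first exact: (is_idealD idJ).
  by rewrite -mul_mpolyC; apply: (is_idealM idJ).
apply: (indep_eliminate (erefl 0) (@is0B mp) TDl TDr TZ TV0 subJ _ il Jl2).
  move=> l' il' l'0 q ql'; rewrite (indep_powers0 il' l'0 ql'); by case: idJ.
by rewrite -E subrr.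
Qed.

Lemma frob_indep_eval (e : 'I_n -> k) : frob_indep (fun f => f.@[e] = 0).
Proof.
move=> l il l0 q ql.
have h := (pindepP (unzip1 l)).1 il [seq (q.1, q.2.@[e]) | q <- l].
apply: (h _ _ (q.1, q.2.@[e])).
- by rewrite /unzip1 -map_comp.
- rewrite -[RHS]l0 big_map (raddf_sum (meval e)); apply: eq_bigr => r _ /=.
  by rewrite mevalZ rmorphXn.
- by apply/mapP; exists q.
Qed.

End PolynomialPowers.

(** The quotient by [J \o h] embeds as a [k]-algebra in the quotient by [J], and injectivity of
    Frobenius passes to subalgebras. *)
Lemma frob_indep_preim n n' (h : {rmorphism {mpoly k[n]} -> {mpoly k[n']}})
    (J : {mpoly k[n']} -> Prop) : (forall c, h c%:MP = c%:MP) ->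
  frob_indep J -> frob_indep (J \o h).
Proof.
move=> hC Ji l il Jl q ql.
apply: (Ji [seq (q.1, h q.2) | q <- l] _ _ (q.1, h q.2)).
- by rewrite /unzip1 -map_comp.
- rewrite big_map; move: Jl; rewrite /= rmorph_sum; congr J; apply: eq_bigr => r _.
  by rewrite -!mul_mpolyC rmorphM rmorphXn /= hC.
- by apply/mapP; exists q.
Qed.

Section IndependentPowers.
Variables (n : nat) (J : {mpoly k[n]} -> Prop).
Hypotheses (idJ : is_ideal J) (Ji : frob_indep J).
Local Notation mp := {mpoly k[n]}.
Local Notation zact := (fun (c : k) (f : mp) => c *: f).

Let JB a b : J a -> J b -> J (a - b). Proof. exact: (is_idealB idJ). Qed.
Let JZ c a : J a -> J (zact c a).
Proof. by move=> Ja; rewrite /= -mul_mpolyC; apply: (is_idealM idJ). Qed.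

Definition jindepP := @indepP k mp zact J (is_ideal0 idJ) JB JZ
  (fun c => scalerDr c) (fun c d => scalerA c d) (@scale1r _ _) (@scale0r _ _)
  (fun c a => scaleNr c a).

(** Given a relation among the [p]-th powers, expand its coefficients on one family of scalars
    independent over the [p]-th powers of [k]. Each scalar then multiplies the [p]-th power of a
    combination of [cs]; [Ji] puts that combination in [J], and independence of [cs] kills its
    coefficients. *)
Lemma indep_frobenius (cs : seq mp) :
  indep zact J cs -> indep zact J [seq f ^+ p | f <- cs].
Proof.
move=> ics; apply/jindepP => l lcs Jl q ql.
pose t := size cs; have sl : size l = t by have := congr1 size lcs; rewrite !size_map.
pose lam (i : 'I_t) := (nth (0, 0) l i).2.
pose E (i : 'I_t) := nth 0 cs i.
have lE i : (i < t)%N -> (nth (0, 0) l i).1 = nth 0 cs i ^+ p.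
  move=> it; rewrite -(nth_map (0, 0) 0 fst) ?sl // -[map fst l]/(unzip1 l) lcs.
  by rewrite (nth_map 0).
have suml : \sum_(r <- l) r.2 *: r.1 = \sum_i lam i *: E i ^+ p.
  rewrite (big_nth (0, 0)) big_mkord sl; apply: eq_bigr => i _.
  by rewrite lE.
pose T (mu : 'rV[k]_t) (c : k) := \row_i (c * mu 0 i ^+ p).
have TDl f g a : T (f + g) a = T f a + T g a.
  apply/rowP => i; rewrite !mxE -mulrDr; congr (_ * _).
  by apply: exprDn_pchar; rewrite pnatE ?pk ?(p_prime pk).
have TDr f a b : T f (a + b) = T f a + T f b.
  by apply/rowP => i; rewrite !mxE mulrDl.
have TZ c f a : T (c *: f) a = T f (pact c a).
  by apply/rowP => i; rewrite !mxE /pact exprMn mulrA.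
have TV0 f a : a = 0 -> T f a = 0.
  by move=> ->; apply/rowP => i; rewrite !mxE mul0r.
have [l' il' E'] : exists2 l' : seq (k * 'rV[k]_t), pindep (unzip1 l') &
    \sum_(q <- l') T q.2 q.1
      - \sum_(q <- [seq (lam i, delta_mx 0 i) | i <- enum 'I_t]) T q.2 q.1 = 0.
  exact: (indep_rewrite (erefl 0) (@is0B 'rV[k]_t) TDl TDr TZ TV0).
have lamE i : lam i = \sum_(r <- l') r.1 * (r.2 : 'rV[k]_t) 0 i ^+ p.
  have := congr1 (fun f : 'rV[k]_t => f 0 i) (subr0_eq E'); rewrite !summxE => E1.
  transitivity (\sum_(r <- l') T r.2 r.1 0 i).
    rewrite E1 big_map enumT (bigD1 i) //= !mxE !eqxx expr1n mulr1.
    rewrite big1 ?addr0 // => j ji; rewrite !mxE eq_sym (negPf ji) andbF expr0n.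
    by rewrite gtn_eqF // mulr0.
  by apply: eq_bigr => r _; rewrite mxE.
pose l'' := [seq (r.1, \sum_i (r.2 : 'rV[k]_t) 0 i *: E i) | r <- l'].
have Jl'' : J (\sum_(r <- l'') r.1 *: r.2 ^+ p).
  have : J (\sum_i lam i *: E i ^+ p) by rewrite -suml.
  congr J; rewrite big_map; under [LHS]eq_bigr => i _ do rewrite lamE scaler_suml.
  rewrite exchange_big; apply: eq_bigr => r _ /=.
  rewrite expr_sum_p scaler_sumr; apply: eq_bigr => i _.
  by rewrite expZp scalerA.
have il'' : pindep (unzip1 l'') by rewrite /unzip1 -map_comp.
have csE : [seq E i | i <- enum 'I_t] = cs.
  apply: (@eq_from_nth _ 0); first by rewrite size_map size_enum_ord.
  move=> i; rewrite size_map size_enum_ord => it.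
  by rewrite (nth_map (Ordinal it)) ?size_enum_ord // /E nth_enum_ord.
have mu0 (r : k * 'rV[k]_t) i : r \in l' -> r.2 0 i = 0.
  move=> rl'; have Jr : J (\sum_i r.2 0 i *: E i).
    by apply: (Ji il'' Jl'' (q := (r.1, _))); apply/mapP; exists r.
  apply: ((jindepP cs).1 ics [seq (E i, r.2 0 i) | i <- enum 'I_t] _ _ (E i, r.2 0 i)).
  - by rewrite /unzip1 -map_comp.
  - by rewrite big_map enumT.
  - by apply/mapP; exists i; rewrite ?mem_enum.
have [i il ->] : exists2 i, (i < t)%N & q = nth (0, 0) l i.
  by move/(nthP (0, 0)): ql => [i]; rewrite sl => it <-; exists i.
rewrite -[LHS]/(lam (Ordinal il)) lamE big_seq big1 // => r rl'.
by rewrite mu0 // expr0n gtn_eqF // mulr0.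
Qed.

End IndependentPowers.
End FrobeniusIndependence.

(** * Frobenius on the tensor square *)

Section Tensor.
Variables (k : fieldType) (n : nat).
Local Notation mp := {mpoly k[n]}.
Local Notation mp2 := {mpoly k[n + n]}.

Lemma lembZ c (f : mp) : lemb (c *: f) = c *: lemb f.
Proof. by rewrite /lemb mmapZ mul_mpolyC. Qed.

Lemma rembZ c (f : mp) : remb (c *: f) = c *: remb f.
Proof. by rewrite /remb mmapZ mul_mpolyC. Qed.

Definition uncurry : mp2 -> {mpoly mp[n]} :=
  mmap (@mpolyC n mp \o @mpolyC n k)
       (join_pts (fun i => 'X_i) (fun i => ('X_i)%:MP)).

HB.instance Definition _ := GRing.RMorphism.copy uncurry
  (mmap (@mpolyC n mp \o @mpolyC n k)
        (join_pts (fun i => 'X_i) (fun i => ('X_i)%:MP))).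

Lemma uncurryD F F' : uncurry (F + F') = uncurry F + uncurry F'.
Proof. exact: raddfD. Qed.

Lemma uncurryM F F' : uncurry (F * F') = uncurry F * uncurry F'.
Proof. exact: rmorphM. Qed.

Lemma uncurry_lemb (f : mp) : uncurry (lemb f) = map_mpoly (@mpolyC n k) f.
Proof. by rewrite /uncurry (mmap_lemb (@mpolyC n mp \o @mpolyC n k)). Qed.

Lemma uncurry_remb (f : mp) : uncurry (remb f) = f%:MP.
Proof.
rewrite /uncurry (mmap_remb (@mpolyC n mp \o @mpolyC n k)).
by rewrite -[in RHS](mmap_id f) (rmorph_mmap (@mpolyC n mp)).
Qed.

Lemma uncurry_decomp F :
  F = \sum_(m <- msupp (uncurry F)) lemb 'X_[m] * remb (uncurry F)@_m.
Proof.
transitivity (mmap (@remb k n) (@lvars k n) (uncurry F)); last first.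
  by apply: eq_bigr => m _; rewrite mulrC /lemb mmapX.
rewrite /uncurry (rmorph_mmap (mmap (@remb k n) (@lvars k n))).
rewrite -[LHS]mmap_id; apply: eq_mmap => [c|i] /=.
  by rewrite mmapC /= /remb mmapC.
rewrite /join_pts -[i in LHS]splitK; case: (split i) => j /=.
  by rewrite mmapX mmap1U.
by rewrite mmapC /= /remb mmapX mmap1U.
Qed.

Section Ideal.
Variable J : mp -> Prop.
Hypothesis idJ : is_ideal J.

(* Membership in the ideal generated by the second copy of J is tested
   coefficientwise, viewing k[X, Y] as k[Y][X]. *)
Definition right_ideal (F : mp2) := forall m, J (uncurry F)@_m.

Lemma right_ideal_ideal : is_ideal right_ideal.
Proof.
split=> [m|F F' JF JF' m|F F' JF' m].
- by rewrite (rmorph0 uncurry) mcoeff0; case: idJ.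
- by rewrite uncurryD mcoeffD; apply: (is_idealD idJ); [apply: JF | apply: JF'].
- rewrite uncurryM mcoeffM; apply: (is_ideal_sum idJ) => mm _.
  exact: (is_idealM idJ).
Qed.

Lemma right_ideal_remb f : J f -> right_ideal (remb f).
Proof.
move=> Jf m; rewrite uncurry_remb mcoeffC; exact: (is_idealMr idJ).
Qed.

Lemma right_ideal_pair F : right_ideal F -> pair_ideal J F.
Proof.
move=> JF; rewrite [F]uncurry_decomp.
apply: (is_ideal_sum (pair_ideal_ideal J)) => m _.
apply: (is_idealM (pair_ideal_ideal J)); exact: pair_ideal_remb.
Qed.

Lemma tensor_coeff (l : seq (mp * mp)) m :
  (uncurry (\sum_(q <- l) lemb q.2 * remb q.1))@_m
  = \sum_(q <- l) q.2@_m *: q.1.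
Proof.
rewrite (rmorph_sum uncurry) (raddf_sum (mcoeff m)); apply: eq_bigr => q _ /=.
rewrite uncurryM uncurry_lemb uncurry_remb mulrC mcoeffCM mcoeff_map_mpoly.
by rewrite mulrC /= mul_mpolyC.
Qed.

Local Notation zact := (fun (c : k) (f : mp) => c *: f).
Local Notation jindep := (indep zact J).

Let JB a b : J a -> J b -> J (a - b). Proof. exact: (is_idealB idJ). Qed.

Let RB a b : right_ideal a -> right_ideal b -> right_ideal (a - b).
Proof. exact: (is_idealB right_ideal_ideal). Qed.

Let T (Q E : mp) : mp2 := lemb Q * remb E.

Let TDl f g a : T (f + g) a = T f a + T g a.
Proof. by rewrite /T rmorphD mulrDl. Qed.
Let TDr f a b : T f (a + b) = T f a + T f b.
Proof. by rewrite /T rmorphD mulrDr. Qed.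
Let TZ c f a : T (c *: f) a = T f (c *: a).
Proof.
by rewrite /T lembZ rembZ -scalerAl -scalerAr.
Qed.
Let TJ f a : J a -> right_ideal (T f a).
Proof.
by move=> Ja; apply: (is_idealM right_ideal_ideal); apply: right_ideal_remb.
Qed.

Lemma tensor_decomp F : exists l : seq (mp * mp),
  F = \sum_(q <- l) lemb q.2 * remb q.1.
Proof.
exists [seq ((uncurry F)@_m, 'X_[m]) | m <- msupp (uncurry F)].
by rewrite big_map {1}[F]uncurry_decomp.
Qed.

(** The part coming from the left copy of [J] is rewritten with left factors in [J] and eliminated
    modulo [right_ideal]. Relations modulo [right_ideal] alone have zero left factors, as seen
    coefficient by coefficient. *)
Lemma tensor_indep (l : seq (mp * mp)) : jindep (unzip1 l) ->
  pair_ideal J (\sum_(q <- l) lemb q.2 * remb q.1) ->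
  forall q, q \in l -> J q.2.
Proof.
move=> il [l1 [l2 [J1 J2 E]]].
have [l3 J3 E3] : exists2 l3 : seq (mp * mp), forall q, q \in l3 -> J q.2 &
    \sum_(p <- l1) p.1 * lemb p.2 = \sum_(q <- l3) lemb q.2 * remb q.1.
  elim: l1 J1 {E} => [|p l1 IH] J1.
    by exists [::]; rewrite ?big_nil.
  have [|l3 J3 E3] := IH; first by move=> q ql; apply: J1; rewrite inE ql orbT.
  have [l4 E4] := tensor_decomp p.1.
  exists ([seq (q.1, q.2 * p.2) | q <- l4] ++ l3) => [q|].
    rewrite mem_cat => /orP[/mapP[r _ ->]|/J3 //] /=.
    by apply: (is_idealM idJ); apply: J1; apply: mem_head.
  rewrite big_cons big_cat -E3 /=; congr (_ + _).
  rewrite E4 big_map mulr_suml; apply: eq_bigr => q _ /=.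
  by rewrite rmorphM /= mulrAC.
have subJ : subspace J.
  split=> [f g|c f Jf]; first exact: (is_idealD idJ).
  by rewrite -mul_mpolyC; apply: (is_idealM idJ).
apply: (indep_eliminate (is_ideal0 right_ideal_ideal) RB TDl TDr TZ TJ subJ _ il J3).
  move=> l' il' Kl' q ql'; suff -> : q.2 = 0 by case: idJ.
  apply/mpolyP => m; rewrite mcoeff0.
  have h := (jindepP idJ _).1 il' [seq (q.1, q.2@_m) | q <- l'].
  apply: (h _ _ (q.1, q.2@_m)).
  - by rewrite /unzip1 -map_comp.
  - by rewrite big_map /= -tensor_coeff.
  - by apply/mapP; exists q.
rewrite -E3 E addrC addKr; apply: (is_ideal_sum_mem right_ideal_ideal) => q ql.
by apply: (is_idealM right_ideal_ideal); apply: right_ideal_remb; apply: J2.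
Qed.

(** Treating the [g i] as a single vector gives them a common family of independent right
    factors. *)
Lemma vector_decomp t (g : 'I_t -> mp2) :
  exists2 l : seq (mp * {ffun 'I_t -> mp}), jindep (unzip1 l) &
    forall i, right_ideal (\sum_(q <- l) lemb (q.2 i) * remb q.1 - g i).
Proof.
pose U := {ffun 'I_t -> mp}; pose W := {ffun 'I_t -> mp2}.
pose T' (Q : U) (E : mp) : W := [ffun i => T (Q i) E].
pose K (w : W) := forall i, right_ideal (w i).
have K0 : K 0 by move=> i; rewrite ffunE; apply: (is_ideal0 right_ideal_ideal).
have KB a b : K a -> K b -> K (a - b).
  by move=> Ka Kb i; rewrite !ffunE; apply: RB.
have TDl' f g' a : T' (f + g') a = T' f a + T' g' a.
  by apply/ffunP => i; rewrite !ffunE TDl.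
have TDr' f a b : T' f (a + b) = T' f a + T' f b.
  by apply/ffunP => i; rewrite !ffunE TDr.
have TZ' c (f : U) a : T' (c *: f) a = T' f (zact c a).
  by apply/ffunP => i; rewrite !ffunE TZ.
have TJ' f a : J a -> K (T' f a).
  by move=> Ja i; rewrite ffunE; apply: TJ.
have [l0 E0] : exists l : seq (mp * U),
    forall i, g i = \sum_(q <- l) lemb (q.2 i) * remb q.1.
  have [L LP] := choice_fun (fun i => tensor_decomp (g i)).
  exists (flatten [seq [seq (q.1, [ffun j => if j == i then q.2 else 0]) |
                         q <- L i] | i <- enum 'I_t]) => i.
  rewrite big_flatten big_map enumT (bigD1 i) //= big_map.
  rewrite [X in _ = _ + X]big1 ?addr0 => [|j ji].
    by rewrite {1}LP; apply: eq_bigr => q _; rewrite ffunE eqxx.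
  rewrite big_map big1 // => q _.
  by rewrite ffunE eq_sym (negPf ji) rmorph0 mul0r.
have [l il Kl] := indep_rewrite K0 KB TDl' TDr' TZ' TJ' l0.
have ev (l1 : seq (mp * U)) i :
    (\sum_(q <- l1) T' q.2 q.1) i = \sum_(q <- l1) lemb (q.2 i) * remb q.1.
  by rewrite sum_ffunE; apply: eq_bigr => q _; rewrite ffunE.
have evB (a b : W) i : (a - b) i = a i - b i by rewrite !ffunE.
exists l; first exact: il.
by move=> i; have := Kl i; rewrite evB !ev -E0.
Qed.

End Ideal.

(** Decompose all members of the family over common right factors independent modulo [J]. Their
    [p]-th powers stay independent, so the relation splits into one relation modulo [J] for each
    right factor, to which [Ji] applies. *)
Lemma frob_indep_pair p (pk : p \in [pchar k]) (J : mp -> Prop) :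
  is_ideal J -> frob_indep p J -> frob_indep p (pair_ideal J).
Proof.
move=> idJ Ji l il Jl q0 q0l.
pose t := size l; pose c (i : 'I_t) := (nth (0, 0) l i).1.
pose g (i : 'I_t) := (nth (0, 0) l i).2.
have [L iL gL] := vector_decomp idJ g.
have idR := right_ideal_ideal idJ; have idP := pair_ideal_ideal J.
have lE (f : k * mp2 -> mp2) : \sum_(q <- l) f q = \sum_(i < t) f (c i, g i).
  rewrite (big_nth (0, 0)) big_mkord; apply: eq_bigr => i _.
  by rewrite /c /g -surjective_pairing.
pose Q' (Q : {ffun 'I_t -> mp}) := \sum_i c i *: Q i ^+ p.
have JQ' q : q \in L -> J (Q' q.2).
  pose L' := [seq (q.1 ^+ p, Q' q.2) | q <- L].
  have iL' : indep (fun (c : k) (f : mp) => c *: f) J (unzip1 L').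
    rewrite /L' /unzip1 -map_comp.
    have := indep_frobenius pk idJ Ji iL.
    by rewrite /unzip1 -map_comp.
  move=> qL; apply: (tensor_indep idJ iL' _ (q := (q.1 ^+ p, Q' q.2))); last first.
    by apply/mapP; exists q.
  apply: (is_idealBr idP Jl); apply: right_ideal_pair.
  rewrite lE -[X in right_ideal J X]opprB; apply: (is_idealN idR).
  have -> : \sum_(q <- L') lemb q.2 * remb q.1
     = \sum_i c i *: (\sum_(q <- L) lemb (q.2 i) * remb q.1) ^+ p.
    rewrite big_map; under [RHS]eq_bigr do rewrite expr_sum_p // scaler_sumr.
    rewrite exchange_big; apply: eq_bigr => r _ /=.
    rewrite /Q' (raddf_sum (@lemb k n)) mulr_suml; apply: eq_bigr => i _.
    by rewrite /= lembZ exprMn -!rmorphXn -scalerAl.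
  rewrite -sumrB; apply: (is_ideal_sum idR) => i _ /=.
  rewrite -scalerBr -mul_mpolyC; apply: (is_idealM idR).
  rewrite -opprB; apply: (is_idealN idR); apply: (is_idealXB idR); exact: gL.
have [i it ->] : exists2 i, (i < t)%N & q0 = nth (0, 0) l i.
  by move/(nthP (0, 0)): q0l => [i it <-]; exists i.
have gi : right_ideal J (g (Ordinal it) - \sum_(q <- L) lemb (q.2 (Ordinal it)) * remb q.1).
  by rewrite -opprB; apply: (is_idealN idR).
rewrite -[_.2]/(g (Ordinal it)).
apply: (is_idealBr idP _ (right_ideal_pair gi)).
apply: (is_ideal_sum_mem idP) => q qL; apply: (is_idealMr idP).
apply: pair_ideal_lemb.
apply: (Ji [seq (c i, (q.2 : {ffun 'I_t -> mp}) i) | i <- enum 'I_t] _ _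
  (c (Ordinal it), q.2 (Ordinal it))).
- have -> : unzip1 [seq (c i, (q.2 : {ffun 'I_t -> mp}) i) | i <- enum 'I_t]
     = unzip1 l; last by [].
  rewrite /unzip1 -map_comp; apply: (@eq_from_nth _ 0).
    by rewrite size_map size_enum_ord size_map.
  move=> j; rewrite size_map size_enum_ord => jt.
  rewrite (nth_map (Ordinal jt)) ?size_enum_ord // (nth_map (0, 0)) //.
  by rewrite /= /c nth_enum_ord.
- by rewrite big_map enumT; apply: JQ'.
- by apply/mapP; exists (Ordinal it); rewrite ?mem_enum.
Qed.

End Tensor.

(** * Smooth groups have injective relative Frobenius *)

Section SmoothLift.
Variables (k : fieldType) (G : affgrp k).
Hypothesis Gsm : smooth G.
Local Notation n := (gdim G).
Local Notation mp := {mpoly k[n]}.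
Local Notation I := (gideal G).

Lemma gideal_proper : ~ I 1.
Proof.
move=> I1; have := @gone_pts k G k idfun 1 I1; rewrite rmorph1 => /eqP.
by rewrite oner_eq0.
Qed.

Variables (r : nat) (y : 'I_r -> mp).
Hypotheses (Iy : forall i, I (y i)) (yI : forall f, I f -> idpow y 1 f).

Let idI : is_ideal I := idealP I.

Let idpow_I j f : idpow y j.+1 f -> I f.
Proof.
move=> [b _ ->]; apply: (is_ideal_sum idI) => i _; exact: (is_idealMr idI).
Qed.

(* Smoothness provides approximate retractions of affine space onto G. *)
Lemma smooth_retraction j : exists w : 'I_n -> mp,
  (forall i, I (w i - 'X_i)) /\
  forall f, I f -> idpow y j.+1 (mmap (@mpolyC n k) w f).
Proof.
elim: j => [|j [w [wX wI]]].
  exists (fun i => 'X_i); split=> [i|f If]; first by rewrite subrr; apply: ideal0.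
  by rewrite mmap_id; apply: yI.
have [|Q1 [pi1 [surj1 ker1]]] := quotient_ring (idpow_ideal y j.+2).
  by move=> /idpow_I; apply: gideal_proper.
(* The image of the [j.+1]-st power of the ideal in the quotient by the next power has square zero,
   so smoothness lifts the point given by [w]. *)
pose I1 (x : Q1) := exists2 a, idpow y j.+1 a & pi1 a = x.
have idI1 : is_ideal I1.
  split=> [|_ _ [a ya <-] [b yb <-]|x _ [b yb <-]].
  - by exists 0; [apply: (is_ideal0 (idpow_ideal _ _)) | rewrite rmorph0].
  - by exists (a + b); [apply: (is_idealD (idpow_ideal _ _)) | rewrite rmorphD].
  - have [a <-] := surj1 x; exists (a * b); last by rewrite rmorphM.
    exact: (is_idealM (idpow_ideal _ _)).
have I1P a : I1 (pi1 a) <-> idpow y j.+1 a.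
  split=> [[b yb] E|]; last by exists a.
  have /ker1/idpowS : pi1 (a - b) = 0 by rewrite rmorphB E subrr.
  exact: (is_idealBr (idpow_ideal _ _)).
have [|Q2 [q [surj2 ker2]]] := quotient_ring idI1.
  by rewrite -(rmorph1 pi1) => /I1P/idpow_I; apply: gideal_proper.
pose s : {rmorphism k -> Q1} := pi1 \o @mpolyC n k.
have mmap_s (t : 'I_n -> mp) f :
    mmap s (fun i => pi1 (t i)) f = pi1 (mmap (@mpolyC n k) t f).
  by rewrite rmorph_mmap.
have sq0 x1 x2 : q x1 = 0 -> q x2 = 0 -> x1 * x2 = 0.
  move=> /ker2[a ya <-] /ker2[b yb <-]; rewrite -rmorphM; apply/ker1.
  by apply: idpow_leq (idpow_mul ya yb); rewrite addSn addnS ltnS ltnS leq_addl.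
have Gv : gpts G (q \o s) (fun i => q (pi1 (w i))).
  move=> f If; have := rmorph_mmap q s (fun i => pi1 (w i)) f.
  by rewrite mmap_s => <-; apply/ker2/I1P/wI.
have [u Gu qu] := Gsm surj2 sq0 Gv.
have [w' w'u] := choice_fun (fun i => surj1 (u i)).
exists w'; split=> [i|f If].
  rewrite -[w' i](subrK (w i)) -addrA; apply: (is_idealD idI) => //.
  apply: (@idpow_I j); apply/I1P/ker2.
  by rewrite !rmorphB /= w'u qu subrr.
apply/ker1; rewrite -mmap_s -[RHS](Gu f If); exact: eq_mmap.
Qed.

End SmoothLift.

Section SmoothFrobenius.
Variables (k : fieldType) (p : nat).
Hypothesis pk : p \in [pchar k].
Variable n : nat.
Local Notation mp := {mpoly k[n]}.

Definition pdiv_mnm (m : 'X_{1..n}) := [forall i, (p %| m i)%N].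

(** A retraction of [k[X]] onto [k[X_1^p, ..., X_n^p]], linear over that subring. *)
Definition pproj (f : mp) : mp :=
  \sum_(m <- msupp f | pdiv_mnm m) f@_m *: 'X_[m].

Lemma pprojE f m : (pproj f)@_m = if pdiv_mnm m then f@_m else 0.
Proof.
rewrite (raddf_sum (mcoeff m)) /=.
under eq_bigr => m' _ do rewrite mcoeffZ mcoeffX.
have [fm|fm] := boolP (m \in msupp f); last first.
  rewrite (memN_msupp_eq0 fm) if_same big_seq_cond big1 // => m' /andP[fm' _].
  by case: eqP fm => [<-|]; rewrite ?fm' ?mulr0.
rewrite big_mkcond (bigD1_seq m) ?msupp_uniq //= eqxx mulr1 big1 ?addr0 //.
by move=> m' m'm; rewrite (negPf m'm) mulr0 if_same.
Qed.

Lemma pprojD f g : pproj (f + g) = pproj f + pproj g.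
Proof.
apply/mpolyP => m; rewrite mcoeffD !pprojE mcoeffD.
by case: ifP; rewrite ?addr0.
Qed.

Lemma pproj_sum I (r : seq I) (P : pred I) (F : I -> mp) :
  pproj (\sum_(i <- r | P i) F i) = \sum_(i <- r | P i) pproj (F i).
Proof.
apply: (big_morph _ pprojD); apply/mpolyP => m.
by rewrite pprojE mcoeff0 if_same.
Qed.

Lemma pprojZX c m : pproj (c *: 'X_[m]) = if pdiv_mnm m then c *: 'X_[m] else 0.
Proof.
apply/mpolyP => m'; rewrite pprojE (fun_if (mcoeff m')) mcoeff0 mcoeffZ mcoeffX.
by have [->|_] := eqVneq m m'; rewrite ?mulr0 ?if_same.
Qed.

Lemma pproj0 : pproj 0 = 0.
Proof. by rewrite /pproj msupp0 big_nil. Qed.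

Lemma pproj_mulXp f c m :
  pproj (f * (c *: 'X_[m *+ p])) = pproj f * (c *: 'X_[m *+ p]).
Proof.
elim/mpolyind: f => [|a m' f _ _ IH]; first by rewrite mul0r pproj0 mul0r.
rewrite mulrDl !pprojD mulrDl IH; congr (_ + _).
rewrite -scalerAl -scalerAr scalerA -mpolyXD !pprojZX.
have -> : pdiv_mnm (m' + m *+ p) = pdiv_mnm m'.
  apply: eq_forallb => i.
  by rewrite mnmDE mulmnE dvdn_addl // dvdn_mull.
case: ifP => _; last by rewrite mul0r.
by rewrite -scalerAl -scalerAr scalerA -mpolyXD.
Qed.

Lemma pproj_mulX f h : pproj (f * h ^+ p) = pproj f * h ^+ p.
Proof.
rewrite (mpoly_powE pk) !mulr_sumr pproj_sum; apply: eq_bigr => m _.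
exact: pproj_mulXp.
Qed.

Lemma pproj_pspan f : pspan p (fun _ => True) (pproj f).
Proof.
apply: pspan_sum => m /forallP pm.
have -> : 'X_[m] = 'X_[[multinom (m i %/ p)%N | i < n]] ^+ p :> mp.
  rewrite mpolyXn; congr 'X_[_]; apply/mnmP => i.
  by rewrite mulmnE mnmE divnK.
exact: pspanX.
Qed.

Lemma pproj_id g : pspan p (fun _ => True) g -> pproj g = g.
Proof.
move=> [l _ ->]; rewrite pproj_sum; apply: eq_bigr => q _.
rewrite -mul_mpolyC pproj_mulX; congr (_ * _).
rewrite -[_%:MP]mulr1 mul_mpolyC -mpolyX0 pprojZX ifT //.
by apply/forallP => i; rewrite mnm0E dvdn0.
Qed.

End SmoothFrobenius.

(** With [ev] the substitution of the retraction [w], split [g] as [(g - ev g) + ev g]. Since [g]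
    combines [p]-th powers, the first term combines [p]-th powers of differences [h - ev h], which
    lie in [I]. The second lies in a high power of [I], hence combines [p]-th powers of the
    generators [y]. *)
Lemma smooth_frob_closed (k : fieldType) p (pk : p \in [pchar k]) (G : affgrp k) :
  smooth G -> frob_closed p (gideal G).
Proof.
move=> Gsm g Pg Ig; set I := gideal G in Ig *.
have idI : is_ideal I := idealP I.
have [l lI lgen] := noetherian_mpoly (n := gdim G) (@noetherian_field k) idI.
pose y (i : 'I_(size l)) := nth 0 l i.
have Iy i : I (y i) by apply: lI; apply: mem_nth.
have yI f : I f -> idpow y 1 f.
  apply: lgen (idpow_ideal y 1) _ f => z /(nthP 0)[i il <-].
  exact: (idpow_gen y (Ordinal il)).
have [w [wX wI]] := smooth_retraction Gsm Iy yI (size l * p.-1).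
pose ev := mmap (@mpolyC (gdim G) k) w.
have evI f : I (f - ev f).
  rewrite -[X in X - _](mmap_id f) -opprB; apply: (is_idealN idI).
  exact: mmap_cong.
have Pev : pspan p (fun _ => True) (ev g).
  have [m _ ->] := Pg; rewrite /ev rmorph_sum; apply: pspan_sum => q _ /=.
  by rewrite mmapZ rmorphXn mul_mpolyC; apply: pspanX.
have Iev : pspan p I (ev g).
  have [b evE] := idpow_frobenius (ltnSn _) (wI _ Ig).
  (* The coefficients [b] are arbitrary polynomials. Applying [pproj] fixes the left side, commutes
     with the factors [y i ^+ p], and replaces the coefficients by combinations of [p]-th powers. *)
  rewrite -(pproj_id pk Pev) /ev evE pproj_sum; apply: pspan_sum => i _.
  rewrite (pproj_mulX pk); have [m _ ->] := pproj_pspan p (b i).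
  rewrite mulr_suml; apply: pspan_sum => q _.
  by rewrite -scalerAl -exprMn; apply: pspanX; apply: idealM.
rewrite -[g](subrK (ev g)); apply: pspanD => //.
have [m _ ->] := Pg; rewrite /ev rmorph_sum -sumrB; apply: pspan_sum => q _ /=.
rewrite mmapZ mul_mpolyC -scalerBr.
have -> : q.2 ^+ p - mmap (@mpolyC _ k) w (q.2 ^+ p) = (q.2 - ev q.2) ^+ p.
  rewrite rmorphXn /=; apply/eqP; rewrite subr_eq -(exprDp pk) subrK //.
by apply: pspanX.
Qed.

(** * The largest smooth subgroup *)

Section SmoothPart.
Variables (k : fieldType) (G : affgrp k).
Local Notation n := (gdim G).
Local Notation mp := {mpoly k[n]}.

Lemma subgrp_regular_char0 (H : subgrp G) : (forall m, m.+1%:R != 0 :> k) ->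
  regular_at (@gonep k G) (sideal H).
Proof.
move=> char0.
have [t [d [y [x [D [u [[Jy xe] [DD DJ] [Dx ue] ind sp]]]]]]] := local_frame H.
exact: (regular_char0 (idealP _) (@sideal_one k G H) Jy xe DD DJ Dx ue ind sp).
Qed.

Lemma subgrp_regular_charp p (H : subgrp G) : p \in [pchar k] ->
  frob_closed p (sideal H) -> regular_at (@gonep k G) (sideal H).
Proof.
move=> pk Hf.
have [t [d [y [x [D [u [[Jy xe] [DD DJ] [Dx ue] ind sp]]]]]]] := local_frame H.
exact: (regular_charp (idealP _) (@sideal_one k G H) Jy xe DD DJ Dx ue ind sp pk).
Qed.

Section Positive.
Variables (p : nat) (M : subgrp G).
Hypothesis pk : p \in [pchar k].

(* The smallest ideal containing that of M whose quotient has injective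
   relative Frobenius. *)
Definition sm_mem (f : mp) := forall J : mp -> Prop,
  is_ideal J -> frob_indep p J -> (forall g, sideal M g -> J g) -> J f.

Lemma sm_ideal : is_ideal sm_mem.
Proof.
split=> [J idJ _ _|f g Hf Hg J idJ Ji JM|f g Hg J idJ Ji JM].
- by case: idJ.
- by apply: (is_idealD idJ); [apply: Hf | apply: Hg].
- by apply: (is_idealM idJ); apply: Hg.
Qed.

(** Both the hypothesis and the conclusion of [frob_indep] are memberships in the ideal, so the
    property passes to intersections. *)
Lemma sm_indep : frob_indep p sm_mem.
Proof.
move=> l il Jl q ql J idJ Ji JM; apply: (Ji l il) => //; exact: Jl.
Qed.

Lemma sm_sub f : sideal M f -> sm_mem f.
Proof. by move=> Mf J _ _; apply. Qed.

Lemma sm_preim n' (h : {rmorphism mp -> {mpoly k[n']}}) (J : {mpoly k[n']} -> Prop) :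
  (forall c, h c%:MP = c%:MP) -> is_ideal J -> frob_indep p J ->
  (forall g, sideal M g -> J (h g)) -> forall f, sm_mem f -> J (h f).
Proof.
move=> hC idJ Ji JM f smf; apply: (smf (J \o h)); [|exact: frob_indep_preim|exact: JM].
have JD a b : J (h a) -> J (h b) -> J (h (a + b)).
  by move=> Ja Jb; rewrite rmorphD; apply: (is_idealD idJ).
have JX a b : J (h b) -> J (h (a * b)).
  by move=> Jb; rewrite rmorphM; apply: (is_idealM idJ).
by apply: (IsIdeal _ JD JX); rewrite /= rmorph0; apply: (is_ideal0 idJ).
Qed.

Definition smooth_part : subgrp G.
Proof.
refine (@SubGrp k G (mkideal sm_ideal) _ _ _ _).
- by move=> f Gf; apply: sm_sub; apply: sideal_sub Gf.
- move=> R s u v su sv f smf.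
  have [l1 [l2 [J1 J2 E]]] : pair_ideal sm_mem (comul f).
    (* The preimage of the pair ideal under comultiplication contains the ideal of [M] and has
       injective Frobenius, so by minimality it contains [sm_mem]. *)
    apply: (sm_preim (h := @comul k G) _ (pair_ideal_ideal _)) smf => [c||g Mg].
    + exact: mmapC.
    + exact: (frob_indep_pair pk sm_ideal sm_indep).
    + have [l1 [l2 [J1 J2 E]]] := comul_pair_ideal Mg.
      by exists l1, l2; split=> // q ql; apply: sm_sub; [apply: J1 | apply: J2].
  rewrite -mmap_comul E rmorphD !rmorph_sum big_seq big1 => [|q /J1 sq]; last first.
    by rewrite rmorphM /= mmap_lemb (su _ sq) mulr0.
  rewrite big_seq big1 ?addr0 // => q /J2 sq.
  by rewrite rmorphM /= mmap_remb (sv _ sq) mulr0.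
- move=> R s f smf.
  suff fe : f.@[@gonep k G] = 0.
    have <- : mmap s (s \o @gonep k G) f = mmap s (gone G s) f by [].
    by rewrite -(rmorph0 s) -fe [in RHS](rmorph_mmap s).
  have eD a b : a.@[@gonep k G] = 0 -> b.@[@gonep k G] = 0 -> (a + b).@[@gonep k G] = 0.
    by move=> a0 b0; rewrite mevalD a0 b0 addr0.
  have eM a b : b.@[@gonep k G] = 0 -> (a * b).@[@gonep k G] = 0.
    by move=> b0; rewrite mevalM b0 mulr0.
  apply: (smf (fun g => g.@[@gonep k G] = 0)); last exact: sideal_one.
    by apply: (IsIdeal _ eD eM); rewrite meval0.
  exact: frob_indep_eval.
- move=> R s u su f smf.
  have : sm_mem (mmap (@mpolyC n k) (@ginvp k G) f).
    apply: (sm_preim (h := mmap (@mpolyC n k) (@ginvp k G))) smf => [c||| g Mg].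
    + exact: mmapC.
    + exact: sm_ideal.
    + exact: sm_indep.
    apply: sm_sub.
    have Mx : zeros_mod (@mpolyC n k) (sideal M) (sideal M) (fun i => 'X_i).
      by move=> h Mh; rewrite mmap_id.
    have := sinv_mod (idealP (sideal M)) Mx Mg; congr (sideal M _).
    by apply: eq_mmap => // i; rewrite /ginv mmap_id.
  by move=> /su; rewrite mmap_comp.
Defined.

(** The ideal of a smooth [S] inside [M] has injective Frobenius and contains that of [M], so it is
    among those that [sm_mem] intersects. *)
Lemma smooth_partP : smooth G -> is_smooth_part M smooth_part.
Proof.
move=> Gsm; split.
  split; first exact: sm_sub.
  apply: regular_smooth Gsm _; apply: (subgrp_regular_charp pk).
  exact: (frob_indep_closed pk sm_indep).
move=> S [SM Ssm] f smf; apply: smf SM; first exact: idealP.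
apply: (frob_closed_indep pk (idealP _)).
exact: (smooth_frob_closed pk Ssm).
Qed.

End Positive.

(** When no prime is the characteristic, Cartier's theorem makes [M] itself smooth. *)
Lemma exists_smooth_part (M : subgrp G) : smooth G ->
  exists S, is_smooth_part M S.
Proof.
move=> Gsm; case: (classic (exists p, p \in [pchar k])) => [[p pk] | char0].
  by exists (smooth_part M pk); apply: smooth_partP.
exists M; split; last by move=> S [].
split; first by [].
apply: regular_smooth Gsm _; apply: subgrp_regular_char0 => m.
have /pcharf0P -> // : [pchar k] =i pred0.
by move=> p; apply/negP => pk; apply: char0; exists p.
Qed.

End SmoothPart.

Theorem proposition4p1
  (k : fieldType)
  (* an algebraic closure of k *)
  (kbar : closedFieldType) (iota : {rmorphism k -> kbar})
  (kbarP : algebraic_closure iota)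
  (G : affgrp k) (Gpr : pseudo_reductive G)
  (* k'/k, the minimal field of definition inside kbar of R_u(G_kbar) *)
  (Rubar : subgrp (bc_grp iota G)) (RubarP : is_Ru Rubar)
  (k' : fieldExtType k) (e' : {rmorphism k' -> kbar})
  (k'P : min_field_of_definition (in_alg k') e' Rubar)
  (* pi' : G_k' -> G' = G_k' / R_u(G_k') *)
  (Ru' : subgrp (bc_grp (in_alg k') G)) (Ru'P : is_Ru Ru')
  (G' : affgrp k') (pi' : grp_hom (bc_grp (in_alg k') G) G')
  (pi'P : is_quotient Ru' pi')
  (H' : subgrp G') :
  exists M Msm : subgrp G,
    [/\ (* M is the preimage of R_{k'/k}(H') under i_G *)
        is_iG_preimage pi' H' M,
        (* Msm is M^sm *)
        is_smooth_part M Msm,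
        (exists H : subgrp G, levitation pi' H' H) ->
          is_largest (levitation pi' H') M &
        (exists H : subgrp G, smooth_levitation pi' H' H) ->
          is_largest (smooth_levitation pi' H') Msm].
Proof.
have [Gsm _ _] := Gpr.
have [S SP] := exists_smooth_part (iG_preimage pi' H') Gsm.
exists (iG_preimage pi' H'), S; split=> //.
- exact: iG_preimageP.
- exact: largest_levitation.
- exact: largest_smooth_levitation.
Qed.
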